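(* Let $X$ be a Ramanujan $\widetilde A_2$-complex of density $q$, and let $m\ge1$. The degree of $\mathcal A_m$ on $X$ is $k=2(q^2+q+1)q^{2(m-1)}$, and the largest absolute value $\lambda^{(m)}$ of a nontrivial eigenvalue of $\mathcal A_m$ satisfies $$\lambda^{(m)}\le(m^2+3m+2)q^m-2(m^2-1)q^{m-1}+(m^2-3m+2)q^{m-2},$$ so that the largest normalized nontrivial eigenvalue of $\mathcal A_m$ satisfies $\frac{\lambda^{(m)}}{k}\le\frac{m^2+3m+2}{q^m}$. The trivial spectrum of $\mathcal A_m$, including multiplicities, is $$\begin{cases}\{k\} & X\text{ is non-tripartite},\\ \{k,-\frac k2,-\frac k2\} & X\text{ is tripartite and }3\nmid m,\\ \{k,k,k\} & X\text{ is tripartite and }3\mid m.\end{cases}$$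
   Context: Let $F$ be a non-archimedean local field with ring of integers $\mathcal O$, uniformizer $\pi$ and residue field $\mathbb F_q$. The building $\mathcal B=\mathcal B_3(F)$ is the 2-dimensional clique complex whose vertices are homothety classes of $\mathcal O$-lattices in $F^3$ (identified with $PGL_3(F)/PGL_3(\mathcal O)$ via $gK\mapsto g\mathcal O^3$), two distinct classes being adjacent iff they have representatives with $\pi L<L'<L$. Vertices are colored by $\mathrm{col}(gK)=\mathrm{ord}_\pi\det g\in\mathbb Z/3\mathbb Z$, and directed edges by $\mathrm{col}(v\to w)=\mathrm{col}(w)-\mathrm{col}(v)\in\{1,2\}$. An $\widetilde A_2$-complex of density $q$ is a quotient $X=\Gamma\backslash\mathcal B$ by a cocompact lattice $\Gamma\le PGL_3(F)$ acting on $\mathcal B$ without fixed points; it is a finite simplicial complex with fundamental group $\Gamma$ and inherits the edge coloring. $X$ is tripartite if $\Gamma$ preserves vertex colors. For $j=1,2$, on $\mathcal B$ and on $X$, $(A_jf)(v)=\sum_{w\sim v,\ \mathrm{col}(v\to w)=j}f(w)$; each $A_j$ is regular of degree $q^2+q+1$, and eigenvalues of $A_j$ on $L^2(X(0))$ of absolute value $q^2+q+1$ are called trivial. $X$ is Ramanujan if for $j=1,2$ every eigenvalue of $A_j$ on $L^2(X(0))$ is either trivial or contained in the spectrum of $A_j$ acting on $L^2(\mathcal B(0))$. An $m$-geodesic (of color one) is a sequence of vertices $v_0,\dots,v_m$ with $\{v_i,v_{i+1}\}$ an edge, $v_{i+2}\ne v_i$, $\{v_i,v_{i+1},v_{i+2}\}$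 not a triangle of the complex, and $\mathrm{col}(v_i\to v_{i+1})=1$. The operator $\mathcal A_m$ on $L^2(X(0))$ is $(\mathcal A_mf)(v)=\sum_w f(w)$, where $w$ runs over the endpoints of $m$-geodesics starting at $v$ together with the starting points of $m$-geodesics ending at $v$ (counted with multiplicity, one term per geodesic; equivalently, $\mathcal A_m$ is induced on the quotient $X$ by the corresponding operator on $\mathcal B$). In particular $\mathcal A_1=A_1+A_2$. An eigenvalue of $\mathcal A_m$ is called trivial if its eigenfunction is an eigenfunction of $A_1,A_2$ with eigenvalues of absolute value $q^2+q+1$. *)

(* Defs.v *)
From HB Require Import structures.
From mathcomp Require Import all_boot all_order all_algebra.
From mathcomp Require Import all_classical all_reals all_analysis.
From mathcomp Require Import complex.

Set Implicit Arguments.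
Unset Strict Implicit.
Unset Printing Implicit Defensive.

Import Order.TTheory GRing.Theory Num.Theory.
Local Open Scope classical_set_scope.
Local Open Scope ring_scope.

(** * Non-archimedean local fields *)

(* [ord 0] is a junk value; [ord_ideal ord n] is the fractional ideal
   [pi^n O], hence [ord_ideal ord 0] is the valuation ring. *)
Definition ord_ideal (F : fieldType) (ord : F -> int) (n : int) : set F :=
  [set x | x = 0 \/ n <= ord x].

Definition residue_classes (F : fieldType) (ord : F -> int) : set (set F) :=
  [set [set y | ord_ideal ord 1 (y - x)] | x in ord_ideal ord 0].

(* A field complete for a normalized discrete valuation with finite residue
   field, together with a uniformizer. *)
Record localField := LocalField {
  lf_field :> fieldType;
  ord : lf_field -> int;
  unif : lf_field;
  ordM : forall x y, x != 0 -> y != 0 -> ord (x * y) = ord x + ord y;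
  ordD : forall x y, x != 0 -> y != 0 -> x + y != 0 ->
    Num.min (ord x) (ord y) <= ord (x + y);
  unif_neq0 : unif != 0;
  ord_unif : ord unif = 1;
  lf_complete : forall u : nat -> lf_field,
    (forall n : int, exists N : nat, forall i j : nat,
      (N <= i)%N -> (N <= j)%N -> ord_ideal ord n (u i - u j)) ->
    exists l : lf_field, forall n : int, exists N : nat, forall i : nat,
      (N <= i)%N -> ord_ideal ord n (u i - l);
  lf_residue_finite : finite_set (residue_classes ord)
}.

Definition frac_ideal (F : localField) (n : int) : set F := ord_ideal (@ord F) n.
Arguments frac_ideal : clear implicits.

Definition residue_field (F : localField) : set (set F) :=
  residue_classes (@ord F).
Arguments residue_field : clear implicits.

(** * The building of PGL_3(F) *)

Definition std_lattice (F : localField) : set 'cV[F]_3 :=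
  [set x | forall i, frac_ideal F 0 (x i 0)].
Arguments std_lattice : clear implicits.

Definition lat_act (F : localField) (g : 'M[F]_3) (L : set 'cV[F]_3) :
  set 'cV[F]_3 := [set g *m x | x in L].

Definition homothety_class (F : localField) (L : set 'cV[F]_3) :
  set (set 'cV[F]_3) := [set lat_act c%:M L | c in [set c : F | c != 0]].

Definition vertex (F : localField) : Type :=
  set_type [set homothety_class (lat_act g (std_lattice F)) |
            g in [set g : 'M[F]_3 | g \in unitmx]].
Arguments vertex : clear implicits.
HB.instance Definition _ (F : localField) := Choice.on (vertex F).

Definition adj (F : localField) (v w : vertex F) : Prop :=
  v <> w /\
  exists L L' : set 'cV[F]_3,
    [/\ val v L, val w L', lat_act (unif F)%:M L `<` L' & L' `<` L].

(* Some [g] in GL_3(F) with [v = gK]. *)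
Definition frame (F : localField) (v : vertex F) : 'M[F]_3 :=
  xget 1%:M [set g : 'M[F]_3 | g \in unitmx /\
             val v = homothety_class (lat_act g (std_lattice F))].

Definition color (F : localField) (v : vertex F) : 'Z_3 :=
  (ord (\det (frame v)))%:~R.

Definition edge_color (F : localField) (v w : vertex F) : 'Z_3 :=
  color w - color v.

Definition simplex (F : localField) (s : set (vertex F)) : Prop :=
  [/\ finite_set s, s !=set0 &
      forall v w, s v -> s w -> v <> w -> adj v w].

Definition triangle (F : localField) (u v w : vertex F) : Prop :=
  [/\ adj u v, adj v w & adj u w].

(* [moves g v w] reads [g v = w], for [g] in GL_3(F). *)
Definition moves (F : localField) (g : 'M[F]_3) (v w : vertex F) : Prop :=
  val w = [set lat_act g L | L in val v].

(* Points of the geometric realization, in barycentric coordinates. *)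
Definition realization (R : realType) (F : localField) :
  set (vertex F -> R) :=
  [set x | exists s, [/\ simplex s, forall v, 0 <= x v,
     forall v, x v <> 0 -> s v & \sum_(v \in s) x v = 1]].
Arguments realization : clear implicits.

Definition fixes_point (R : realType) (F : localField) (g : 'M[F]_3)
    (x : vertex F -> R) : Prop :=
  forall v w, moves g v w -> x w = x v.

(** * Cocompact lattices in PGL_3(F) *)

(* A subgroup of PGL_3(F) is given by its full preimage in GL_3(F), i.e. by a
   subgroup of GL_3(F) containing the nonzero scalar matrices. *)
Definition pgl_subgroup (F : localField) (Gamma : set 'M[F]_3) : Prop :=
  [/\ forall g, Gamma g -> g \in unitmx,
      forall c : F, c != 0 -> Gamma c%:M,
      forall g h, Gamma g -> Gamma h -> Gamma (g *m h) &
      forall g, Gamma g -> Gamma (invmx g)].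

Definition mx_ball (F : localField) (g : 'M[F]_3) (n : int) : set 'M[F]_3 :=
  [set h | forall i j, frac_ideal F n (h i j - g i j)].

Definition open_GL (F : localField) (U : set 'M[F]_3) : Prop :=
  U `<=` [set g | g \in unitmx] /\
  forall g, U g -> exists n : int,
    mx_ball g n `&` [set h | h \in unitmx] `<=` U.

(* Some neighbourhood of 1 in PGL_3(F) meets the subgroup only in 1. *)
Definition discrete_subgroup (F : localField) (Gamma : set 'M[F]_3) : Prop :=
  exists U : set 'M[F]_3, [/\ open_GL U, U 1%:M &
    forall g, Gamma g -> U g -> is_scalar_mx g].

(* Compactness of the quotient of PGL_3(F) by the subgroup: the open subsets
   of this quotient are the open subsets of GL_3(F) invariant under the
   preimage [Gamma] of the subgroup. *)
Definition cocompact (F : localField) (Gamma : set 'M[F]_3) : Prop :=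
  forall D : set (set 'M[F]_3),
    (forall U, D U -> open_GL U /\
      forall g h, Gamma g -> U h -> U (g *m h)) ->
    [set g | g \in unitmx] `<=` \bigcup_(U in D) U ->
    exists D' : set (set 'M[F]_3), [/\ finite_set D', D' `<=` D &
      [set g | g \in unitmx] `<=` \bigcup_(U in D') U].

Definition acts_freely (R : realType) (F : localField)
    (Gamma : set 'M[F]_3) : Prop :=
  forall g, Gamma g -> ~~ is_scalar_mx g ->
  forall x, realization R F x -> ~ fixes_point g x.
Arguments acts_freely R {F} Gamma.

Definition A2tilde_group (R : realType) (F : localField)
    (Gamma : set 'M[F]_3) : Prop :=
  [/\ pgl_subgroup Gamma, discrete_subgroup Gamma, cocompact Gamma &
      acts_freely R Gamma].
Arguments A2tilde_group R {F} Gamma.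

Definition tripartite (F : localField) (Gamma : set 'M[F]_3) : Prop :=
  forall g, Gamma g -> forall v w, moves g v w -> color w = color v.

(** * Vertices of the quotient complex *)

Definition vorbit (F : localField) (Gamma : set 'M[F]_3) (v : vertex F) :
  set (vertex F) := [set w | exists2 g, Gamma g & moves g v w].

Definition qvertex (F : localField) (Gamma : set 'M[F]_3) : Type :=
  set_type (range (vorbit Gamma)).

Definition vproj (F : localField) (Gamma : set 'M[F]_3) (v : vertex F) :
  qvertex Gamma := SigSub (mem_set (imageT (vorbit Gamma) v)).

Definition vlift (F : localField) (Gamma : set 'M[F]_3) (x : qvertex Gamma) :
  vertex F := projT1 (cid2 (set_mem (valP x))).

(* The operator induced on functions on the vertices of the quotient by an
   operator on functions on the vertices of the building. For an operator
   commuting with the group, the choice of lifts does not matter. *)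
Definition quotient_op (F : localField) (Gamma : set 'M[F]_3) (C : Type)
    (T : (vertex F -> C) -> (vertex F -> C)) (f : qvertex Gamma -> C) :
  qvertex Gamma -> C := fun x => T (f \o @vproj F Gamma) (vlift x).

(** * Hecke and geodesic operators *)

Definition Aop (C : nmodType) (F : localField) (j : 'Z_3)
    (f : vertex F -> C) : vertex F -> C :=
  fun v => \sum_(w \in [set w | adj v w /\ edge_color v w = j]) f w.

Definition pstart (T : Type) (m : nat) (p : m.+1.-tuple T) : T :=
  tnth p ord0.

Definition pend (T : Type) (m : nat) (p : m.+1.-tuple T) : T :=
  tnth p ord_max.

Definition geodesic (F : localField) (m : nat)
    (p : m.+1.-tuple (vertex F)) : Prop :=
  let v i := nth (pstart p) p i in
  (forall i, (i < m)%N -> adj (v i) (v i.+1) /\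
                          edge_color (v i) (v i.+1) = 1) /\
  (forall i, (i.+1 < m)%N -> v i.+2 <> v i /\
                             ~ triangle (v i) (v i.+1) (v i.+2)).

(* The terms of the sum defining [(A_m f)(v)]: the pairs [(p, true)] with [p] a
   geodesic starting at [v], contributing [f] of its endpoint, and the pairs
   [(p, false)] with [p] a geodesic ending at [v], contributing [f] of its
   starting point. *)
Definition geodesic_terms (F : localField) (m : nat) (v : vertex F) :
  set (m.+1.-tuple (vertex F) * bool) :=
  [set t | geodesic t.1 /\ (if t.2 then pstart t.1 else pend t.1) = v].
Arguments geodesic_terms {F} m v.

Definition geodesic_op (C : nmodType) (F : localField) (m : nat)
    (f : vertex F -> C) : vertex F -> C :=
  fun v => \sum_(t \in geodesic_terms m v)
             f (if t.2 then pend t.1 else pstart t.1).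

(** * Spectra *)

Section L2.
Variables (R : realType) (V : choiceType).
Local Notation C := R[i].

Definition norm2sq (f : V -> C) : \bar R :=
  \esum_(v in [set: V]) ((ComplexField.Normc.normc (f v)) ^+ 2)%:E.

Definition l2 : set (V -> C) := [set f | (norm2sq f < +oo)%E].

Definition l2_bounded_operator (S : (V -> C) -> (V -> C)) : Prop :=
  [/\ forall f, l2 f -> l2 (S f),
      forall (a : C) f g, l2 f -> l2 g ->
        S (fun v => a * f v + g v) = (fun v => a * S f v + S g v) &
      exists c : R, forall f, l2 f -> (norm2sq (S f) <= c%:E * norm2sq f)%E].

Definition l2_spectrum (T : (V -> C) -> (V -> C)) : set C :=
  [set lam | ~ exists S, l2_bounded_operator S /\
    forall f, l2 f ->
      S (fun v => T f v - lam * f v) = f /\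
      (fun v => T (S f) v - lam * S f v) = f].

End L2.

Section QuotientSpectra.
Variables (R : realType) (F : localField) (Gamma : set 'M[F]_3).
Local Notation C := R[i].

(* As the quotient has finitely many vertices, every function on them is
   square summable. *)
Local Notation L2X := (qvertex Gamma -> C).

Definition eigenfunction (T : L2X -> L2X) (lam : C) (f : L2X) : Prop :=
  (exists x, f x <> 0) /\ forall x, T f x = lam * f x.

Definition eigenvalue_of (T : L2X -> L2X) (lam : C) : Prop :=
  exists f, eigenfunction T lam f.

Definition AX (j : 'Z_3) : L2X -> L2X := quotient_op (Aop j).

Definition geodesic_opX (m : nat) : L2X -> L2X := quotient_op (geodesic_op m).

Definition Aop_trivial (q : nat) (lam : C) : Prop :=
  ComplexField.Normc.normc lam = (q ^ 2 + q + 1)%:R.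

Definition ramanujan (q : nat) : Prop :=
  forall j : 'Z_3, j = 1 \/ j = 2%:R ->
  forall lam : C, eigenvalue_of (AX j) lam ->
    Aop_trivial q lam \/ l2_spectrum (@Aop C F j) lam.

Definition trivial_eigenfunction (q : nat) (f : L2X) : Prop :=
  forall j : 'Z_3, j = 1 \/ j = 2%:R ->
  exists2 lam : C, eigenfunction (AX j) lam f & Aop_trivial q lam.

Definition lin_comb (n : nat) (e : 'I_n -> L2X) (a : 'I_n -> C) : L2X :=
  fun x => \sum_(i < n) a i * e i x.

Definition span_of (P : set L2X) : set L2X :=
  [set f | exists n (e : 'I_n -> L2X) (a : 'I_n -> C),
     (forall i, P (e i)) /\ f = lin_comb e a].

(* [mu] is a nontrivial eigenvalue if its eigenspace does not consist only of
   combinations of trivial eigenfunctions. So multiplicities are taken into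
   account: a value of the trivial spectrum may also occur as a nontrivial
   eigenvalue, and sums of trivial eigenfunctions for different eigenvalues of
   A_1 and A_2 do not count as nontrivial. *)
Definition nontrivial_eigenvalue (q m : nat) : set C :=
  [set mu | exists f, eigenfunction (geodesic_opX m) mu f /\
                      ~ span_of (trivial_eigenfunction q) f].

(* [s] lists, with multiplicities, the eigenvalues of A_m on a basis of the
   span of the trivial eigenfunctions. *)
Definition trivial_spectrum (q m : nat) (s : seq C) : Prop :=
  exists e : 'I_(size s) -> L2X,
    [/\ forall i, trivial_eigenfunction q (e i) /\
                  eigenfunction (geodesic_opX m) s`_i (e i),
        forall a, lin_comb e a = (fun=> 0) -> forall i, a i = 0 &
        forall f, trivial_eigenfunction q f -> exists a, f = lin_comb e a].

(* The largest absolute value of a nontrivial eigenvalue (0 if there is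
   none). *)
Definition lambda_max (q m : nat) : R :=
  sup [set ComplexField.Normc.normc mu | mu in nontrivial_eigenvalue q m].

End QuotientSpectra.
Arguments ramanujan R {F} Gamma q.
Arguments nontrivial_eigenvalue R {F} Gamma q m.
Arguments trivial_spectrum {R F} Gamma q m s.
Arguments lambda_max R {F} Gamma q m.

(* Main.v *)
(* Inclusion-exclusion in the links, which are projective planes of order q,
   expresses the sum T_m over the endpoints of color-one m-geodesics by
     T_(m+3) = A_1 T_(m+2) - q A_2 T_(m+1) + q^3 T_m   (m >= 1),
   so on a joint eigenfunction with eigenvalues q e_1(z), q e_2(z), where
   z_1 z_2 z_3 = 1, T_m acts by a multiple of q^m times the Hall-Littlewood
   polynomial of the row (m) at t = 1/q. If all |z_i| = 1, its modulus is at
   most its value c_m at z = (1, 1, 1), a polynomial in m times q^m.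

   The spectrum of A_1 on L^2 of the building is tempered in this sense. The
   positive horospherical function with parameters (1, 1, 1) is a Schur test
   function, giving ||T_m|| <= c_m; if some |z_i| <> 1, the eigenvalue of T_m
   grows exponentially and eventually beats c_m. As T_m is a polynomial in
   A_1 - lam and its adjoint plus that eigenvalue, and A_1 is normal, this bounds
   A_1 - lam and its adjoint from below, and a Neumann series inverts it.

   On the finite quotient, A_1 and A_2 are adjoint and commute, hence have a
   joint orthogonal eigenbasis; an eigenfunction that is not trivial is tempered
   by the Ramanujan property, and both directions of geodesics add up to 2 c_m.
   Equality in the triangle inequality forces a trivial eigenfunction to be a
   multiple of zeta^color with zeta^3 = 1. It descends to the quotient always
   if zeta = 1 and otherwise iff the group preserves colors, with the eigenvalue
   (k/2) (zeta^m + zeta^(2m)). *)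
Require Import Defs.
From mathcomp Require Import all_boot all_order all_algebra.
From mathcomp Require Import all_classical all_reals all_analysis.
From mathcomp Require Import complex.
From mathcomp Require Import spectral zify ring lra.
Set Implicit Arguments.
Unset Strict Implicit.
Unset Printing Implicit Defensive.
Import Order.TTheory GRing.Theory Num.Theory.
Import numFieldNormedType.Exports.
Import complex.
Local Open Scope classical_set_scope.
Local Open Scope ring_scope.

(** * Geodesics in a digraph with projective-plane links *)

(** The analysis sees the building only through the incidence axioms of [plane_links] and the
    positive function [psi]; lattices serve to verify these and to handle the quotient. A single
    eigenvalue of T_m may be small by cancellation between its three exponentials, so a second-order
    difference operator first isolates the dominant one. All norms are squared, and the crude bound
    |x + y|^2 <= 2 |x|^2 + 2 |y|^2 costs the factor 2 in 2 c_m^2, harmless against exponential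
    growth. Estimates are made on functions of finite support and on finite windows of vertices;
    they extend to L^2 because every operator involved has finite range. As A_1 is normal with
    adjoint A_2, an eigenvalue lam of A_1 comes with its conjugate for A_2, exactly on the quotient
    and approximately on the building. This is why spectral arguments evaluate [geo_eig] at lam and
    its conjugate. *)

Section Digraph.
Variables (V : eqType) (outs ins : V -> seq V).

Definition nsum (Z : nmodType) (f : V -> Z) (v : V) : Z :=
  \sum_(w <- outs v) f w.

(** For color-one edges u -> v -> w, being geodesic means that there is no edge from w back to u
    ([edge1_triangle]), which is what the filter tests. *)
Fixpoint geo_ext (m : nat) (u v : V) : seq (seq V) :=
  if m is m'.+1 then
    [seq w :: p | w <- [seq w <- outs v | u \notin outs w], p <- geo_ext m' v w]
  else [:: [::]].

Definition geo_from (m : nat) (v : V) : seq (seq V) :=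
  if m is m'.+1 then [seq w :: p | w <- outs v, p <- geo_ext m' v w]
  else [:: [::]].

Definition gext (Z : nmodType) m (f : V -> Z) (u v : V) : Z :=
  \sum_(p <- geo_ext m u v) f (last v p).

Definition gsum (Z : nmodType) m (f : V -> Z) (v : V) : Z :=
  \sum_(p <- geo_from m v) f (last v p).

Lemma gext0 (Z : nmodType) (f : V -> Z) u v : gext 0 f u v = f v.
Proof. by rewrite /gext /= big_seq1. Qed.

Lemma gextS (Z : nmodType) m (f : V -> Z) u v :
  gext m.+1 f u v = \sum_(w <- outs v | u \notin outs w) gext m f v w.
Proof. by rewrite /gext /= big_allpairs_dep big_filter. Qed.

Lemma gsum0 (Z : nmodType) (f : V -> Z) v : gsum 0 f v = f v.
Proof. by rewrite /gsum /= big_seq1. Qed.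

Lemma gsumS (Z : nmodType) m (f : V -> Z) v :
  gsum m.+1 f v = \sum_(w <- outs v) gext m f v w.
Proof. by rewrite /gsum /= big_allpairs_dep. Qed.

Lemma gsum1 (Z : nmodType) (f : V -> Z) v : gsum 1 f v = nsum f v.
Proof. by rewrite gsumS; apply: eq_bigr => w _; rewrite gext0. Qed.

End Digraph.

(* The local structure of the digraph of color-one edges: [outs v] and [ins v]
   are the lines and the points of a projective plane of order [q], with [u]
   incident to [w] iff there is a triangle [v -> w -> u -> v]. *)
Record plane_links (V : eqType) (outs ins : V -> seq V) (q : nat) : Prop :=
  PlaneLinks {
  outs_uniq : forall v, uniq (outs v);
  ins_uniq : forall v, uniq (ins v);
  mem_ins : forall v w, (v \in ins w) = (w \in outs v);
  size_outs : forall v, size (outs v) = (q ^ 2 + q + 1)%N;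
  size_ins : forall v, size (ins v) = (q ^ 2 + q + 1)%N;
  triangle_count : forall v w, w \in outs v ->
    count (fun u => v \in outs u) (outs w) = q.+1;
  outs_meet : forall v w w', w != w' -> w \in outs v -> w' \in outs v ->
    count (fun u => (u \in outs w) && (u \in outs w')) (ins v) = 1%N;
  ins_join : forall v w w', w != w' -> w \in ins v -> w' \in ins v ->
    count (fun u => (w \in outs u) && (w' \in outs u)) (outs v) = 1%N
}.

Lemma plane_links_rev (V : eqType) (outs ins : V -> seq V) q :
  plane_links outs ins q -> plane_links ins outs q.
Proof.
case=> uo ui mi so si tc om ij; split => //.
- move=> v w wv.
  rewrite mi in wv; rewrite -(tc _ _ wv) -!size_filter; apply/perm_size.
  apply: uniq_perm; rewrite ?filter_uniq// => u.
  by rewrite !mem_filter !mi andbC.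
- move=> v w w' ww' wv w'v; rewrite -(ij _ _ _ ww' wv w'v).
  by apply: eq_count => u; rewrite !mi.
- move=> v w w' ww' wv w'v; rewrite -(om _ _ _ ww' wv w'v).
  by apply: eq_count => u; rewrite !mi.
Qed.

Lemma eq_big_uniq (I : eqType) (Z : nmodType) (r s : seq I) (P Q : pred I)
    (F : I -> Z) : uniq r -> uniq s ->
    (forall i, (i \in r) && P i = (i \in s) && Q i) ->
  \sum_(i <- r | P i) F i = \sum_(i <- s | Q i) F i.
Proof.
move=> ur us eqrs; rewrite -big_filter -[RHS]big_filter; apply: perm_big.
apply: uniq_perm; rewrite ?filter_uniq// => i.
by rewrite !mem_filter andbC eqrs andbC.
Qed.

Section PlaneLinks.
Variables (V : eqType) (outs ins : V -> seq V) (q : nat).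
Hypothesis Hpl : plane_links outs ins q.
Variable Z : zmodType.
Implicit Types f : V -> Z.

Local Notation A := (@nsum V outs Z).
Local Notation B := (@nsum V ins Z).
Local Notation G := (@gsum V outs Z).
Local Notation R := (@gext V outs Z).

Let muo := outs_uniq Hpl.
Let mui := ins_uniq Hpl.
Let mem_i := mem_ins Hpl.

(** Both sides run over the triangles v -> a -> b -> v. *)
Lemma sum_triangles (F : V -> V -> Z) v :
  \sum_(a <- outs v) \sum_(b <- outs a | v \in outs b) F a b =
  \sum_(b <- ins v) \sum_(a <- outs v | b \in outs a) F a b.
Proof.
rewrite (exchange_big_dep predT)//=; apply: eq_big_seq => a av.
by apply: eq_big_uniq => // b; rewrite mem_i andbC.
Qed.

(** Prepending an edge v -> a to a geodesic gives a geodesic unless its first step a -> b closes a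
    triangle with v; the correction groups these failures by b. *)
Lemma nsum_gsum m f v :
  A (G m.+1 f) v =
  G m.+2 f v + \sum_(b <- ins v) \sum_(a <- outs v | b \in outs a) R m f a b.
Proof.
rewrite -sum_triangles gsumS -big_split /=; apply: eq_bigr => a _.
rewrite gsumS gextS (bigID (fun b => v \in outs b)) /= addrC; congr (_ + _).
Qed.

(** Of the q + 1 vertices a completing b -> v to a triangle, exactly one also completes b -> c if c
    <> v, and all do if c = v. The remaining ones, q or none, allow the step from b to c. *)
Lemma sum_common_in m f v b : v \in outs b ->
  \sum_(a <- outs v | b \in outs a) R m.+1 f a b =
  \sum_(c <- outs b | c != v) R m f b c *+ q.
Proof.
move=> vb.
under eq_bigr do rewrite gextS.
rewrite (exchange_big_dep predT)//= [RHS]big_mkcond /=.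
apply: eq_big_seq => c cb.
rewrite big_const_seq iter_addr_0.
have vc_count : (count (fun a => (b \in outs a) && (a \in outs c)) (outs v) +
    count (fun a => (b \in outs a) && (a \notin outs c)) (outs v) = q.+1)%N.
  rewrite -(triangle_count Hpl vb) -count_predUI.
  rewrite [X in (_ + X)%N](eq_count (a2 := pred0)); last first.
    by move=> a /=; case: (a \in outs c); rewrite ?andbF.
  rewrite count_pred0 addn0; apply: eq_count => a /=.
  by case: (a \in outs c); rewrite ?andbF ?andbT ?orbF.
have [cv|cv] := eqVneq c v; last first.
  congr (_ *+ _); apply/eqP; rewrite -eqSS -vc_count addnC -addn1 eqn_add2l.
  rewrite -(outs_meet Hpl (_ : c != v) cb vb) // -!size_filter.
  apply/eqP/perm_size/uniq_perm; rewrite ?filter_uniq// => a.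
  by rewrite !mem_filter mem_i; case: (b \in outs a); case: (a \in outs c);
    case: (a \in outs v).
suff -> : count (fun a => (b \in outs a) && (a \notin outs c)) (outs v) = 0%N by [].
rewrite cv; apply/eqP; rewrite -leqn0 leqNgt -has_count.
by apply/hasPn => a /= ->; rewrite andbF.
Qed.

(** For each first step v -> c, the q + 1 in-neighbours b of v lying on a triangle with it are
    forbidden, which leaves q^2. *)
Lemma sum_ins_gext m f v :
  \sum_(b <- ins v) R m.+1 f b v = G m.+1 f v *+ (q ^ 2).
Proof.
under eq_bigr do rewrite gextS.
rewrite (exchange_big_dep predT)//= gsumS -sumrMnl.
apply: eq_big_seq => c cv; rewrite big_const_seq iter_addr_0; congr (_ *+ _).
apply/eqP; rewrite -(eqn_add2l q.+1) [X in _ == X](_ : _ = (q ^ 2 + q + 1)%N); last by lia.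
rewrite -(size_ins Hpl v) -(triangle_count Hpl cv).
rewrite -(count_predC (fun b => b \in outs c) (ins v)); apply/eqP.
congr (_ + _)%N; rewrite -!size_filter; apply/perm_size/uniq_perm; rewrite ?filter_uniq// => b.
by rewrite !mem_filter mem_i andbC.
Qed.

(** A path v -> a <- w with w <> v determines a unique b with a -> b and v <- b -> w, and
    conversely, by join and meet in a link. Returning paths w = v lack this uniqueness and are
    counted apart. *)
Lemma nsumC f v : A (B f) v = B (A f) v.
Proof.
rewrite /nsum.
have split_diag (s t : V -> seq V) : (forall a, a \in s v -> v \in t a) ->
    (forall a, uniq (t a)) ->
    \sum_(a <- s v) \sum_(w <- t a) f w =
    f v *+ size (s v) + \sum_(a <- s v) \sum_(w <- t a | w != v) f w.
  move=> vt ut; rewrite -[size _]count_predT -iter_addr_0 -big_const_seq.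
  rewrite -big_split /=; apply: eq_big_seq => a av.
  by rewrite (bigD1_seq v) ?vt.
rewrite !split_diag //; first last.
- by move=> a; rewrite mem_i.
- by move=> a; rewrite mem_i.
rewrite (size_outs Hpl) (size_ins Hpl); congr (_ + _).
transitivity (\sum_(a <- outs v) \sum_(b <- ins v | b \in outs a)
    \sum_(w <- ins a | (w != v) && (w \in outs b)) f w).
  apply: eq_big_seq => a av.
  rewrite (exchange_big_dep (fun w => w != v)) /=; last by move=> b w _ /andP[].
  rewrite big_seq_cond [RHS]big_seq_cond; apply: eq_bigr => w /andP[wa wv].
  rewrite big_const_seq iter_addr_0 -[LHS]mulr1n; congr (_ *+ _).
  have vw : v != w by rewrite eq_sym.
  have va : v \in ins a by rewrite mem_i.
  rewrite -(ins_join Hpl vw va wa).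
  rewrite -!size_filter; apply/perm_size/uniq_perm; rewrite ?filter_uniq// => b.
  rewrite !mem_filter mem_i wv /=.
  by case: (v \in outs b); case: (w \in outs b); case: (b \in outs a).
rewrite (exchange_big_dep predT)//=; apply: eq_big_seq => b bv.
transitivity (\sum_(a <- outs v | b \in outs a)
    \sum_(w <- outs b | (w != v) && (w \in ins a)) f w).
  apply: eq_bigr => a _; apply: eq_big_uniq => // w.
  by case: (w \in ins a); case: (w \in outs b); case: (w != v).
rewrite (exchange_big_dep (fun w => w != v)) /=; last by move=> a w _ /andP[].
rewrite big_seq_cond [RHS]big_seq_cond; apply: eq_bigr => w /andP[wb wv].
rewrite big_const_seq iter_addr_0 -[RHS]mulr1n; congr (_ *+ _).
have vw : v != w by rewrite eq_sym.
have vb : v \in outs b by rewrite -mem_i.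
rewrite -(outs_meet Hpl vw vb wb).
rewrite -!size_filter; apply/perm_size/uniq_perm; rewrite ?filter_uniq// => a.
rewrite !mem_filter !mem_i wv /=.
by case: (a \in outs v); case: (a \in outs w); case: (b \in outs a).
Qed.

Lemma gsum2 f v : G 2 f v + B f v *+ q.+1 = A (A f) v.
Proof.
have -> : A (A f) v = A (G 1 f) v by apply: eq_bigr => w _; rewrite gsum1.
rewrite nsum_gsum; congr (_ + _); rewrite /nsum -sumrMnl.
apply: eq_big_seq => b bv; under eq_bigr do rewrite gext0.
rewrite big_const_seq iter_addr_0; congr (_ *+ _).
rewrite -(triangle_count (plane_links_rev Hpl) bv).
rewrite -!size_filter; apply/perm_size/uniq_perm; rewrite ?filter_uniq// => a.
by rewrite !mem_filter !mem_i andbC.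
Qed.

(** The term c = v missing in [sum_common_in] is the second sum on the left; adding it completes the
    sum over c to the full geodesic sum at b. *)
Lemma gsum_step m f v :
  A (G m.+2 f) v + (\sum_(b <- ins v) R m f b v) *+ q =
  G m.+3 f v + B (G m.+1 f) v *+ q.
Proof.
rewrite nsum_gsum -addrA; congr (_ + _).
rewrite /nsum -!sumrMnl -big_split /=.
apply: eq_big_seq => b; rewrite mem_i => bv.
rewrite sum_common_in// gsumS [in RHS](bigD1_seq v)//=.
by rewrite sumrMnl addrC mulrnDl.
Qed.

(** This start of the recursion deviates from [gsum_rec]: [gext 0] takes no step that could be
    forbidden, so all q^2 + q + 1 in-neighbours count instead of q^2. *)
Lemma gsum3 f v :
  G 3 f v + B (A f) v *+ q = A (G 2 f) v + f v *+ ((q ^ 2 + q + 1) * q).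
Proof.
have -> : B (A f) v = B (G 1 f) v by apply: eq_bigr => w _; rewrite gsum1.
rewrite -gsum_step; congr (_ + _); rewrite mulrnA; congr (_ *+ _).
under eq_bigr do rewrite gext0.
by rewrite big_const_seq iter_addr_0 count_predT (size_ins Hpl).
Qed.

Lemma gsum_rec m f v :
  G m.+4 f v + B (G m.+2 f) v *+ q = A (G m.+3 f) v + G m.+1 f v *+ (q ^ 3).
Proof.
by rewrite -gsum_step sum_ins_gext -mulrnA -expnSr.
Qed.

Lemma size_geo_ext m u v : u \in ins v -> size (geo_ext outs m u v) = (q ^ (2 * m))%N.
Proof.
elim: m u v => [|m IHm] u v uv //=.
rewrite size_allpairs_dep sumnE big_map big_filter big_seq_cond.
rewrite (eq_bigr (fun=> (q ^ (2 * m))%N)); last first.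
  by move=> w /andP[wv _]; rewrite IHm ?mem_i.
rewrite -big_seq_cond big_const_seq iter_addn_0 mulnS expnD mulnC; congr (_ * _)%N.
apply/eqP; rewrite -(eqn_add2l q.+1) [X in _ == X](_ : _ = (q ^ 2 + q + 1)%N); last by lia.
rewrite mem_i in uv.
by rewrite -(size_outs Hpl v) -(triangle_count Hpl uv) count_predC.
Qed.

Lemma size_geo_from m v :
  size (geo_from outs m.+1 v) = ((q ^ 2 + q + 1) * q ^ (2 * m))%N.
Proof.
rewrite /= size_allpairs_dep sumnE big_map big_seq.
rewrite (eq_bigr (fun=> (q ^ (2 * m))%N)); last first.
  by move=> w wv; rewrite size_geo_ext ?mem_i.
by rewrite -big_seq big_const_seq iter_addn_0 count_predT (size_outs Hpl) mulnC.
Qed.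

End PlaneLinks.

(* The eigenvalue of the [m]-step geodesic operator on a common eigenfunction
   with eigenvalues [lam], [mu] of the two Hecke operators. *)
Fixpoint geo_eig (K : pzRingType) (q : nat) (lam mu : K) (m : nat) : K :=
  match m with
  | 0 => 1
  | 1 => lam
  | 2 => lam ^+ 2 - q.+1%:R * mu
  | 3 => lam * (lam ^+ 2 - q.+1%:R * mu) - q%:R * mu * lam
         + ((q ^ 2 + q + 1) * q)%:R
  | ((((m1.+1) as m2).+1) as m3).+1 =>
      lam * geo_eig q lam mu m3 - q%:R * mu * geo_eig q lam mu m2
      + (q ^ 3)%:R * geo_eig q lam mu m1
  end.

Lemma geo_eigS (K : pzRingType) q (lam mu : K) m :
  geo_eig q lam mu m.+4 = lam * geo_eig q lam mu m.+3
    - q%:R * mu * geo_eig q lam mu m.+2 + (q ^ 3)%:R * geo_eig q lam mu m.+1.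
Proof. by []. Qed.

Lemma nat_ind3 (P : nat -> Prop) : P 0%N -> P 1%N -> P 2%N ->
  (forall m, P m -> P m.+1 -> P m.+2 -> P m.+3) -> forall m, P m.
Proof.
move=> P0 P1 P2 PS m; suff: [/\ P m, P m.+1 & P m.+2] by case.
by elim: m => [|m [Pm Pm1 Pm2]]; split=> //; apply: PS.
Qed.

Lemma rmorph_geo_eig (K L : pzRingType) (f : {rmorphism K -> L}) q lam mu m :
  f (geo_eig q lam mu m) = geo_eig q (f lam) (f mu) m.
Proof.
case: m => [|m]; first by rewrite /= rmorph1.
elim/nat_ind3: m => [|||m Pm Pm1 Pm2] //.
- by rewrite /= rmorphB rmorphXn rmorphM rmorph_nat.
- by rewrite /= rmorphD rmorphB !rmorphM rmorphB rmorphXn rmorphM !rmorph_nat.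
by rewrite !geo_eigS -Pm -Pm1 -Pm2 rmorphD rmorphB !rmorphM !rmorph_nat.
Qed.

(** At (3q, 3q) the recursion has characteristic polynomial (x - q)^3, so its solutions are q^m
    times a quadratic polynomial in m. The factor 2 q^2 clears denominators. *)
Lemma geo_eig_max (K : comPzRingType) q m :
  2 * q%:R ^+ 2 * geo_eig q (3 * q%:R) (3 * q%:R) m.+1 =
  q%:R ^+ m.+1 * ((m%:R + 2) * (m%:R + 3) * q%:R ^+ 2
    - 2 * m%:R * (m%:R + 2) * q%:R + m%:R * (m%:R - 1)) :> K.
Proof.
elim/nat_ind3: m => [|||m Pm Pm1 Pm2].
- by rewrite /=; ring.
- by rewrite /=; ring.
- by rewrite /=; ring.
rewrite geo_eigS mulrDr mulrBr !(mulrCA (2 * q%:R ^+ 2)) Pm Pm1 Pm2.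
by rewrite natrX -[m.+3%:R]natr1 -[m.+2%:R]natr1 -[m.+1%:R]natr1 !exprS; ring.
Qed.

Section Eigen.
Variables (V : eqType) (outs ins : V -> seq V) (q : nat).
Hypothesis Hpl : plane_links outs ins q.

Lemma nsumZ (K : pzRingType) (nbrs : V -> seq V) (a : K) (f : V -> K) v :
  nsum nbrs (fun w => a * f w) v = a * nsum nbrs f v.
Proof. by rewrite /nsum mulr_sumr. Qed.

Lemma eq_nsum (Z : nmodType) (nbrs : V -> seq V) (f g : V -> Z) v :
  f =1 g -> nsum nbrs f v = nsum nbrs g v.
Proof. by move=> fg; apply: eq_bigr => w _. Qed.

Lemma gsum_eigen (K : comPzRingType) (lam mu : K) (f : V -> K) :
  (forall v, nsum outs f v = lam * f v) ->
  (forall v, nsum ins f v = mu * f v) ->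
  forall m v, gsum outs m f v = geo_eig q lam mu m * f v.
Proof.
move=> Af Bf m v.
have AZ a w : nsum outs (fun u => a * f u) w = a * lam * f w.
  by rewrite nsumZ Af mulrA.
have BZ a w : nsum ins (fun u => a * f u) w = a * mu * f w.
  by rewrite nsumZ Bf mulrA.
have G2 w : gsum outs 2 f w = geo_eig q lam mu 2 * f w.
  have -> : gsum outs 2 f w = nsum outs (nsum outs f) w - nsum ins f w *+ q.+1.
    by rewrite -(gsum2 Hpl) addrK.
  by rewrite (eq_nsum outs w Af) AZ Bf /= -mulr_natl; ring.
case: m => [|m]; first by rewrite gsum0 mul1r.
elim/nat_ind3: m v => [|||m Pm Pm1 Pm2] v; [by rewrite gsum1 Af|exact: G2| |].
- have -> : gsum outs 3 f v = nsum outs (gsum outs 2 f) v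
      + f v *+ ((q ^ 2 + q + 1) * q) - nsum ins (nsum outs f) v *+ q.
    by rewrite -(gsum3 Hpl) addrK.
  rewrite (eq_nsum outs v G2) (eq_nsum ins v Af) AZ BZ.
  by rewrite /= -mulr_natl -[_ *+ q]mulr_natl; ring.
have -> : gsum outs m.+4 f v = nsum outs (gsum outs m.+3 f) v
    + gsum outs m.+1 f v *+ q ^ 3 - nsum ins (gsum outs m.+2 f) v *+ q.
  by rewrite -(gsum_rec Hpl) addrK.
rewrite (eq_nsum outs v Pm2) (eq_nsum ins v Pm1) AZ BZ Pm geo_eigS.
by rewrite -mulr_natl -[_ *+ q]mulr_natl; ring.
Qed.

End Eigen.

(** * Hall-Littlewood bound for tempered parameters *)

Section HallLittlewood.
Variable K : numFieldType.
Implicit Types (t z : K) (a b : nat -> K).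

(* Multiplies the generating series of [a] by [(1 - t z y) / (1 - z y)]. *)
Fixpoint hl_mul t z a (m : nat) : K :=
  if m is m'.+1 then z * hl_mul t z a m' + a m'.+1 - t * z * a m' else a 0%N.

(* The series [(1 - t z y) / (1 - z y)] has the coefficients 1 and
   [(1 - t) z ^ j], so its coefficientwise modulus is its value at [z = 1]. *)
Lemma hl_mul_le t z a b : 0 <= t <= 1 -> `|z| = 1 ->
  (forall m, `|a m| <= b m) -> forall m, `|hl_mul t z a m| <= hl_mul t 1 b m.
Proof.
move=> /andP[t0 t1] z1 ab m.
have b0 k : 0 <= b k by apply: le_trans (ab k).
(* Subtracting a gives a recursion with the nonnegative coefficients 1 and 1 - t, to which the
   triangle inequality applies without loss. *)
suff H : `|hl_mul t z a m - a m| <= hl_mul t 1 b m - b m.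
  rewrite -[hl_mul t z a m](subrK (a m)) (le_trans (ler_normD _ _))//.
  by rewrite -[leRHS](subrK (b m)) lerD.
elim: m => [|m IHm]; first by rewrite /= !subrr normr0.
rewrite (_ : hl_mul t z a m.+1 - _ =
  z * (hl_mul t z a m - a m) + (1 - t) * z * a m); last by rewrite /=; ring.
rewrite (_ : hl_mul t 1 b m.+1 - _ =
  (hl_mul t 1 b m - b m) + (1 - t) * b m); last by rewrite /=; ring.
rewrite (le_trans (ler_normD _ _))// !normrM z1 mul1r mulr1 lerD//.
by rewrite ger0_norm ?subr_ge0// ler_wpM2l ?subr_ge0.
Qed.

(** The coefficients of the product of (1 - t z_i y) / (1 - z_i y), that is, the Hall-Littlewood
    functions q_m. For m >= 1 they are 1 - t times the polynomial of the row (m), whence the factor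
    1 - 1/q in [hl_sym_geo_eig]. *)
Definition hl_sym t z1 z2 z3 : nat -> K :=
  hl_mul t z3 (hl_mul t z2 (hl_mul t z1 (fun m => (m == 0%N)%:R))).

Lemma hl_sym_le t z1 z2 z3 m : 0 <= t <= 1 ->
  `|z1| = 1 -> `|z2| = 1 -> `|z3| = 1 ->
  `|hl_sym t z1 z2 z3 m| <= hl_sym t 1 1 1 m.
Proof.
move=> t01 n1 n2 n3; do 3![apply: hl_mul_le => // {}m].
by rewrite normr_nat.
Qed.

Lemma hl_sym_geo_eig (q : nat) z1 z2 z3 m : q != 0%N -> z1 * z2 * z3 = 1 ->
  q%:R ^+ m.+1 * hl_sym q%:R^-1 z1 z2 z3 m.+1 = (1 - q%:R^-1) *
  geo_eig q (q%:R * (z1 + z2 + z3)) (q%:R * (z1 * z2 + z1 * z3 + z2 * z3)) m.+1.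
Proof.
move=> q0 z123.
have q0' : q%:R != 0 :> K by rewrite pnatr_eq0.
rewrite /hl_sym; set t := q%:R^-1.
have qt : q%:R * t = 1 by rewrite mulfV.
elim/nat_ind3: m => [|||m Pm Pm1 Pm2].
- by rewrite /=; field.
- by rewrite /= -[q.+1%:R]natr1 /t; field.
- rewrite /= !natrM !natrD !natrX -[q.+1%:R]natr1.
  (* Inserting z1 z2 z3 = 1 into the constant term makes both sides homogeneous, so that the claim
     becomes an identity of rational functions. *)
  have -> : q%:R ^+ 2 + q%:R + 1 = (q%:R ^+ 2 + q%:R + 1) * (z1 * z2 * z3) by rewrite z123 mulr1.
  by rewrite /t; field.
set x := hl_mul t z3 _ in Pm Pm1 Pm2 *.
have xS : x m.+4 = (z1 + z2 + z3) * x m.+3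
    - (z1 * z2 + z1 * z3 + z2 * z3) * x m.+2 + x m.+1.
  by rewrite -[x m.+1]mul1r -z123 /x /=; ring.
transitivity (q%:R * (z1 + z2 + z3) * (q%:R ^+ m.+3 * x m.+3)
  - q%:R * (q%:R * (z1 * z2 + z1 * z3 + z2 * z3)) * (q%:R ^+ m.+2 * x m.+2)
  + q%:R ^+ 3 * (q%:R ^+ m.+1 * x m.+1)).
  by rewrite xS !exprS; ring.
by rewrite Pm Pm1 Pm2 geo_eigS natrX; ring.
Qed.

Lemma norm_geo_eig_le (q : nat) z1 z2 z3 m : (1 < q)%N -> z1 * z2 * z3 = 1 ->
  `|z1| = 1 -> `|z2| = 1 -> `|z3| = 1 ->
  `|geo_eig q (q%:R * (z1 + z2 + z3)) (q%:R * (z1 * z2 + z1 * z3 + z2 * z3)) m|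
  <= geo_eig q (3 * q%:R) (3 * q%:R) m.
Proof.
move=> q1 z123 n1 n2 n3; case: m => [|m]; first by rewrite /= normr1.
have q0 : q != 0%N by rewrite -lt0n ltnW.
have q0' : 0 < q%:R :> K by rewrite ltr0n lt0n.
have t1 : 0 < 1 - q%:R^-1 :> K by rewrite subr_gt0 invf_lt1// ltr1n.
have -> : geo_eig q (3 * q%:R) (3 * q%:R) m.+1 = geo_eig q
    (q%:R * (1 + 1 + 1)) (q%:R * (1 * 1 + 1 * 1 + 1 * 1)) m.+1 :> K.
  by congr geo_eig; ring.
rewrite -(ler_pM2l t1) -{1}(gtr0_norm t1) -normrM -!hl_sym_geo_eig ?mulr1//.
have qm : 0 <= q%:R ^+ m.+1 :> K by rewrite exprn_ge0 ?ltW.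
rewrite normrM (ger0_norm qm) (ler_wpM2l qm)//.
by apply: hl_sym_le => //; rewrite invr_ge0 ltW//= invf_le1// ler1n ltnW.
Qed.

Lemma geo_eig_max_ge0 (q : nat) m : (1 < q)%N ->
  0 <= geo_eig q (3 * q%:R) (3 * q%:R) m :> K.
Proof.
move=> q1; have := @norm_geo_eig_le q 1 1 1 m q1.
by rewrite !mulr1 !normr1 => /(_ erefl erefl erefl erefl)/(le_trans _)->.
Qed.

End HallLittlewood.

(** * Reversal of geodesics and symmetry of the kernel *)

Section GeodesicSeq.
Variables (V : eqType).
Implicit Types (outs ins : V -> seq V) (s p : seq V).

Fixpoint geo_path outs (u v : V) p : bool :=
  if p is w :: p' then [&& w \in outs v, u \notin outs w & geo_path outs v w p']
  else true.

Definition geo_seq outs s : bool :=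
  if s is v :: p then
    if p is w :: p' then (w \in outs v) && geo_path outs v w p' else true
  else true.

Lemma mem_geo_ext outs m u v p :
  (p \in geo_ext outs m u v) = (size p == m) && geo_path outs u v p.
Proof.
elim: m u v p => [|m IHm] u v [|w p] //=.
- by apply/negbTE/allpairsPdep => -[x [y []]].
apply/allpairsPdep/idP => /= [[x [y [+ + [-> ->]]]]|/and4P[sp wv uw gp]].
  by rewrite mem_filter IHm => /andP[-> ->] /andP[/eqP -> ->]; rewrite eqxx.
by exists w, p; split=> //; rewrite ?mem_filter ?uw ?IHm ?wv// -eqSS sp.
Qed.

Lemma mem_geo_from outs m v p :
  (p \in geo_from outs m v) = (size p == m) && geo_seq outs (v :: p).
Proof.
case: m p => [|m] [|w p] //=; first by apply/negbTE/allpairsPdep => -[x [y []]].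
apply/allpairsPdep/idP => /= [[x [y [+ + [-> ->]]]]|/and3P[sp wv gp]].
  by rewrite mem_geo_ext => -> /andP[/eqP -> ->]; rewrite eqxx.
by exists w, p; split=> //; rewrite mem_geo_ext gp -eqSS sp.
Qed.

Lemma uniq_geo_ext outs m u v :
  (forall x, uniq (outs x)) -> uniq (geo_ext outs m u v).
Proof.
move=> uo; elim: m u v => [|m IHm] u v //=.
apply: allpairs_uniq_dep; rewrite ?filter_uniq// => -[x p] [y p'] _ _ /=.
by case=> -> ->.
Qed.

Lemma uniq_geo_from outs m v :
  (forall x, uniq (outs x)) -> uniq (geo_from outs m v).
Proof.
move=> uo; case: m => [|m] //=.
apply: allpairs_uniq_dep => //; first by move=> x _; apply: uniq_geo_ext.
by move=> -[x p] [y p'] _ _ /= [-> ->].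
Qed.

Lemma geo_pathP outs x0 u v p :
  geo_path outs u v p <->
  forall i, (i < size p)%N -> nth x0 (v :: p) i.+1 \in outs (nth x0 (v :: p) i)
   /\ nth x0 [:: u, v & p] i \notin outs (nth x0 [:: u, v & p] i.+2).
Proof.
elim: p u v => [|w p IHp] u v /=; first by split.
split=> [/and3P[wv uw /IHp H] [|i] //= ip|H]; first by have := H i; apply.
have [-> -> /=] := H 0%N isT.
by apply/IHp => i ip; apply: (H i.+1).
Qed.

Lemma geo_seqP outs x0 s :
  geo_seq outs s <->
  (forall i, (i.+1 < size s)%N -> nth x0 s i.+1 \in outs (nth x0 s i)) /\
  (forall i, (i.+2 < size s)%N -> nth x0 s i \notin outs (nth x0 s i.+2)).
Proof.
case: s => [|v [|w p]] //=; split=> [/andP[wv /(geo_pathP _ x0) H]|[H1 H2]].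
  split=> -[|i] //= ip; first by case: (H i).
  - by case: (H 0%N).
  - by case: (H i.+1).
apply/andP; split; first exact: (H1 0%N).
by apply/(geo_pathP _ x0) => i ip; split; [apply: (H1 i.+1)|apply: (H2 i)].
Qed.

(** The forbidden edge from the third vertex back to the first is again forbidden when both the
    sequence and all edges are reversed. *)
Lemma geo_seq_rev outs ins s :
  (forall v w, (v \in ins w) = (w \in outs v)) ->
  geo_seq ins (rev s) = geo_seq outs s.
Proof.
move=> io; case: s => [|x0 s0] //; set s := x0 :: s0.
have impl (o1 o2 : V -> seq V) s1 : (forall v w, (v \in o2 w) = (w \in o1 v)) ->
    geo_seq o1 s1 -> geo_seq o2 (rev s1).
  move=> o12 /(geo_seqP _ x0) [H1 H2]; apply/(geo_seqP _ x0).
  rewrite size_rev; split=> i ip.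
    rewrite !nth_rev// 1?ltnW// o12.
    by have := H1 (size s1 - i.+2)%N; rewrite -subSn// subSS; apply; lia.
  rewrite !nth_rev// 1?ltnW// 1?ltnW// o12.
  have := H2 (size s1 - i.+3)%N; rewrite -[(size s1 - i.+3).+2](_ : (size s1 - i.+1 = _)%N); last by lia.
  by apply; lia.
apply/idP/idP; last exact: impl.
by move/(impl _ _ _ (fun v w => esym (io w v))); rewrite revK.
Qed.

End GeodesicSeq.

Section Kernel.
Variables (V : eqType) (outs ins : V -> seq V).
Hypothesis uo : forall v, uniq (outs v).
Hypothesis ui : forall v, uniq (ins v).
Hypothesis io : forall v w, (v \in ins w) = (w \in outs v).

Definition geo_count (nbrs : V -> seq V) m v w : nat :=
  count (fun p => last v p == w) (geo_from nbrs m v).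

(** Reversal is a bijection between the two sets of geodesics. Hence the two directions of the
    geodesic operator are adjoint to each other. *)
Lemma geo_countC m v w : geo_count outs m v w = geo_count ins m w v.
Proof.
rewrite /geo_count -!size_filter.
rewrite -(size_map (fun p => v :: p)) -[RHS](size_map (fun p => rev (w :: p))).
apply/perm_size/uniq_perm.
- by rewrite map_inj_uniq ?filter_uniq ?uniq_geo_from// => x y [].
- rewrite map_inj_uniq ?filter_uniq ?uniq_geo_from// => x y.
  by move=> /(can_inj revK)[].
move=> s; apply/mapP/mapP => -[p].
  rewrite mem_filter mem_geo_from => /and3P[/eqP lp sp gp] ->.
  exists (rev (belast v p)); last by rewrite -rev_rcons revK -lp -lastI.
  rewrite mem_filter mem_geo_from size_rev size_belast sp.
  rewrite -lp -rev_rcons -lastI (geo_seq_rev _ io) gp !andbT.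
  by case: p {sp gp lp} => [|x p] /=; rewrite ?rev_cons ?last_rcons eqxx.
rewrite mem_filter mem_geo_from => /and3P[/eqP lp sp gp] ->.
exists (rev (belast w p)); last by rewrite lastI rev_rcons lp.
rewrite mem_filter mem_geo_from size_rev size_belast sp.
have -> : v :: rev (belast w p) = rev (w :: p) by rewrite -lp -rev_rcons -lastI.
rewrite (geo_seq_rev (outs := ins)) ?gp ?andbT => [|x y]; last by rewrite io.
case: p {sp gp} lp => [|x p] //= lp; first by rewrite lp.
by rewrite rev_cons last_rcons eqxx.
Qed.

Lemma gsum_count (nbrs : V -> seq V) (Z : nmodType) m (f : V -> Z) (t : seq V) v : uniq t ->
  (forall w, w \notin t -> f w = 0) ->
  gsum nbrs m f v = \sum_(w <- t) f w *+ geo_count nbrs m v w.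
Proof.
move=> ut ft; rewrite /gsum.
transitivity (\sum_(p <- geo_from nbrs m v) \sum_(w <- t | last v p == w) f w).
  apply: eq_bigr => p _; have [lt|lt] := boolP (last v p \in t).
    rewrite -big_filter (_ : [seq w <- t | last v p == w] = [:: last v p]) ?big_seq1//.
    apply: perm_small_eq => //; apply: uniq_perm; rewrite ?filter_uniq// => w.
    by rewrite mem_filter inE eq_sym; case: eqP => // ->.
  rewrite ft// big_seq_cond big1// => w /andP[wt /eqP lw].
  by rewrite lw wt in lt.
rewrite (exchange_big_dep predT)//=; apply: eq_bigr => w _.
by rewrite big_const_seq iter_addr_0.
Qed.

Lemma gsum_adjoint (K : comPzRingType) m (a b : V -> K) (s t : seq V) :
  uniq s -> uniq t ->
  (forall w, w \notin s -> a w = 0) -> (forall w, w \notin t -> b w = 0) ->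
  \sum_(v <- s) a v * gsum outs m b v = \sum_(w <- t) gsum ins m a w * b w.
Proof.
move=> us ut sa tb.
under eq_bigr do rewrite (gsum_count _ m _ ut tb) mulr_sumr.
rewrite exchange_big; apply: eq_bigr => w _ /=.
rewrite (gsum_count _ m _ us sa) mulr_suml; apply: eq_bigr => v _.
by rewrite geo_countC mulrnAr mulrnAl.
Qed.

End Kernel.

(** * The Schur test and the L^2 spectrum *)

Section NormSq.
Variable R : rcfType.
Implicit Types x y : R[i].

Definition normsq x : R := Re x ^+ 2 + Im x ^+ 2.

Lemma ReD x y : Re (x + y) = Re x + Re y. Proof. by case: x y => ? ? []. Qed.
Lemma ImD x y : Im (x + y) = Im x + Im y. Proof. by case: x y => ? ? []. Qed.
Lemma ReN x : Re (- x) = - Re x. Proof. by case: x. Qed.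
Lemma ImN x : Im (- x) = - Im x. Proof. by case: x. Qed.
Lemma ReM x y : Re (x * y) = Re x * Re y - Im x * Im y.
Proof. by case: x y => ? ? []. Qed.
Lemma ImM x y : Im (x * y) = Re x * Im y + Im x * Re y.
Proof. by case: x y => ? ? []. Qed.

Lemma Re_sum (I : Type) (r : seq I) (P : pred I) (F : I -> R[i]) :
  Re (\sum_(i <- r | P i) F i) = \sum_(i <- r | P i) Re (F i).
Proof. exact: (big_morph (@Re R) ReD). Qed.

Lemma Im_sum (I : Type) (r : seq I) (P : pred I) (F : I -> R[i]) :
  Im (\sum_(i <- r | P i) F i) = \sum_(i <- r | P i) Im (F i).
Proof. exact: (big_morph (@Im R) ImD). Qed.

Lemma normsq_ge0 x : 0 <= normsq x.
Proof. by rewrite addr_ge0 ?sqr_ge0. Qed.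

Lemma normsq0 : normsq 0 = 0.
Proof. by rewrite /normsq /= expr0n addr0. Qed.

Lemma normsqM x y : normsq (x * y) = normsq x * normsq y.
Proof. by rewrite /normsq ReM ImM; ring. Qed.

Lemma normsqN x : normsq (- x) = normsq x.
Proof. by rewrite /normsq ReN ImN !sqrrN. Qed.

Lemma normsqD_le x y : normsq (x + y) <= 2 * normsq x + 2 * normsq y.
Proof.
rewrite /normsq ReD ImD; set a := Re x; set b := Im x; set c := Re y; set d := Im y.
have := sqr_ge0 (a - c); have := sqr_ge0 (b - d); lra.
Qed.

Lemma normc_sqr x : ComplexField.Normc.normc x ^+ 2 = normsq x.
Proof. by case: x => a b /=; rewrite sqr_sqrtr ?addr_ge0 ?sqr_ge0. Qed.

(** Weighted Cauchy-Schwarz. In the induction the cross term [D] satisfies D^2 <= P Q by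
    Cauchy-Schwarz in the plane, hence 2 D <= P + Q. *)
Lemma normsq_sum_le (I : Type) (r : seq I) (x : I -> R[i]) (w : I -> R) :
  (forall i, 0 < w i) ->
  normsq (\sum_(i <- r) x i) <=
  (\sum_(i <- r) w i) * (\sum_(i <- r) normsq (x i) / w i).
Proof.
move=> w0; elim: r => [|i r IHr]; first by rewrite !big_nil normsq0 mul0r.
rewrite !big_cons; move: IHr; set X := \sum_(j <- r) x j.
set W := \sum_(j <- r) w j; set Y := \sum_(j <- r) _ => IHr.
have W0 : 0 <= W by apply: sumr_ge0 => j _; rewrite ltW.
have Y0 : 0 <= Y by apply: sumr_ge0 => j _; rewrite divr_ge0 ?normsq_ge0 ?ltW.
set P := W * (normsq (x i) / w i); set Q := w i * Y.
have P0 : 0 <= P by rewrite mulr_ge0 ?divr_ge0 ?normsq_ge0// ltW.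
have Q0 : 0 <= Q by rewrite mulr_ge0// ltW.
set D := Re (x i) * Re X + Im (x i) * Im X.
have PQ : P * Q = normsq (x i) * (W * Y) by rewrite /P /Q; field; rewrite gt_eqF.
have D2 : D ^+ 2 <= P * Q.
  rewrite PQ; apply: le_trans (ler_wpM2l (normsq_ge0 _) IHr).
  have := sqr_ge0 (Re (x i) * Im X - Im (x i) * Re X).
  rewrite /D /normsq; set a := Re _; set b := Im _; set c := Re _; set d := Im _.
  by move=> H; rewrite -subr_ge0; move: H; congr (_ <= _); ring.
have D1 : 2 * D <= P + Q.
  rewrite leNgt; apply/negP => H.
  have : (P + Q) ^+ 2 < (2 * D) ^+ 2 by rewrite ltrXn2r// ?addr_ge0// mulr_ge0//; lra.
  rewrite -subr_gt0; have := sqr_ge0 (P - Q); nra.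
have -> : normsq (x i + X) = normsq (x i) + normsq X + 2 * D.
  by rewrite /normsq ReD ImD /D; ring.
have -> : (w i + W) * (normsq (x i) / w i + Y) = normsq (x i) + P + Q + W * Y.
  by rewrite /P /Q; field; rewrite gt_eqF.
lra.
Qed.

End NormSq.

Section Window.
Variables (R : rcfType) (V : eqType).
Implicit Types (f g : V -> R[i]) (s t : seq V).

Definition wnorm s f : R := \sum_(v <- s) normsq (f v).

(** Says that the squared L^2 norm is at most M ([norm2sq_le]), tested on finite windows so that no
    infinite sum enters the estimates. *)
Definition bounded_by f (M : R) := forall s, uniq s -> wnorm s f <= M.

Definition vanish_off (Z : nmodType) t (f : V -> Z) := forall v, v \notin t -> f v = 0.

Lemma wnorm_ge0 s f : 0 <= wnorm s f.
Proof. by apply: sumr_ge0 => v _; apply: normsq_ge0. Qed.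

Lemma bounded_by_ge0 f M : bounded_by f M -> 0 <= M.
Proof. by move=> /(_ [::] isT); rewrite /wnorm big_nil. Qed.

Lemma sum_vanish (Z : nmodType) s t (x : V -> Z) : uniq s -> uniq t ->
  vanish_off s x -> vanish_off t x -> \sum_(v <- s) x v = \sum_(v <- t) x v.
Proof.
move=> us ut sx tx.
have half (r1 r2 : seq V) : vanish_off r2 x ->
    \sum_(v <- r1) x v = \sum_(v <- r1 | v \in r2) x v.
  move=> x2; rewrite (bigID (fun v => v \in r2)) /= [X in _ + X]big1 ?addr0//.
rewrite (half s t)// (half t s)//; apply: eq_big_uniq => // v; exact: andbC.
Qed.

Lemma wnorm_vanish s t f : uniq s -> uniq t -> vanish_off t f ->
  wnorm s f <= wnorm t f.
Proof.
move=> us ut tf; rewrite /wnorm (bigID (fun v => v \in t)) /=.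
rewrite [X in _ + X]big1 ?addr0 => [|v /tf ->]; last by rewrite normsq0.
rewrite [leRHS](bigID (fun v => v \in s)) /= -[leLHS]addr0 lerD//.
  by rewrite le_eqVlt; apply/orP; left; apply/eqP; apply: eq_big_uniq => // v; exact: andbC.
by apply: sumr_ge0 => v _; apply: normsq_ge0.
Qed.

Lemma bounded_by_vanish t f : uniq t -> vanish_off t f -> bounded_by f (wnorm t f).
Proof. by move=> ut tf s us; apply: wnorm_vanish. Qed.

Lemma bounded_byD f g M M' : bounded_by f M -> bounded_by g M' ->
  bounded_by (fun v => f v + g v) (2 * M + 2 * M').
Proof.
move=> fM gM s us; apply: le_trans (lerD (ler_wpM2l _ (fM s us)) (ler_wpM2l _ (gM s us))) => //.
rewrite /wnorm !mulr_sumr -big_split /=; apply: ler_sum => v _.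
exact: normsqD_le.
Qed.

Lemma bounded_byZ a f M : bounded_by f M ->
  bounded_by (fun v => a * f v) (normsq a * M).
Proof.
move=> fM s us; apply: le_trans (ler_wpM2l (normsq_ge0 a) (fM s us)).
by rewrite /wnorm mulr_sumr; apply: ler_sum => v _; rewrite normsqM.
Qed.

Lemma eq_bounded_by f g M : f =1 g -> bounded_by f M -> bounded_by g M.
Proof.
move=> fg fM s us; apply: le_trans (fM s us).
by rewrite /wnorm le_eqVlt; apply/orP; left; apply/eqP; apply: eq_bigr => v _; rewrite fg.
Qed.

Lemma bounded_by_le f M M' : M <= M' -> bounded_by f M -> bounded_by f M'.
Proof. by move=> MM fM s us; apply: le_trans MM; apply: fM. Qed.

Definition restr t f := fun v => if v \in t then f v else 0.

Lemma restr_vanish t f : vanish_off t (restr t f).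
Proof. by move=> v /negbTE vt; rewrite /restr vt. Qed.

Lemma wnorm_restr t f : wnorm t (restr t f) = wnorm t f.
Proof. by rewrite /wnorm; apply: eq_big_seq => v vt; rewrite /restr vt. Qed.

End Window.

Section Schur.
Variables (R : rcfType) (V : eqType) (outs ins : V -> seq V) (q : nat).
Hypothesis Hpl : plane_links outs ins q.
Hypothesis q_gt1 : (1 < q)%N.
Variable psi : V -> R.
Hypothesis psi_gt0 : forall v, 0 < psi v.
Hypothesis psi_outs : forall v, nsum outs psi v = 3 * q%:R * psi v.
Hypothesis psi_ins : forall v, nsum ins psi v = 3 * q%:R * psi v.

Let c m : R := geo_eig q (3 * q%:R) (3 * q%:R) m.

(** Schur test: weighted Cauchy-Schwarz gives |T f|^2 <= (T psi) (T h) with h = |f|^2 / psi and T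
    psi = c psi. Moving T from h to psi by adjointness yields the second factor c. *)
Lemma gsum_schur m f s t : uniq s -> uniq t -> vanish_off t f ->
  wnorm s (gsum outs m f) <= c m ^+ 2 * wnorm t f.
Proof.
move=> us ut tf.
have c0 : 0 <= c m by apply: geo_eig_max_ge0.
pose h w := normsq (f w) / psi w.
have h0 w : 0 <= h w by rewrite divr_ge0 ?normsq_ge0// ltW.
have th : vanish_off t h by move=> w /tf fw; rewrite /h fw normsq0 mul0r.
have Gpsi v : gsum outs m psi v = c m * psi v by apply: (gsum_eigen Hpl).
have G'psi v : gsum ins m psi v = c m * psi v.
  by apply: (gsum_eigen (plane_links_rev Hpl)).
(* Adjointness is available for finite supports only, so c psi is cut off outside the window;
   positivity makes the cut harmless. *)
pose a v := if v \in s then c m * psi v else 0.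
have sa : vanish_off s a by move=> v /negbTE vs; rewrite /a vs.
have a_le v : a v <= c m * psi v.
  by rewrite /a; case: ifP => // _; rewrite mulr_ge0// ltW.
have -> : c m ^+ 2 * wnorm t f = \sum_(w <- t) (c m * (c m * psi w)) * h w.
  rewrite /wnorm mulr_sumr; apply: eq_bigr => w _.
  by rewrite /h; field; rewrite gt_eqF.
apply: (@le_trans _ _ (\sum_(v <- s) a v * gsum outs m h v)).
  rewrite /wnorm big_seq [leRHS]big_seq; apply: ler_sum => v vs.
  by rewrite /a vs -Gpsi; apply: normsq_sum_le.
rewrite (gsum_adjoint (outs_uniq Hpl) (ins_uniq Hpl) (mem_ins Hpl) m us ut sa th).
apply: ler_sum => w _; apply: ler_wpM2r => //.
by rewrite -G'psi mulr_sumr; apply: ler_sum => p _; apply: a_le.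
Qed.

Lemma gsum_bounded m (f : V -> R[i]) M :
  bounded_by f M -> bounded_by (gsum outs m f) (c m ^+ 2 * M).
Proof.
move=> fM s us.
(* On the window only the values of f at endpoints of its m-geodesics matter, so f may be replaced
   by its restriction to them. *)
pose t := undup (flatten [seq [seq last v p | p <- geo_from outs m v] | v <- s]).
have ut : uniq t by apply: undup_uniq.
have := gsum_schur m us ut (@restr_vanish _ _ t f).
rewrite wnorm_restr => /le_trans H.
apply: le_trans (H _ (ler_wpM2l (sqr_ge0 _) (fM t ut))).
rewrite /wnorm le_eqVlt; apply/orP; left; apply/eqP/eq_big_seq => v vs.
congr normsq; apply: eq_big_seq => p pv; rewrite /restr mem_undup.
suff -> : last v p \in flatten [seq [seq last v p | p <- geo_from outs m v] | v <- s] by [].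
by apply/flatten_mapP; exists v => //; apply: map_f.
Qed.

End Schur.

(** * Lower bound for A_1 - lam on functions of finite support *)

Section LowerBound.
Variables (R : rcfType) (V : eqType) (outs ins : V -> seq V) (q : nat).
Hypothesis Hpl : plane_links outs ins q.
Hypothesis q_gt1 : (1 < q)%N.
Variable psi : V -> R.
Hypothesis psi_gt0 : forall v, 0 < psi v.
Hypothesis psi_outs : forall v, nsum outs psi v = 3 * q%:R * psi v.
Hypothesis psi_ins : forall v, nsum ins psi v = 3 * q%:R * psi v.

Implicit Types (f g : V -> R[i]) (s t : seq V).

Lemma nsum_outs_bounded f M :
  bounded_by f M -> bounded_by (nsum outs f) ((3 * q%:R) ^+ 2 * M).
Proof.
move=> /(gsum_bounded Hpl q_gt1 psi_gt0 psi_outs psi_ins 1).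
by apply: eq_bounded_by => v; rewrite gsum1.
Qed.

Lemma nsum_ins_bounded f M :
  bounded_by f M -> bounded_by (nsum ins f) ((3 * q%:R) ^+ 2 * M).
Proof.
move=> /(gsum_bounded (plane_links_rev Hpl) q_gt1 psi_gt0 psi_ins psi_outs 1).
by apply: eq_bounded_by => v; rewrite gsum1.
Qed.

Definition nbhd t := undup (t ++ flatten (map outs t) ++ flatten (map ins t)).

Lemma nbhd_uniq t : uniq (nbhd t). Proof. exact: undup_uniq. Qed.

Lemma mem_nbhd t v : v \in t -> v \in nbhd t.
Proof. by move=> vt; rewrite mem_undup mem_cat vt. Qed.

Lemma outs_nbhd t v w : v \in t -> w \in outs v -> w \in nbhd t.
Proof.
move=> vt wv; rewrite mem_undup !mem_cat; apply/or3P/Or32/flattenP.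
by exists (outs v) => //; apply: map_f.
Qed.

Lemma ins_nbhd t v w : v \in t -> w \in ins v -> w \in nbhd t.
Proof.
move=> vt wv; rewrite mem_undup !mem_cat; apply/or3P/Or33/flattenP.
by exists (ins v) => //; apply: map_f.
Qed.

Variable lam : R[i].

Definition shift_op f v := nsum outs f v - lam * f v.
Definition shift_adj f v := nsum ins f v - lam^*%C * f v.
Local Notation N := shift_op.
Local Notation N' := shift_adj.

Lemma vanish_nsum_outs t f : vanish_off t f -> vanish_off (nbhd t) (nsum outs f).
Proof.
move=> tf v vt; rewrite /nsum big_seq big1// => w wv; apply: tf.
by apply: contra vt => wt; apply: ins_nbhd wt _; rewrite (mem_ins Hpl).
Qed.

Lemma vanish_nsum_ins t f : vanish_off t f -> vanish_off (nbhd t) (nsum ins f).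
Proof.
move=> tf v vt; rewrite /nsum big_seq big1// => w wv; apply: tf.
by apply: contra vt => wt; apply: outs_nbhd wt _; rewrite -(mem_ins Hpl).
Qed.

Lemma vanish_nbhd (t : seq V) f : vanish_off t f -> vanish_off (nbhd t) f.
Proof. by move=> tf v vt; apply: tf; apply: contra vt; apply: mem_nbhd. Qed.

Lemma vanish_N t f : vanish_off t f -> vanish_off (nbhd t) (N f).
Proof.
move=> tf v vt; rewrite /N (vanish_nsum_outs tf)// (vanish_nbhd tf)//.
by rewrite mulr0 subr0.
Qed.

Lemma vanish_N' t f : vanish_off t f -> vanish_off (nbhd t) (N' f).
Proof.
move=> tf v vt; rewrite /N' (vanish_nsum_ins tf)// (vanish_nbhd tf)//.
by rewrite mulr0 subr0.
Qed.

(** The real part of the Hermitian inner product; it determines norms and suffices to express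
    adjointness. *)
Definition wdot s f g : R :=
  \sum_(v <- s) (Re (f v) * Re (g v) + Im (f v) * Im (g v)).

Lemma wdotE s f : wdot s f f = wnorm s f.
Proof. by []. Qed.

Lemma wdotC s f g : wdot s f g = wdot s g f.
Proof. by apply: eq_bigr => v _; rewrite mulrC [X in _ + X]mulrC. Qed.

Lemma eq_wdot s f f' g : f =1 f' -> wdot s f g = wdot s f' g.
Proof. by move=> ff; apply: eq_bigr => v _; rewrite ff. Qed.

Lemma Re_nsum nbrs f v : Re (nsum nbrs f v) = nsum nbrs (fun w => Re (f w)) v.
Proof. exact: Re_sum. Qed.

Lemma Im_nsum nbrs f v : Im (nsum nbrs f v) = nsum nbrs (fun w => Im (f w)) v.
Proof. exact: Im_sum. Qed.

Lemma wdot_shift s t f g : uniq s -> uniq t -> vanish_off s f -> vanish_off t g ->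
  wdot s f (N g) = wdot t (N' f) g.
Proof.
move=> us ut sf tg.
have adj (a b : V -> R) : vanish_off s a -> vanish_off t b ->
    \sum_(v <- s) a v * nsum outs b v = \sum_(w <- t) nsum ins a w * b w.
  move=> sa tb.
  have := gsum_adjoint (outs_uniq Hpl) (ins_uniq Hpl) (mem_ins Hpl) 1 us ut sa tb.
  under eq_bigr do rewrite gsum1.
  by under [in RHS]eq_bigr do rewrite gsum1.
have sRe : vanish_off s (fun v => Re (f v)) by move=> v /sf ->.
have sIm : vanish_off s (fun v => Im (f v)) by move=> v /sf ->.
have tRe : vanish_off t (fun v => Re (g v)) by move=> v /tg ->.
have tIm : vanish_off t (fun v => Im (g v)) by move=> v /tg ->.
pose x v := Re (f v) * Re (lam * g v) + Im (f v) * Im (lam * g v).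
have sx : vanish_off s x by move=> v /sf; rewrite /x => ->; rewrite /= !mul0r addr0.
have tx : vanish_off t x by move=> v /tg; rewrite /x => ->; rewrite mulr0 /= !mulr0 addr0.
have sum_x := sum_vanish us ut sx tx.
transitivity (\sum_(v <- s) (Re (f v) * nsum outs (fun w => Re (g w)) v +
    Im (f v) * nsum outs (fun w => Im (g w)) v) - \sum_(v <- s) x v).
  rewrite -sumrB; apply: eq_bigr => v _.
  by rewrite /x /N ReD ImD ReN ImN Re_nsum Im_nsum; ring.
rewrite big_split /= adj// adj// -big_split /= sum_x -sumrB.
apply: eq_bigr => v _.
rewrite /N' /x ReD ImD ReN ImN Re_nsum Im_nsum !ReM !ImM.
by case: lam => a b /=; ring.
Qed.

Lemma wdot_shift_adj s t f g : uniq s -> uniq t ->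
  vanish_off s f -> vanish_off t g -> wdot s f (N' g) = wdot t (N f) g.
Proof. by move=> us ut sf tg; rewrite [RHS]wdotC (wdot_shift ut us tg sf) wdotC. Qed.

Lemma nsum_lin nbrs a f g v :
  nsum nbrs (fun w => f w - a * g w) v = nsum nbrs f v - a * nsum nbrs g v.
Proof. by rewrite /nsum sumrB mulr_sumr. Qed.

Lemma shiftC f v : N' (N f) v = N (N' f) v.
Proof. by rewrite /N /N' !nsum_lin (nsumC Hpl); ring. Qed.

(** Normality: the two squared norms are the inner products of f with N' N f and N N' f, which
    agree. *)
Lemma shift_normal t f : uniq t -> vanish_off t f ->
  wnorm (nbhd t) (N f) = wnorm (nbhd t) (N' f).
Proof.
move=> ut tf; have un := nbhd_uniq t.
rewrite -!wdotE (wdot_shift un ut (vanish_N tf) tf).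
rewrite (wdot_shift_adj un ut (vanish_N' tf) tf).
exact/eq_wdot/shiftC.
Qed.

(* [T - p] is controlled by [shift_op] on finitely supported functions: on
   approximate eigenfunctions, [T] acts as the scalar [p]. *)
Definition near_scalar (T : (V -> R[i]) -> V -> R[i]) (p : R[i]) :=
  exists2 K : R, 0 <= K & forall f t, uniq t -> vanish_off t f ->
    bounded_by (fun v => T f v - p * f v) (K * wnorm (nbhd t) (N f)).

Lemma near_scalar_ext T T' p p' : (forall f v, T f v = T' f v) -> p = p' ->
  near_scalar T p -> near_scalar T' p'.
Proof.
move=> TT' <- [K K0 TK]; exists K => // f t ut tf.
by apply: eq_bounded_by (TK f t ut tf) => v; rewrite TT'.
Qed.

Lemma near_scalar_id : near_scalar id 1.
Proof.
exists 0 => // f t ut tf s us; rewrite mul0r /wnorm big1// => v _.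
by rewrite mul1r subrr normsq0.
Qed.

Lemma near_scalar_lin a T T' p p' : near_scalar T p -> near_scalar T' p' ->
  near_scalar (fun f v => a * T f v + T' f v) (a * p + p').
Proof.
move=> [K K0 TK] [K' K'0 TK']; exists (2 * (normsq a * K) + 2 * K').
  by rewrite addr_ge0 ?mulr_ge0 ?normsq_ge0.
move=> f t ut tf.
have := bounded_byD (bounded_byZ a (TK f t ut tf)) (TK' f t ut tf).
rewrite (_ : _ + _ = (2 * (normsq a * K) + 2 * K') * wnorm (nbhd t) (N f)); last by ring.
by apply: eq_bounded_by => v; ring.
Qed.

(** With A the sum over [outs], A T f - lam p f = A (T f - p f) + p N f, and A is bounded. *)
Lemma near_scalar_outs T p : near_scalar T p ->
  near_scalar (fun f => nsum outs (T f)) (lam * p).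
Proof.
move=> [K K0 TK]; exists (2 * ((3 * q%:R) ^+ 2 * K) + 2 * normsq p).
  by rewrite addr_ge0 ?mulr_ge0 ?sqr_ge0 ?normsq_ge0.
move=> f t ut tf; have un := nbhd_uniq t.
have fN := bounded_by_vanish un (vanish_N tf).
have := bounded_byD (nsum_outs_bounded (TK f t ut tf)) (bounded_byZ p fN).
rewrite (_ : _ + _ = (2 * ((3 * q%:R) ^+ 2 * K) + 2 * normsq p) * wnorm (nbhd t) (N f)); last by ring.
by apply: eq_bounded_by => v; rewrite nsum_lin /N; ring.
Qed.

(** The analogous decomposition contains p N' f instead, which [shift_normal] controls by N f. *)
Lemma near_scalar_ins T p : near_scalar T p ->
  near_scalar (fun f => nsum ins (T f)) (lam^*%C * p).
Proof.
move=> [K K0 TK]; exists (2 * ((3 * q%:R) ^+ 2 * K) + 2 * normsq p).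
  by rewrite addr_ge0 ?mulr_ge0 ?sqr_ge0 ?normsq_ge0.
move=> f t ut tf; have un := nbhd_uniq t.
have fN := bounded_by_vanish un (vanish_N' tf).
rewrite -(shift_normal ut tf) in fN.
have := bounded_byD (nsum_ins_bounded (TK f t ut tf)) (bounded_byZ p fN).
rewrite (_ : _ + _ = (2 * ((3 * q%:R) ^+ 2 * K) + 2 * normsq p) * wnorm (nbhd t) (N f)); last by ring.
by apply: eq_bounded_by => v; rewrite nsum_lin /N'; ring.
Qed.

Lemma near_scalar_gsum m :
  near_scalar (fun f => gsum outs m f) (geo_eig q lam lam^*%C m).
Proof.
have G0 := near_scalar_id.
have G1 := near_scalar_outs G0.
have B1 := near_scalar_ins G0.
have G2 : near_scalar (fun f => gsum outs 2 f) (geo_eig q lam lam^*%C 2).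
  apply: near_scalar_ext (near_scalar_lin (- q.+1%:R) B1 (near_scalar_outs G1)).
    move=> f v; rewrite -(gsum2 Hpl f v) -mulr_natl; ring.
  by rewrite /=; ring.
case: m => [|m]; first by apply: near_scalar_ext G0 => // f v; rewrite gsum0.
elim/nat_ind3: m => [|||m G G' G''].
- by apply: near_scalar_ext G1; rewrite ?mulr1// => f v; rewrite gsum1.
- exact: G2.
- have G3 f v := gsum3 Hpl f v.
  have p3 : geo_eig q lam lam^*%C 3 = lam * geo_eig q lam lam^*%C 2
    - q%:R * lam^*%C * lam + ((q ^ 2 + q + 1) * q)%:R by [].
  move: ((q ^ 2 + q + 1) * q)%N G3 p3 => n G3 p3.
  apply: near_scalar_ext (near_scalar_lin (- q%:R) (near_scalar_ins G1)
      (near_scalar_lin n%:R G0 (near_scalar_outs G2))).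
    move=> f v; have := G3 f v.
    move: (gsum outs 3 f v) (nsum outs (gsum outs 2 f) v) (nsum ins (nsum outs f) v).
    move=> x y z; rewrite -(mulr_natl z q) -(mulr_natl (f v) n) => /eqP.
    by rewrite eq_sym -subr_eq => /eqP <-; ring.
  by rewrite p3; ring.
apply: near_scalar_ext (near_scalar_lin (- q%:R) (near_scalar_ins G')
    (near_scalar_lin (q ^ 3)%:R G (near_scalar_outs G''))).
  move=> f v; have := gsum_rec Hpl m f v; rewrite -[_ *+ q]mulr_natl -[_ *+ q ^ 3]mulr_natl => /eqP.
  by rewrite eq_sym -subr_eq => /eqP <-; ring.
by rewrite geo_eigS; ring.
Qed.

(** From p f = - (T f - p f) + T f follows |p|^2 |f|^2 <= 2 K |N f|^2 + 2 c^2 |f|^2; the assumption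
    lets the last term be absorbed on the left. *)
Lemma shift_lower_bound m :
  2 * geo_eig q (3 * q%:R) (3 * q%:R) m ^+ 2 < normsq (geo_eig q lam lam^*%C m) ->
  exists2 K : R, 0 < K & forall f t, uniq t -> vanish_off t f ->
    wnorm t f <= K * wnorm (nbhd t) (N f).
Proof.
set c := geo_eig _ _ _ _; set p := geo_eig _ _ _ _ => cp.
have [K K0 GK] := near_scalar_gsum m.
have d0 : 0 < normsq p - 2 * c ^+ 2 by rewrite subr_gt0.
exists ((2 * K + 1) / (normsq p - 2 * c ^+ 2)).
  by rewrite divr_gt0// ltr_wpDl ?mulr_ge0.
move=> f t ut tf.
rewrite mulrAC ler_pdivlMr//.
have := bounded_byD (bounded_byZ (-1) (GK f t ut tf))
  (gsum_bounded Hpl q_gt1 psi_gt0 psi_outs psi_ins m (bounded_by_vanish ut tf)).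
move=> /(_ t ut).
have -> : wnorm t (fun v => -1 * (gsum outs m f v - p * f v) + gsum outs m f v)
    = normsq p * wnorm t f.
  rewrite /wnorm mulr_sumr; apply: eq_bigr => v _.
  by rewrite -normsqM; congr normsq; ring.
rewrite normsqN (_ : normsq 1 = 1) ?mul1r; last by rewrite /normsq /=; ring.
have := wnorm_ge0 (nbhd t) (N f); rewrite -/c; set x := wnorm _ (N f); set y := wnorm t f.
move=> x0; rewrite !mulrA; nra.
Qed.

End LowerBound.

(** * Pointwise limits of complex sequences *)

Section ComplexSeq.
Variable R : realType.
Implicit Types (u w : nat -> R[i]) (l : R[i]).

Definition ccvg u l : Prop :=
  (fun n => Re (u n)) @ \oo --> Re l /\ (fun n => Im (u n)) @ \oo --> Im l.

Lemma ccvg_unique u l l' : ccvg u l -> ccvg u l' -> l = l'.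
Proof.
move=> [ur ui] [ur' ui']; apply/eqP; rewrite eq_complex; apply/andP; split.
  by apply/eqP; apply: (@cvg_unique _ _ _ _ _ _ ur ur').
by apply/eqP; apply: (@cvg_unique _ _ _ _ _ _ ui ui').
Qed.

Lemma ccvg_cst l : ccvg (fun=> l) l.
Proof. by split; apply: cvg_cst. Qed.

Lemma ccvgD u w l l' : ccvg u l -> ccvg w l' -> ccvg (fun n => u n + w n) (l + l').
Proof.
move=> [ur ui] [wr wi]; split.
  by under eq_fun do rewrite ReD; rewrite ReD; apply: cvgD.
by under eq_fun do rewrite ImD; rewrite ImD; apply: cvgD.
Qed.

Lemma ccvgZ a u l : ccvg u l -> ccvg (fun n => a * u n) (a * l).
Proof.
move=> [ur ui]; split.
  by under eq_fun do rewrite ReM; rewrite ReM; apply: cvgB; apply: cvgM => //; apply: cvg_cst.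
by under eq_fun do rewrite ImM; rewrite ImM; apply: cvgD; apply: cvgM => //; apply: cvg_cst.
Qed.

Lemma ccvg_sum (I : Type) (r : seq I) (u : nat -> I -> R[i]) (l : I -> R[i]) :
  (forall i, ccvg (fun n => u n i) (l i)) ->
  ccvg (fun n => \sum_(i <- r) u n i) (\sum_(i <- r) l i).
Proof.
move=> ul; elim: r => [|i r IHr].
  by under eq_fun do rewrite big_nil; rewrite big_nil; apply: ccvg_cst.
by under eq_fun do rewrite big_cons; rewrite big_cons; apply: ccvgD.
Qed.

Lemma ccvg_shift u l : ccvg u l -> ccvg (fun n => u n.+1) l.
Proof.
by move=> [ur ui]; split; [rewrite -cvg_shiftS in ur|rewrite -cvg_shiftS in ui].
Qed.

Lemma cvg_normsq u l : ccvg u l -> (fun n => normsq (u n)) @ \oo --> normsq l.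
Proof.
by move=> [ur ui]; apply: cvgD; under eq_fun do rewrite expr2; rewrite expr2; apply: cvgM.
Qed.

Lemma cvg_wnorm (V : eqType) (s : seq V) (F : nat -> V -> R[i]) (L : V -> R[i]) :
  (forall v, ccvg (fun n => F n v) (L v)) ->
  (fun n => wnorm s (F n)) @ \oo --> wnorm s L.
Proof.
move=> FL; rewrite /wnorm; elim: s => [|v s IHs].
  by under eq_fun do rewrite big_nil; rewrite big_nil; apply: cvg_cst.
by under eq_fun do rewrite big_cons; rewrite big_cons; apply: cvgD => //; apply: cvg_normsq.
Qed.

Lemma geometric_cvg (u : nat -> R) (a z : R) : 0 <= z < 1 ->
  (forall n, `|u n.+1 - u n| <= a * z ^+ n) -> cvgn u.
Proof.
move=> /andP[z0 z1] uz.
have a0 : 0 <= a by have := le_trans (normr_ge0 _) (uz 0%N); rewrite expr0 mulr1.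
have cv : cvgn (series (fun n => u n.+1 - u n)).
  apply: normed_cvg; apply: series_le_cvg (@is_cvg_geometric_series _ a z _) => //.
  - by move=> n; apply: normr_ge0.
  - by move=> n; rewrite /geometric /= mulr_ge0 ?exprn_ge0.
  - by rewrite ger0_norm.
have -> : u = (fun n => u 0%N + series (fun n => u n.+1 - u n) n).
  apply/funext => n; rewrite /series /= telescope_sumr// addrC subrK//.
by apply: is_cvgD => //; apply: is_cvg_cst.
Qed.

Lemma geometric_ccvg u (a z : R) : 0 <= a -> 0 <= z < 1 ->
  (forall n, normsq (u n.+1 - u n) <= a * z ^+ n) -> exists l, ccvg u l.
Proof.
move=> a0 /andP[z0 z1] uz.
have part (f : R[i] -> R) : (forall x y, f (x - y) = f x - f y) ->
    (forall x, f x ^+ 2 <= normsq x) -> cvgn (fun n => f (u n)).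
  move=> fB fle; apply: (@geometric_cvg _ (Num.sqrt a) (Num.sqrt z)).
    rewrite sqrtr_ge0/=; move: z1; rewrite -{1}(sqr_sqrtr z0) expr_lt1 ?sqrtr_ge0//.
  move=> n; have -> : Num.sqrt z ^+ n = Num.sqrt (z ^+ n).
    rewrite -[in RHS](sqr_sqrtr z0) -exprM mulnC exprM sqrtr_sqr.
    by rewrite ger0_norm// exprn_ge0// sqrtr_ge0.
  rewrite -fB -sqrtr_sqr -sqrtrM// ler_wsqrtr//.
  exact: le_trans (fle _) (uz n).
have cRe : cvgn (fun n => Re (u n)).
  apply: part => [x y|x]; first by rewrite ReD ReN.
  by rewrite lerDl sqr_ge0.
have cIm : cvgn (fun n => Im (u n)).
  apply: part => [x y|x]; first by rewrite ImD ImN.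
  by rewrite lerDr sqr_ge0.
by exists (Complex (limn (fun n => Re (u n))) (limn (fun n => Im (u n)))).
Qed.

End ComplexSeq.

Section NormBound.
Variables (R : realType) (V : choiceType).
Implicit Types f : V -> R[i].

Lemma norm2sq_le f (M : R) : (norm2sq f <= M%:E)%E <-> bounded_by f M.
Proof.
have sumE s : (\sum_(v <- s) ((ComplexField.Normc.normc (f v)) ^+ 2)%:E)%E = (wnorm s f)%:E.
  by rewrite sumEFin; congr EFin; apply: eq_bigr => v _; rewrite normc_sqr.
split=> [fM s us|fM].
  rewrite -lee_fin; apply: le_trans fM; apply: esum_ge; exists [set` s].
    by split.
  by rewrite -fsbig_seq// sumE.
apply: ge_ereal_sup => _ [A [finA _] <-].
by rewrite fsbig_finite//= sumE lee_fin; apply: fM; apply: finmap.fset_uniq.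
Qed.

Lemma l2P f : l2 f <-> exists M, bounded_by f M.
Proof.
split=> [f2|[M /norm2sq_le fM]]; last exact: le_lt_trans fM (ltry _).
exists (fine (norm2sq f)); apply/norm2sq_le.
rewrite fineK// ge0_fin_numE//; apply: esum_ge0 => v _.
by rewrite lee_fin sqr_ge0.
Qed.

Lemma norm2sq_bound (T : (V -> R[i]) -> V -> R[i]) (c : R) :
  (forall f M, bounded_by f M -> bounded_by (T f) (c * M)) ->
  forall f, l2 f -> (norm2sq (T f) <= c%:E * norm2sq f)%E.
Proof.
move=> Tc f f2.
have f_fin : norm2sq f \is a fin_num.
  rewrite ge0_fin_numE//; apply: esum_ge0 => v _; rewrite lee_fin; exact: sqr_ge0.
by rewrite -(fineK f_fin) -EFinM; apply/norm2sq_le/Tc/norm2sq_le; rewrite fineK.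
Qed.

End NormBound.

(** * Inverting A_1 - lam by a Neumann series *)

Section Resolvent.
Variables (R : realType) (V : choiceType) (outs ins : V -> seq V) (q : nat).
Hypothesis Hpl : plane_links outs ins q.
Hypothesis q_gt1 : (1 < q)%N.
Variable psi : V -> R.
Hypothesis psi_gt0 : forall v, 0 < psi v.
Hypothesis psi_outs : forall v, nsum outs psi v = 3 * q%:R * psi v.
Hypothesis psi_ins : forall v, nsum ins psi v = 3 * q%:R * psi v.
Variable lam : R[i].
Implicit Types (f g : V -> R[i]) (s t : seq V).

Local Notation N := (shift_op outs lam).
Local Notation N' := (shift_adj ins lam).
Local Notation nbhd := (nbhd outs ins).

Hypothesis lower : exists2 K : R, 0 < K & forall f t, uniq t -> vanish_off t f ->
  wnorm t f <= K * wnorm (nbhd t) (N f).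

(** Bounds the squared norms of N and N', by the Schur bound 3q for both Hecke operators; the
    summand 1 makes it positive. *)
Let M : R := 2 * (3 * q%:R) ^+ 2 + 2 * normsq lam + 1.

Let M_gt0 : 0 < M.
Proof. by rewrite ltr_wpDl// addr_ge0// mulr_ge0 ?sqr_ge0 ?normsq_ge0. Qed.

Lemma normsq_conj (x : R[i]) : normsq x^*%C = normsq x.
Proof. by case: x => a b; rewrite /normsq /= sqrrN. Qed.

Lemma shift_bounded f M0 : bounded_by f M0 -> bounded_by (N f) (M * M0).
Proof.
move=> fM; have M0_ge0 := bounded_by_ge0 fM.
have := bounded_byD (nsum_outs_bounded Hpl q_gt1 psi_gt0 psi_outs psi_ins fM)
  (bounded_byZ (- lam) fM).
rewrite normsqN => H; apply: bounded_by_le (eq_bounded_by _ H).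
  by rewrite /M; nra.
by move=> v; rewrite /shift_op mulNr.
Qed.

Lemma shift_adj_bounded f M0 : bounded_by f M0 -> bounded_by (N' f) (M * M0).
Proof.
move=> fM; have M0_ge0 := bounded_by_ge0 fM.
have := bounded_byD (nsum_ins_bounded Hpl q_gt1 psi_gt0 psi_outs psi_ins fM)
  (bounded_byZ (- lam^*%C) fM).
rewrite normsqN normsq_conj => H; apply: bounded_by_le (eq_bounded_by _ H).
  by rewrite /M; nra.
by move=> v; rewrite /shift_adj mulNr.
Qed.

Lemma shift_lin a f g v : N (fun w => a * f w + g w) v = a * N f v + N g v.
Proof. by rewrite /shift_op /nsum big_split /= -mulr_sumr; ring. Qed.

Lemma shift_adj_lin a f g v : N' (fun w => a * f w + g w) v = a * N' f v + N' g v.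
Proof. by rewrite /shift_adj /nsum big_split /= -mulr_sumr; ring. Qed.

(** The operator 1 - N' N / M. As N' N / M lies between a positive constant and 1, by [lower] and
    the choice of [M], D is a contraction and its Neumann series inverts N' N / M. *)
Let D f v := f v - (M^-1)%:C%C * N' (N f) v.

Let eq_shift f g : f =1 g -> N f =1 N g.
Proof. by move=> fg v; congr (N _ v); apply/funext. Qed.

Let eq_shift_adj f g : f =1 g -> N' f =1 N' g.
Proof. by move=> fg v; congr (N' _ v); apply/funext. Qed.

Lemma contr_lin a f g v : D (fun w => a * f w + g w) v = a * D f v + D g v.
Proof.
rewrite /D (eq_shift_adj (shift_lin a f g)) shift_adj_lin; ring.
Qed.

Lemma contr_shift f v : D (N f) v = N (D f) v.
Proof.
have -> : N (D f) v = N (fun w => - (M^-1)%:C%C * N' (N f) w + f w) v.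
  by apply: eq_shift => w; rewrite /D; ring.
rewrite shift_lin /D (shiftC Hpl _ (N f)); ring.
Qed.

Lemma contr_local f g s v : v \in s ->
  (forall w, w \in nbhd (nbhd s) -> f w = g w) -> D f v = D g v.
Proof.
move=> vs fg.
have Nfg w : w \in nbhd s -> N f w = N g w.
  move=> ws; rewrite /shift_op /nsum fg; last exact: mem_nbhd.
  by congr (_ - _); apply: eq_big_seq => u uw; apply: fg; apply: outs_nbhd uw.
rewrite /D fg; last by do 2!apply: mem_nbhd.
congr (_ - _ * _); rewrite /shift_adj /nsum Nfg; last exact: mem_nbhd.
by congr (_ - _); apply: eq_big_seq => u uv; apply: Nfg; apply: ins_nbhd uv.
Qed.

(** For finite support, |D f|^2 = |f|^2 - 2 |N f|^2 / M + |N' N f|^2 / M^2 <= |f|^2 - |N f|^2 / M,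
    and [lower] bounds |N f|^2 from below. The general case follows since D has finite range. *)
Lemma contr_bounded : exists2 theta : R, 0 <= theta < 1 &
  forall f M0, bounded_by f M0 -> bounded_by (D f) (theta * M0).
Proof.
have [K K0 lowerK] := lower.
(* Enlarging K by 1/M gives M K' >= 1, so that theta = 1 - 1/(M K') is nonnegative. *)
pose K' := K + M^-1; have Mi0 : 0 < M^-1 by rewrite invr_gt0.
have K'0 : 0 < K' by rewrite addr_gt0.
have MK' : 0 < M * K' by rewrite mulr_gt0.
exists (1 - (M * K')^-1).
  rewrite subr_ge0 invf_le1// ltrBlDr ltrDl invr_gt0 MK' andbT.
  by rewrite /K' mulrDr mulfV ?gt_eqF// lerDr mulr_ge0 ?ltW.
have theta0 : 0 <= 1 - (M * K')^-1.
  rewrite subr_ge0 invf_le1//.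
  by rewrite /K' mulrDr mulfV ?gt_eqF// lerDr mulr_ge0 ?ltW.
have fs f t s : uniq t -> uniq s -> vanish_off t f ->
    wnorm s (D f) <= (1 - (M * K')^-1) * wnorm t f.
  move=> ut us tf.
  have tN := vanish_N Hpl lam tf.
  have tN' := vanish_N' Hpl lam tN.
  have tf1 := vanish_nbhd (outs := outs) (ins := ins) tf.
  have tf2 := vanish_nbhd (outs := outs) (ins := ins) tf1.
  set T := nbhd (nbhd t) in tN' tf2 *.
  have uT : uniq T by apply: nbhd_uniq.
  have TD : vanish_off T (D f) by move=> v vT; rewrite /D tf2// tN'// mulr0 subr0.
  apply: le_trans (wnorm_vanish us uT TD) _.
  have -> : wnorm T (D f) = wnorm T f + M^-1 ^+ 2 * wnorm T (N' (N f))
      - 2 * M^-1 * wdot T f (N' (N f)).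
    rewrite /wnorm /wdot !mulr_sumr -big_split -sumrB /=; apply: eq_bigr => v _.
    by rewrite /normsq /D ReD ImD ReN ImN ReM ImM /=; ring.
  have -> : wdot T f (N' (N f)) = wnorm (nbhd t) (N f).
    by rewrite (wdot_shift_adj Hpl lam uT (nbhd_uniq _ _ t) tf2 tN) wdotE.
  have h1 := wnorm_vanish uT ut tf.
  have h2 : wnorm T (N' (N f)) <= M * wnorm (nbhd t) (N f).
    exact: shift_adj_bounded (bounded_by_vanish (nbhd_uniq _ _ t) tN) T uT.
  have h3 : wnorm t f <= K' * wnorm (nbhd t) (N f).
    apply: le_trans (lowerK f t ut tf) _.
    by apply: ler_wpM2r; rewrite ?wnorm_ge0// lerDl ltW.
  have h4 : M^-1 ^+ 2 * wnorm T (N' (N f)) <= M^-1 * wnorm (nbhd t) (N f).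
    apply: le_trans (ler_wpM2l (sqr_ge0 _) h2) _.
    by rewrite le_eqVlt; apply/orP; left; apply/eqP; field; rewrite gt_eqF.
  have h5 : (M * K')^-1 * wnorm t f <= M^-1 * wnorm (nbhd t) (N f).
    rewrite invfM -mulrA ler_pM2l// mulrC ler_pdivrMr// mulrC//.
  lra.
move=> f M0 fM s us; set T := nbhd (nbhd s).
have -> : wnorm s (D f) = wnorm s (D (restr T f)).
  apply: eq_big_seq => v vs; congr normsq; apply: (contr_local vs) => w wT.
  by rewrite /restr wT.
apply: le_trans (fs _ T s (nbhd_uniq _ _ _) us (@restr_vanish _ _ T f)) _.
by rewrite wnorm_restr ler_wpM2l//; apply: fM; apply: nbhd_uniq.
Qed.

Let eq_contr f g : f =1 g -> D f =1 D g.
Proof. by move=> fg v; congr (D _ v); apply/funext. Qed.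

(** The partial sum of D^i f over i < n, in Horner form. *)
Let neum f n : V -> R[i] := iter n (fun g v => f v + D g v) (fun=> 0).

Lemma neum_diff f n v : neum f n.+1 v - neum f n v = iter n D f v.
Proof.
elim: n v => [|n IHn] v.
  rewrite /= subr0 -[RHS]addr0; congr (_ + _).
  transitivity (D (fun w => -1 * 0 + 0) v).
    by apply: eq_contr => w; rewrite mulr0 addr0.
  by rewrite (contr_lin (-1) (fun=> 0) (fun=> 0)) (mulN1r (D _ _)) addNr.
rewrite [neum f n.+2 v]/= -/(neum f n) [neum f n.+1 v]/= -/(neum f n).
rewrite opprD addrACA subrr add0r -/(neum f n.+1).
rewrite -[iter n.+1 D f v]/(D (iter n D f) v) addrC -mulN1r -contr_lin.
by apply: eq_contr => w; rewrite -IHn mulN1r addrC.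
Qed.

Lemma neum_lin a f g n v :
  neum (fun w => a * f w + g w) n v = a * neum f n v + neum g n v.
Proof.
elim: n v => [|n IHn] v /=; first by rewrite mulr0 addr0.
by rewrite -!/(neum _ n) (eq_contr IHn) contr_lin; ring.
Qed.

Lemma neum_shift f n v : neum (N f) n v = N (neum f n) v.
Proof.
elim: n v => [|n IHn] v /=.
  by rewrite /shift_op /nsum mulr0 subr0 big1.
rewrite -!/(neum _ n) (eq_contr IHn) contr_shift.
rewrite -[N f v]mul1r -shift_lin; apply: eq_shift => w; by rewrite mul1r.
Qed.

Lemma ccvg_shift_op (F : nat -> V -> R[i]) (L : V -> R[i]) :
  (forall v, ccvg (fun n => F n v) (L v)) ->
  forall v, ccvg (fun n => N (F n) v) (N L v).
Proof.
move=> FL v; rewrite /shift_op -mulNr; under eq_fun do rewrite -mulNr.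
by apply: ccvgD; [apply: ccvg_sum|apply: ccvgZ].
Qed.

Lemma ccvg_shift_adj (F : nat -> V -> R[i]) (L : V -> R[i]) :
  (forall v, ccvg (fun n => F n v) (L v)) ->
  forall v, ccvg (fun n => N' (F n) v) (N' L v).
Proof.
move=> FL v; rewrite /shift_adj -mulNr; under eq_fun do rewrite -mulNr.
by apply: ccvgD; [apply: ccvg_sum|apply: ccvgZ].
Qed.

Lemma ccvg_contr (F : nat -> V -> R[i]) (L : V -> R[i]) :
  (forall v, ccvg (fun n => F n v) (L v)) ->
  forall v, ccvg (fun n => D (F n) v) (D L v).
Proof.
move=> FL v; rewrite /D -mulNr; under eq_fun do rewrite -mulNr.
by apply: ccvgD => //; apply: ccvgZ; apply/ccvg_shift_adj/ccvg_shift_op.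
Qed.

Let neum_lim f v : R[i] := xget 0 [set l | ccvg (fun n => neum f n v) l].

Lemma neum_limP f M0 : bounded_by f M0 ->
  forall v, ccvg (fun n => neum f n v) (neum_lim f v).
Proof.
move=> fM v; have [theta theta01 Dle] := contr_bounded.
have itD n : bounded_by (iter n D f) (M0 * theta ^+ n).
  elim: n => [|n IHn]; first by rewrite mulr1.
  by rewrite exprS mulrCA; apply: Dle.
suff lP : exists l, ccvg (fun n => neum f n v) l by exact: (xgetPex 0 lP).
apply: (geometric_ccvg (bounded_by_ge0 fM) theta01) => n.
by rewrite neum_diff; have := itD n [:: v] isT; rewrite /wnorm big_seq1.
Qed.

Lemma neum_lim_bounded : exists C : R, forall f M0, bounded_by f M0 ->
  bounded_by (neum_lim f) (C * M0).
Proof.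
have [theta /andP[th0 th1] Dle] := contr_bounded.
(* In |x + y|^2 <= (1 + 1/e) |x|^2 + (1 + e) |y|^2 this choice gives (1 + e) theta < 1, whereas the
   factor 2 would require theta < 1/2. [C] is the fixed point of the resulting recursion for the
   squared norms. *)
pose e := (1 - theta) / 2; have e0 : 0 < e by rewrite divr_gt0// subr_gt0.
have d0 : 0 < 1 - (1 + e) * theta.
  rewrite [ltRHS](_ : _ = (1 - theta) * (1 - theta / 2)); last by rewrite /e; field.
  by apply: mulr_gt0; lra.
pose C := (1 + e^-1) / (1 - (1 + e) * theta).
have e1 : 0 <= 1 + e^-1 by rewrite addr_ge0 ?invr_ge0 ?ltW.
have e2 : 0 <= 1 + e by rewrite addr_ge0 ?ltW.
have C0 : 0 <= C by rewrite divr_ge0// ltW.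
have CE : (1 + e^-1) + (1 + e) * theta * C = C.
  by rewrite /C; field; rewrite !gt_eqF.
have young (x y : R[i]) : normsq (x + y) <= (1 + e^-1) * normsq x + (1 + e) * normsq y.
  rewrite /normsq ReD ImD; set a := Re x; set b := Im x; set c := Re y; set d := Im y.
  have h1 : 0 <= e^-1 * (a - e * c) ^+ 2 by rewrite mulr_ge0 ?sqr_ge0 ?invr_ge0 ?ltW.
  have h2 : 0 <= e^-1 * (b - e * d) ^+ 2 by rewrite mulr_ge0 ?sqr_ge0 ?invr_ge0 ?ltW.
  have := addr_ge0 h1 h2; rewrite -subr_ge0 => h3; rewrite -subr_ge0.
  by move: h3; rewrite subr0; congr (_ <= _); field; rewrite gt_eqF.
exists C => f M0 fM.
have M0_ge0 := bounded_by_ge0 fM.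
have neum_le n : bounded_by (neum f n) (C * M0).
  elim: n => [|n IHn] s us.
    rewrite (_ : wnorm s (neum f 0) = 0); first exact: mulr_ge0.
    by rewrite /wnorm big1// => v _; apply: normsq0.
  rewrite -{1}CE mulrDl.
  apply: (@le_trans _ _ ((1 + e^-1) * wnorm s f + (1 + e) * wnorm s (D (neum f n)))).
    by rewrite /wnorm !mulr_sumr -big_split; apply: ler_sum => v _; apply: young.
  rewrite lerD//; first by rewrite ler_wpM2l// fM.
  have -> : (1 + e) * theta * C * M0 = (1 + e) * (theta * (C * M0)) by ring.
  by apply: ler_wpM2l => //; exact: Dle IHn s us.
move=> s us; have cv := @cvg_wnorm _ _ s _ _ (neum_limP fM).
rewrite -(cvg_lim (@Rhausdorff _) cv); apply: limr_le; first by apply/cvg_ex; exists (wnorm s (neum_lim f)).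
by apply: nearW => n; apply: neum_le.
Qed.

Lemma neum_lim_fix f M0 v : bounded_by f M0 ->
  N' (N (neum_lim f)) v = M%:C%C * f v.
Proof.
move=> fM.
have := ccvg_unique (ccvg_shift (neum_limP fM v))
  (ccvgD (ccvg_cst (f v)) (ccvg_contr (neum_limP fM) v)).
rewrite /D; set x := N' _ v; set y := neum_lim f v => yE.
have M0' : M%:C%C != 0 by rewrite fmorph_eq0 gt_eqF.
have -> : f v = (M^-1)%:C%C * x.
  by apply/eqP; rewrite -subr_eq0; apply/eqP; apply: (addrI y); rewrite addr0 [RHS]yE; ring.
by rewrite fmorphV mulrA mulfV// mul1r.
Qed.

(** The limit L of the Neumann series satisfies N' N L = M, so N' L / M is the candidate. It is a
    left inverse because L commutes with N, and a right inverse because N' commutes with N. *)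
Lemma shift_invertible : exists S : (V -> R[i]) -> V -> R[i],
  l2_bounded_operator S /\ forall f, l2 f -> S (N f) = f /\ N (S f) = f.
Proof.
pose S f v := (M^-1)%:C%C * N' (neum_lim f) v.
have M0' : M%:C%C != 0 :> R[i] by rewrite fmorph_eq0 gt_eqF.
have MK (x : R[i]) : (M^-1)%:C%C * (M%:C%C * x) = x.
  by rewrite fmorphV mulKf.
have [C CP] := neum_lim_bounded.
have Sbd f M0 : bounded_by f M0 -> bounded_by (S f) (normsq (M^-1)%:C%C * (M * C) * M0).
  by move=> fM; rewrite -!mulrA; apply/bounded_byZ/shift_adj_bounded/CP.
exists S; split; first split.
- move=> f /l2P[M0 fM]; apply/l2P; eexists; exact: Sbd fM.
- move=> a f g /l2P[M1 fM] /l2P[M2 gM]; apply/funext => v; rewrite /S.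
  have fgM : exists M3, bounded_by (fun v => a * f v + g v) M3.
    by eexists; exact: bounded_byD (bounded_byZ a fM) gM.
  have {fgM}[M3 fgM] := fgM.
  have -> : neum_lim (fun v => a * f v + g v) = fun v => a * neum_lim f v + neum_lim g v.
    apply/funext => w; apply: ccvg_unique (neum_limP fgM w) _.
    under eq_fun do rewrite neum_lin.
    by apply: ccvgD; [apply: ccvgZ|]; [exact: neum_limP fM w|exact: neum_limP gM w].
  by rewrite shift_adj_lin; ring.
- by exists (normsq (M^-1)%:C%C * (M * C)); apply: norm2sq_bound.
move=> f /l2P[M0 fM]; split; apply/funext => v.
  rewrite /S.
  have -> : neum_lim (N f) = N (neum_lim f).
    apply/funext => w.
    apply: ccvg_unique (neum_limP (shift_bounded fM) w) _.
    under eq_fun do rewrite neum_shift.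
    by apply: ccvg_shift_op; exact: neum_limP fM.
  by rewrite (neum_lim_fix v fM) MK.
have -> : N (S f) v = (M^-1)%:C%C * N (N' (neum_lim f)) v.
  rewrite -[RHS]addr0 -[X in _ + X](_ : N (fun=> 0) v = 0); last first.
    by rewrite /shift_op /nsum mulr0 subr0 big1.
  by rewrite -shift_lin; apply: eq_shift => w; rewrite addr0.
by rewrite -(shiftC Hpl) (neum_lim_fix v fM) MK.
Qed.

End Resolvent.

(** * Growth of the geodesic eigenvalues off the unit circle *)

Section ScalarGrowth.
Variable R : realType.

(** With s the eighth root of r, Bernoulli gives r^k >= (1 + k (s - 1))^8, which beats a quartic.
    The quartic arises as the square of the quadratic bound (m + 2)^2 at m <= k + 3. *)
Lemma exp_beats_quartic (r a K : R) : 1 < r -> 0 < a ->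
  exists k : nat, K * (k%:R + 5) ^+ 4 < a * r ^+ k.
Proof.
move=> r1 a0.
wlog K0 : K / 0 <= K => [H|].
  have [k kP] := H `|K| (normr_ge0 _); exists k; apply: le_lt_trans kP.
  by rewrite ler_wpM2r ?exprn_ge0 ?addr_ge0// ler_norm.
pose s := Num.sqrt (Num.sqrt (Num.sqrt r)).
have s8 : s ^+ 8 = r.
  rewrite (_ : 8 = 2 * (2 * 2))%N// exprM sqr_sqrtr ?sqrtr_ge0//.
  by rewrite exprM sqr_sqrtr ?sqrtr_ge0// sqr_sqrtr// ltW// (lt_trans ltr01).
have s1 : 1 < s.
  rewrite ltNge; apply/negP => s1; have : s ^+ 8 <= 1 by rewrite exprn_ile1// sqrtr_ge0.
  by rewrite s8 leNgt r1.
pose h := s - 1; have h0 : 0 < h by rewrite subr_gt0.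
have bern k : 1 + k%:R * h <= s ^+ k.
  elim: k => [|k IHk]; first by rewrite mul0r addr0.
  rewrite exprSr -natr1; have kh : 0 <= k%:R * h ^+ 2 by rewrite mulr_ge0// sqr_ge0.
  apply: le_trans (ler_wpM2r _ IHk); last by rewrite ltW// (lt_trans ltr01).
  by rewrite /h in kh *; move: kh; rewrite expr2; nra.
(* Chosen so that k + 5 <= c (1 + k h), which reduces the claim to powers of 1 + k h. *)
pose c := 5 + h^-1; have c0 : 0 < c by rewrite addr_gt0// invr_gt0.
pose x := K * c ^+ 4 / a.
have c4 : 0 <= c ^+ 4 by rewrite exprn_ge0// ltW.
have x0 : 0 <= x by apply: divr_ge0; [exact: mulr_ge0|exact: ltW].
pose k := (Num.truncn (x / h)).+1; exists k.
have kx : x < k%:R * h by rewrite -ltr_pdivrMr// truncnS_gt.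
have kh0 : 0 <= k%:R * h by rewrite mulr_ge0 ?ltW.
have ck : k%:R + 5 <= c * (1 + k%:R * h).
  have -> : c * (1 + k%:R * h) = 5 + h^-1 + 5 * (k%:R * h) + k%:R.
    by rewrite /c; field; rewrite gt_eqF.
  have : 0 <= h^-1 by rewrite invr_ge0 ltW.
  lra.
apply: (@le_lt_trans _ _ (K * (c * (1 + k%:R * h)) ^+ 4)).
  have k5 : 0 <= k%:R + 5 :> R by apply: addr_ge0.
  by apply: ler_wpM2l => //; rewrite lerXn2r ?nnegrE// (le_trans k5).
apply: (@lt_le_trans _ _ (a * (1 + k%:R * h) ^+ 8)); last first.
  have kh1 : 0 <= 1 + k%:R * h by apply: addr_ge0.
  rewrite (ler_wpM2l (ltW a0))// -s8 -exprM mulnC exprM lerXn2r ?nnegrE//.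
  by rewrite exprn_ge0// ltW// (lt_trans ltr01).
set y := 1 + _; have y1 : 1 <= y by rewrite lerDl.
have y0 : 0 < y by rewrite (lt_le_trans ltr01).
have -> : K * (c * y) ^+ 4 = a * x * y ^+ 4.
  by rewrite /x; field; rewrite gt_eqF.
rewrite (_ : y ^+ 8 = y ^+ 4 * y ^+ 4); last by rewrite -exprD.
rewrite -mulrA ltr_pM2l// ltr_pM2r ?exprn_gt0//.
apply: lt_le_trans kx _; apply: (@le_trans _ _ y); first by rewrite lerDr.
by rewrite -[leLHS]expr1 ler_weXn2l.
Qed.

Lemma geo_eig_max_le (q : nat) m : (0 < q)%N ->
  geo_eig q (3 * q%:R) (3 * q%:R) m <= (m%:R + 2) ^+ 2 * q%:R ^+ m :> R.
Proof.
move=> q0; case: m => [|m]; first by rewrite /= expr0 mulr1 expr2; lra.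
have q1 : 1 <= q%:R :> R by rewrite ler1n.
have q2 : 0 < 2 * q%:R ^+ 2 :> R by rewrite mulr_gt0// exprn_gt0// (lt_le_trans ltr01).
rewrite -(ler_pM2l q2) geo_eig_max -[m.+1%:R]natr1.
have -> : 2 * q%:R ^+ 2 * ((m%:R + 1 + 2) ^+ 2 * q%:R ^+ m.+1) =
  q%:R ^+ m.+1 * (2 * q%:R ^+ 2 * (m%:R + 3) ^+ 2) :> R by ring.
rewrite ler_wpM2l ?exprn_ge0//.
have m0 : 0 <= m%:R :> R by [].
move: m0 q1; move: (m%:R) (q%:R) => x y x0 y1.
have h1 : 0 <= x * (x + 2) * y by rewrite !mulr_ge0 ?addr_ge0//; lra.
have h2 : x * (x - 1) <= (x + 3) ^+ 2 * y ^+ 2.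
  apply: (@le_trans _ _ ((x + 3) ^+ 2)); first by rewrite expr2; nra.
  by rewrite ler_peMr ?sqr_ge0// expr2; nra.
have h3 : (x + 2) * (x + 3) * y ^+ 2 <= (x + 3) ^+ 2 * y ^+ 2.
  by rewrite ler_wpM2r ?sqr_ge0// expr2; nra.
nra.
Qed.

(** The bound [pc], assumed for all m, would make the sequence at most polynomial times q^m, and so
    would any fixed combination of consecutive terms; but one such combination is exactly geometric
    of ratio q z with |z| > 1. *)
Lemma geo_eig_unbounded (q : nat) (z z2 z3 : R[i]) : (1 < q)%N ->
  z * z2 * z3 = 1 -> 1 < normsq z -> normsq z2 <= normsq z -> normsq z3 <= normsq z ->
  let lam := q%:R * (z + z2 + z3) in
  let mu := q%:R * (z * z2 + z * z3 + z2 * z3) in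
  exists m, 2 * geo_eig q (3 * q%:R) (3 * q%:R) m ^+ 2 < normsq (geo_eig q lam mu m).
Proof.
move=> q1 zzz z1 zz2 zz3 lam mu; apply/not_existsP => H.
have q0 : 0 < q%:R :> R by rewrite ltr0n ltnW.
pose p := geo_eig q lam mu.
pose c m : R := geo_eig q (3 * q%:R) (3 * q%:R) m.
have pc m : normsq (p m) <= 2 * c m ^+ 2 by rewrite leNgt; apply/negP/H.
pose rho := q%:R * z.
(* The coefficients of (X - q z2) (X - q z3): applied as a difference operator, it kills the modes
   of z2 and z3, also when roots coincide. The remaining amplitude [kap] is nonzero because |q z| >
   |z| >= |z2|, |z3|. *)
pose al := - q%:R * (z2 + z3); pose be := q%:R ^+ 2 * (z2 * z3).
pose y k := p k.+3 + al * p k.+2 + be * p k.+1.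
pose kap := q%:R * z * (q%:R * z - z2) * (q%:R * z - z3).
have yE k : y k = rho ^+ k * kap.
  elim: k => [|k IHk].
    rewrite expr0 mul1r /y /p /kap /=.
    rewrite -[((q ^ 2 + q + 1) * q)%:R]/(((q ^ 2 + q + 1) * q)%N%:R : R[i]).
    rewrite natrM !natrD natrX -[q.+1%:R]natr1.
    have -> : (q%:R ^+ 2 + q%:R + 1) * q%:R = (q%:R ^+ 2 + q%:R + 1) * q%:R * (z * z2 * z3) :> R[i].
      by rewrite zzz mulr1.
    rewrite /lam /mu /al /be; ring.
  rewrite exprS -mulrA -IHk /y [p k.+4]geo_eigS -/p natrX.
  have -> : q%:R ^+ 3 * p k.+1 = q%:R ^+ 3 * (z * z2 * z3) * p k.+1.
    by rewrite zzz mulr1.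
  by rewrite /lam /mu /al /be /rho; ring.
have normsq_q : normsq (q%:R : R[i]) = q%:R ^+ 2.
  by rewrite -(rmorph_nat (real_complex R)) /normsq /= expr0n addr0.
have nz0 (x : R[i]) : x != 0 -> 0 < normsq x.
  move=> x0; rewrite lt0r normsq_ge0 andbT; apply: contra x0.
  by rewrite paddr_eq0 ?sqr_ge0// !sqrf_eq0 eq_complex.
have kap0 : 0 < normsq kap.
  have qz w : normsq w <= normsq z -> q%:R * z - w != 0.
    move=> wz; apply/negP; rewrite subr_eq0 => /eqP E.
    move: wz; rewrite -E normsqM normsq_q leNgt => /negP; apply.
    rewrite ltr_pMl ?(lt_trans ltr01)// exprn_egt1// ltr1n//.
  apply: nz0; rewrite !mulf_neq0 ?qz//; first by rewrite pnatr_eq0 -lt0n ltnW.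
  by apply: contraTneq z1 => ->; rewrite normsq0 -leNgt.
pose K := 4 * (1 + normsq al + normsq be).
pose K' := 2 * K * q%:R ^+ 6.
have [k] := @exp_beats_quartic (normsq z) (normsq kap) K' z1 kap0.
apply/negP; rewrite -leNgt.
pose X := (k%:R + 5) ^+ 4 * (q%:R ^+ 6 * (q%:R ^+ k) ^+ 2) : R.
have cb j : (j <= 3)%N -> c (k + j)%N ^+ 2 <= X.
  move=> j3; have -> : X = ((k%:R + 5) ^+ 2 * q%:R ^+ (k + 3)) ^+ 2.
    by rewrite /X exprD; ring.
  have k5 : 0 <= k%:R + 5 :> R by apply: addr_ge0.
  have ck0 : 0 <= c (k + j)%N by apply: geo_eig_max_ge0.
  have ck : c (k + j)%N <= (k%:R + 5) ^+ 2 * q%:R ^+ (k + 3).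
    apply: le_trans (geo_eig_max_le _ (ltnW q1)) _; apply: ler_pM.
    - by rewrite sqr_ge0.
    - by rewrite exprn_ge0.
    - rewrite lerXn2r ?nnegrE ?addr_ge0// -!natrD ler_nat; lia.
    - by apply: ler_weXn2l; [rewrite ler1n ltnW|rewrite leq_add2l].
  by rewrite lerXn2r ?nnegrE// (le_trans ck0).
have ylb : normsq (y k) = (q%:R ^+ k) ^+ 2 * (normsq kap * normsq z ^+ k).
  have normsqX n : normsq (rho ^+ n) = normsq rho ^+ n.
    elim: n => [|n IHn]; first by rewrite !expr0 /normsq /= expr0n expr1n addr0.
    by rewrite !exprS normsqM IHn.
  by rewrite yE normsqM normsqX /rho normsqM normsq_q exprMn exprAC; ring.
have yub : normsq (y k) <= (q%:R ^+ k) ^+ 2 * (K' * (k%:R + 5) ^+ 4).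
  have -> : (q%:R ^+ k) ^+ 2 * (K' * (k%:R + 5) ^+ 4) =
      2 * (2 * (2 * X) + 2 * (normsq al * (2 * X))) + 2 * (normsq be * (2 * X))
      + 4 * (normsq be * X).
    by rewrite /X /K' /K; ring.
  have [al0 be0] : 0 <= normsq al /\ 0 <= normsq be by split; apply: normsq_ge0.
  have X0 : 0 <= X := le_trans (sqr_ge0 _) (cb 0%N isT).
  rewrite ler_wpDr//; first by rewrite !mulr_ge0.
  apply: le_trans (normsqD_le _ _) _; rewrite normsqM; apply: lerD.
    rewrite ler_pM2l//; apply: le_trans (normsqD_le _ _) _; rewrite normsqM; apply: lerD.
      by rewrite ler_pM2l// (le_trans (pc _))// ler_pM2l// -addn3 cb.
    by rewrite ler_pM2l// ler_wpM2l// (le_trans (pc _))// ler_pM2l// -addn2 cb.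
  by rewrite ler_pM2l// ler_wpM2l// (le_trans (pc _))// ler_pM2l// -addn1 cb.
by move: yub; rewrite ylb ler_pM2l// exprn_gt0// exprn_gt0.
Qed.

(** The roots of X^3 - a X^2 + b X - 1; for a = lam / q and b = mu / q they are the Satake
    parameters. *)
Lemma cubic_roots (a b : R[i]) : exists z1 z2 z3,
  [/\ a = z1 + z2 + z3, b = z1 * z2 + z1 * z3 + z2 * z3 & z1 * z2 * z3 = 1].
Proof.
pose cubic x y w : {poly R[i]} := 'X^3 - x%:P * 'X^2 + y%:P * 'X - w%:P.
have cubic_coef x y w : [/\ (cubic x y w)`_3 = 1, (cubic x y w)`_2 = - x,
    (cubic x y w)`_1 = y & (cubic x y w)`_0 = - w].
  by split; rewrite /cubic !(coefB, coefD, coefXn, coefX, coefC, coefCM) /=; ring.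
have cubic_size x y w : (size (cubic x y w) <= 4)%N.
  by apply/leq_sizeP => -[|[|[|[|j]]]] // _;
    rewrite /cubic !(coefB, coefD, coefXn, coefX, coefC, coefCM) /=; ring.
have [c3 _ _ _] := cubic_coef a b 1.
have size4 : size (cubic a b 1) = 4%N.
  apply/eqP; rewrite eqn_leq cubic_size ltnNge; apply/negP => /leq_sizeP/(_ 3%N isT).
  by rewrite c3 => /eqP; rewrite oner_eq0.
have [r pr] := closed_field_poly_normal (cubic a b 1).
have lc : lead_coef (cubic a b 1) = 1 by rewrite lead_coefE size4.
rewrite lc scale1r in pr.
have := size_prod_XsubC r id; rewrite -pr size4 => /eqP; rewrite eqSS eq_sym.
case: r pr => [|z1 [|z2 [|z3 [|? ?]]]] //=.
rewrite !big_cons big_nil mulr1 => pr _; exists z1, z2, z3.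
have E : cubic a b 1 = cubic (z1 + z2 + z3) (z1 * z2 + z1 * z3 + z2 * z3) (z1 * z2 * z3).
  by rewrite pr /cubic !rmorphD /= !rmorphM /=; ring.
have [_ e2 e1 e0] := cubic_coef a b 1.
have [_ f2 f1 f0] := cubic_coef (z1 + z2 + z3) (z1 * z2 + z1 * z3 + z2 * z3) (z1 * z2 * z3).
split; last by apply/esym/oppr_inj; rewrite -e0 E f0.
  by apply: oppr_inj; rewrite -e2 E f2.
by rewrite -e1 E f1.
Qed.

Lemma normsq_norm (x : R[i]) : `|x| = 1 <-> normsq x = 1.
Proof.
have [E x0] : (normsq x)%:C%C = `|x| ^+ 2 /\ 0 <= `|x| by rewrite add_Re2_Im2.
split=> [H|H]; first by apply: (@complexI R); rewrite E H expr1n.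
by apply/eqP; rewrite -(@pexpr_eq1 _ _ 2)// -E H.
Qed.

(* Either all Satake parameters have modulus one, which bounds the geodesic
   eigenvalues by their value at (1, 1, 1), or these grow too fast. *)
Lemma geo_eig_dichotomy (q : nat) (lam mu : R[i]) : (1 < q)%N ->
  (forall m, `|geo_eig q lam mu m| <= geo_eig q (3 * q%:R) (3 * q%:R) m) \/
  (exists m, 2 * geo_eig q (3 * q%:R) (3 * q%:R) m ^+ 2 < normsq (geo_eig q lam mu m)).
Proof.
move=> q1.
have q0 : q%:R != 0 :> R[i] by rewrite pnatr_eq0 -lt0n ltnW.
have [z1 [z2 [z3 [e1 e2 e3]]]] := cubic_roots (lam / q%:R) (mu / q%:R).
have -> : lam = q%:R * (z1 + z2 + z3) by rewrite -e1 mulrC divfK.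
have -> : mu = q%:R * (z1 * z2 + z1 * z3 + z2 * z3) by rewrite -e2 mulrC divfK.
clear e1 e2.
(* Here z has the largest modulus. If that is at most 1, the product 1 forces all moduli to be 1;
   otherwise the eigenvalues grow. The rest of the proof permutes the roots. *)
have step (z w1 w2 : R[i]) : z * w1 * w2 = 1 -> normsq w1 <= normsq z -> normsq w2 <= normsq z ->
  (forall m, `|geo_eig q (q%:R * (z + w1 + w2)) (q%:R * (z * w1 + z * w2 + w1 * w2)) m|
     <= geo_eig q (3 * q%:R) (3 * q%:R) m) \/
  (exists m, 2 * geo_eig q (3 * q%:R) (3 * q%:R) m ^+ 2 <
     normsq (geo_eig q (q%:R * (z + w1 + w2)) (q%:R * (z * w1 + z * w2 + w1 * w2)) m)).
  move=> zw h1 h2; have [z1'|z1'] := leP (normsq z) 1; [left=> m|right]; last exact: (geo_eig_unbounded q1 zw z1' h1 h2).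
  have := congr1 (@normsq R) zw; rewrite !normsqM (_ : normsq 1 = 1); last first.
    by rewrite /normsq /= expr1n expr0n addr0.
  have := normsq_ge0 z; have := normsq_ge0 w1; have := normsq_ge0 w2.
  move: h1 h2 z1'; set a := normsq z; set b := normsq w1; set c := normsq w2.
  move=> h1 h2 a1 c0 b0 a0 abc.
  have ab1 : a * b <= 1 by rewrite mulr_ile1// (le_trans h1).
  have c1 : c = 1 by nra.
  have b1 : b = 1 by nra.
  have a1' : a = 1 by nra.
  by apply: norm_geo_eig_le => //; apply/normsq_norm.
have [h12|h12] := leP (normsq z2) (normsq z1); have [h13|h13] := leP (normsq z3) (normsq z1).
- exact: step.
- have := step z3 z1 z2; rewrite (_ : z3 * z1 * z2 = z1 * z2 * z3); last by ring.
  rewrite (_ : z3 + z1 + z2 = z1 + z2 + z3); last by ring.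
  rewrite (_ : z3 * z1 + z3 * z2 + z1 * z2 = z1 * z2 + z1 * z3 + z2 * z3); last by ring.
  by apply => //; [exact: ltW|apply: le_trans h12 (ltW h13)].
- have := step z2 z1 z3; rewrite (_ : z2 * z1 * z3 = z1 * z2 * z3); last by ring.
  rewrite (_ : z2 + z1 + z3 = z1 + z2 + z3); last by ring.
  rewrite (_ : z2 * z1 + z2 * z3 + z1 * z3 = z1 * z2 + z1 * z3 + z2 * z3); last by ring.
  by apply => //; [exact: ltW|apply: le_trans h13 (ltW h12)].
have [h23|h23] := leP (normsq z2) (normsq z3).
  have := step z3 z1 z2; rewrite (_ : z3 * z1 * z2 = z1 * z2 * z3); last by ring.
  rewrite (_ : z3 + z1 + z2 = z1 + z2 + z3); last by ring.
  rewrite (_ : z3 * z1 + z3 * z2 + z1 * z2 = z1 * z2 + z1 * z3 + z2 * z3); last by ring.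
  by apply => //; exact: ltW.
have := step z2 z1 z3; rewrite (_ : z2 * z1 * z3 = z1 * z2 * z3); last by ring.
rewrite (_ : z2 + z1 + z3 = z1 + z2 + z3); last by ring.
rewrite (_ : z2 * z1 + z2 * z3 + z1 * z3 = z1 * z2 + z1 * z3 + z2 * z3); last by ring.
by apply => //; exact: ltW.
Qed.

End ScalarGrowth.

Section SpectralBound.
Variables (R : realType) (V : choiceType) (outs ins : V -> seq V) (q : nat).
Hypothesis Hpl : plane_links outs ins q.
Hypothesis q_gt1 : (1 < q)%N.
Variable psi : V -> R.
Hypothesis psi_gt0 : forall v, 0 < psi v.
Hypothesis psi_outs : forall v, nsum outs psi v = 3 * q%:R * psi v.
Hypothesis psi_ins : forall v, nsum ins psi v = 3 * q%:R * psi v.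

Lemma spectrum_geo_eig_le (lam : R[i]) m : l2_spectrum (nsum outs (Z := R[i])) lam ->
  `|geo_eig q lam lam^*%C m| <= geo_eig q (3 * q%:R) (3 * q%:R) m.
Proof.
move=> spec; have [->//|[m' H]] := geo_eig_dichotomy lam lam^*%C q_gt1.
have low := shift_lower_bound Hpl q_gt1 psi_gt0 psi_outs psi_ins H.
have := shift_invertible Hpl q_gt1 psi_gt0 psi_outs psi_ins low.
by move=> inv; exfalso; exact: spec inv.
Qed.

End SpectralBound.

(** * Lattices and vertices of the building *)

Section Valuation.
Variable F : localField.
Implicit Types x y : F.

Definition vge (n : int) x : bool := (x == 0) || (n <= ord x).

Lemma frac_idealE n x : frac_ideal F n x <-> vge n x.
Proof.
split=> [[->|H]|/orP[/eqP ->|H]]; rewrite /vge ?eqxx ?H ?orbT//.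
  by left.
by right.
Qed.

Lemma ord_one : ord (1 : F) = 0.
Proof.
have := ordM (oner_neq0 F) (oner_neq0 F); rewrite mulr1 => /eqP.
by rewrite -subr_eq0 opprD addNKr oppr_eq0 => /eqP.
Qed.

Lemma ordV x : x != 0 -> ord x^-1 = - ord x.
Proof.
move=> x0; have x0' : x^-1 != 0 by rewrite invr_eq0.
by have := ordM x0 x0'; rewrite mulfV// ord_one => /esym/eqP; rewrite addrC addr_eq0 => /eqP.
Qed.

Lemma ordN x : ord (- x) = ord x.
Proof.
have [->|x0] := eqVneq x 0; first by rewrite oppr0.
have m0 : (-1 : F) != 0 by rewrite oppr_eq0 oner_eq0.
have := ordM m0 m0; rewrite mulrNN mulr1 ord_one => om.
by rewrite -mulN1r ordM//; lia.
Qed.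

Lemma ordX x n : x != 0 -> ord (x ^+ n) = ord x *+ n.
Proof.
move=> x0; elim: n => [|n IHn]; first by rewrite ord_one.
by rewrite exprS ordM ?expf_neq0// IHn mulrS.
Qed.

Lemma vge0 n : vge n 0. Proof. by rewrite /vge eqxx. Qed.

Lemma vgeE n x : x != 0 -> vge n x = (n <= ord x).
Proof. by rewrite /vge => /negbTE ->. Qed.

Lemma vge1 : vge 0 1. Proof. by rewrite vgeE ?oner_neq0// ord_one. Qed.

Lemma vgeD n x y : vge n x -> vge n y -> vge n (x + y).
Proof.
have [->|x0] := eqVneq x 0; first by rewrite add0r.
have [->|y0] := eqVneq y 0; first by rewrite addr0.
have [->|xy0] := eqVneq (x + y) 0; first by rewrite vge0.
rewrite !vgeE// => nx ny; apply: le_trans (ordD x0 y0 xy0).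
by rewrite le_min nx.
Qed.

Lemma vgeN n x : vge n (- x) = vge n x.
Proof. by rewrite /vge oppr_eq0 ordN. Qed.

Lemma vgeB n x y : vge n x -> vge n y -> vge n (x - y).
Proof. by move=> nx ny; apply: vgeD; rewrite ?vgeN. Qed.

Lemma vgeM n m x y : vge n x -> vge m y -> vge (n + m) (x * y).
Proof.
have [->|x0] := eqVneq x 0; first by rewrite mul0r !vge0.
have [->|y0] := eqVneq y 0; first by rewrite mulr0 !vge0.
by rewrite !vgeE ?mulf_neq0// ordM//; apply: lerD.
Qed.

Lemma vge0M x y : vge 0 x -> vge 0 y -> vge 0 (x * y).
Proof. exact: vgeM. Qed.

Lemma vge_sum (I : Type) (r : seq I) (P : pred I) (f : I -> F) n :
  (forall i, P i -> vge n (f i)) -> vge n (\sum_(i <- r | P i) f i).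
Proof. by move=> H; elim/big_ind: _ => //; [exact: vge0|exact: vgeD]. Qed.

Lemma vge_prod (I : Type) (r : seq I) (P : pred I) (f : I -> F) :
  (forall i, P i -> vge 0 (f i)) -> vge 0 (\prod_(i <- r | P i) f i).
Proof. by move=> H; elim/big_ind: _ => //; [exact: vge1|exact: vge0M]. Qed.

Lemma vge_le n m x : m <= n -> vge n x -> vge m x.
Proof. by rewrite /vge => mn /orP[->//|/(le_trans mn) ->]; rewrite orbT. Qed.



Lemma vge_unif : vge 0 (unif F).
Proof. by rewrite vgeE ?unif_neq0// ord_unif. Qed.

Lemma vge_div_unif n x : vge (n + 1) x = vge n (x / unif F).
Proof.
have u0 := unif_neq0 F.
have [->|x0] := eqVneq x 0; first by rewrite mul0r !vge0.
by rewrite !vgeE ?mulf_neq0 ?invr_eq0// ordM ?invr_eq0// ordV// ord_unif lerBrDr.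
Qed.

End Valuation.

Section ResidueSystem.
Variables (F : localField) (q : nat).
Hypothesis hq : (residue_field F #= `I_q)%card.

(** These representatives of the residue classes become the off-diagonal entries of the normal forms
    [nbr_mx]. *)
Lemma residue_system : exists r : 'I_q -> F, [/\ forall i, vge 0 (r i),
   forall x, vge 0 x -> exists i, vge 1 (x - r i) &
   forall i j, vge 1 (r i - r j) -> i = j].
Proof.
have /card_set_bijP[f [ff fi fs]] := card_esym hq.
have rP (i : 'I_q) : exists x : F, vge 0 x /\ f i = [set y | ord_ideal (@ord F) 1 (y - x)].
  have /ff [x xO xf] : `I_q i by exact: ltn_ord.
  by exists x; split=> //; apply/frac_idealE.
pose r i := projT1 (cid (rP i)).
have r0 i : vge 0 (r i) by rewrite /r; case: (cid _) => x [].
have rf (i : 'I_q) : f i = [set y | ord_ideal (@ord F) 1 (y - r i)].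
  by rewrite /r; case: (cid _) => x [].
exists r; split=> //.
  move=> x x0.
  have /fs[i iq fx] : residue_field F [set y | ord_ideal (@ord F) 1 (y - x)].
    by exists x => //; apply/frac_idealE.
  exists (Ordinal iq); apply/frac_idealE.
  have : [set y | ord_ideal (@ord F) 1 (y - x)] x by left; rewrite subrr.
  by rewrite -fx (rf (Ordinal iq)).
move=> i j rij; apply: val_inj; apply: fi; rewrite ?inE /=; [exact: ltn_ord|exact: ltn_ord|].
rewrite (rf i) (rf j); apply/seteqP; split=> y /frac_idealE yi; apply/frac_idealE.
  by rewrite (_ : y - r j = (y - r i) + (r i - r j)); [apply: vgeD|ring].
rewrite (_ : y - r i = (y - r j) - (r i - r j)); [exact: vgeB|ring].
Qed.

Lemma residue_gt1 : (1 < q)%N.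
Proof.
have [r [r0 rs ri]] := residue_system.
have [i iP] := rs 0 (vge0 _ _); have [j jP] := rs 1 (vge1 _).
have ij : i <> j.
  move=> ij; rewrite ij in iP; have := vgeB jP iP.
  rewrite (_ : 1 - r j - (0 - r j) = 1); last by ring.
  by rewrite vgeE ?oner_neq0// ord_one.
case: q i j ij {r r0 rs ri iP jP} => [[]//|[|//]] i j.
by rewrite !ord1.
Qed.

End ResidueSystem.

Section Matrix3.
Variable F : comNzRingType.

Definition o0 : 'I_3 := @Ordinal 3 0 isT.
Definition o1 : 'I_3 := @Ordinal 3 1 isT.
Definition o2 : 'I_3 := @Ordinal 3 2 isT.

Lemma forall_ord3 (P : 'I_3 -> Prop) : P o0 -> P o1 -> P o2 -> forall i, P i.
Proof.
move=> P0 P1 P2 [[|[|[|//]]] i3].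
- by rewrite (_ : Ordinal i3 = o0)//; apply: val_inj.
- by rewrite (_ : Ordinal i3 = o1)//; apply: val_inj.
- by rewrite (_ : Ordinal i3 = o2)//; apply: val_inj.
Qed.

Definition mx3 (a b c d e f g h i : F) : 'M[F]_3 := \matrix_(x, y)
  nth 0 (nth [::] [:: [:: a; b; c]; [:: d; e; f]; [:: g; h; i]] x) y.

Lemma mx3_eta (M : 'M[F]_3) : M = mx3 (M o0 o0) (M o0 o1) (M o0 o2)
  (M o1 o0) (M o1 o1) (M o1 o2) (M o2 o0) (M o2 o1) (M o2 o2).
Proof. by apply/matrixP; do 2![apply: forall_ord3]; rewrite mxE. Qed.

Lemma sum_ord3 (f : 'I_3 -> F) : \sum_i f i = f o0 + f o1 + f o2.
Proof.
rewrite !big_ord_recl big_ord0 addr0 addrA.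
by congr (f _ + f _ + f _); apply: val_inj.
Qed.

Lemma mx3M a b c d e f g h i a' b' c' d' e' f' g' h' i' :
  mx3 a b c d e f g h i *m mx3 a' b' c' d' e' f' g' h' i' =
  mx3 (a * a' + b * d' + c * g') (a * b' + b * e' + c * h') (a * c' + b * f' + c * i')
      (d * a' + e * d' + f * g') (d * b' + e * e' + f * h') (d * c' + e * f' + f * i')
      (g * a' + h * d' + i * g') (g * b' + h * e' + i * h') (g * c' + h * f' + i * i').
Proof.
by apply/matrixP; do 2![apply: forall_ord3]; rewrite !mxE sum_ord3 !mxE.
Qed.

Lemma mx3Z x a b c d e f g h i : x *: mx3 a b c d e f g h i =
  mx3 (x * a) (x * b) (x * c) (x * d) (x * e) (x * f) (x * g) (x * h) (x * i).
Proof. by apply/matrixP; do 2![apply: forall_ord3]; rewrite !mxE. Qed.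

Lemma mx3_scalar x : x%:M = mx3 x 0 0 0 x 0 0 0 x.
Proof. by apply/matrixP; do 2![apply: forall_ord3]; rewrite !mxE. Qed.

Lemma mx3_tr a b c d e f g h i : (mx3 a b c d e f g h i)^T = mx3 a d g b e h c f i.
Proof. by apply/matrixP; do 2![apply: forall_ord3]; rewrite !mxE. Qed.

Lemma det_mx3 a b c d e f g h i : \det (mx3 a b c d e f g h i) =
  a * (e * i - f * h) - b * (d * i - f * g) + c * (d * h - e * g).
Proof.
rewrite (expand_det_row _ o0) sum_ord3 /cofactor.
do 3!rewrite (expand_det_row _ ord0) !big_ord_recl big_ord0 /cofactor !det_mx11.
by rewrite !mxE /=; ring.
Qed.

End Matrix3.

Ltac mx3_eq := rewrite ?mx3M ?mx3Z ?mx3_scalar; congr mx3; by [ring | field].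

Section IntegralMatrix.
Variable F : localField.

Definition intmx m n (M : 'M[F]_(m, n)) : Prop := forall i j, vge 0 (M i j).

Lemma intmxM m n p (M : 'M[F]_(m, n)) (N : 'M[F]_(n, p)) :
  intmx M -> intmx N -> intmx (M *m N).
Proof.
by move=> MO NO i j; rewrite mxE; apply: vge_sum => k _; apply: vge0M.
Qed.

Lemma intmxZ m n c (M : 'M[F]_(m, n)) : vge 0 c -> intmx M -> intmx (c *: M).
Proof. by move=> c0 MO i j; rewrite mxE; apply: vge0M. Qed.

Lemma intmx_tr m n (M : 'M[F]_(m, n)) : intmx M -> intmx M^T.
Proof. by move=> MO i j; rewrite mxE. Qed.

Lemma intmx_det n (M : 'M[F]_n) : intmx M -> vge 0 (\det M).
Proof.
move=> MO; apply: vge_sum => s _; apply: vge0M; last exact: vge_prod.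
by rewrite -signr_odd; case: odd; rewrite ?expr1 ?expr0 ?vgeN vge1.
Qed.

Lemma intmx_adj n (M : 'M[F]_n) : intmx M -> intmx (\adj M).
Proof.
move=> MO i j; rewrite mxE; apply: vge0M.
  by rewrite -signr_odd; case: odd; rewrite ?expr1 ?expr0 ?vgeN vge1.
by apply: intmx_det => x y; rewrite !mxE.
Qed.

Lemma intmx_inv n c (M : 'M[F]_n) : M \in unitmx -> intmx M -> vge 0 (c / \det M) ->
  intmx (c *: invmx M).
Proof.
move=> Mu MO cO; rewrite /invmx Mu scalerA; apply: intmxZ => //; exact: intmx_adj.
Qed.

Lemma intmx3P a b c d e f g h i : intmx (mx3 a b c d e f g h i) <->
  [/\ vge 0 a, vge 0 b & vge 0 c] /\ [/\ vge 0 d, vge 0 e & vge 0 f]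
  /\ [/\ vge 0 g, vge 0 h & vge 0 i].
Proof.
split=> [H|[[? ? ?] [[? ? ?] [? ? ?]]]].
  have E x y := H x y.
  by split; [|split]; split; move: (E o0 o0) (E o0 o1) (E o0 o2)
    (E o1 o0) (E o1 o1) (E o1 o2) (E o2 o0) (E o2 o1) (E o2 o2); rewrite !mxE.
by apply: forall_ord3; apply: forall_ord3; rewrite mxE.
Qed.

Lemma scale_intmx (M : 'M[F]_3) : exists n : nat, intmx (unif F ^+ n *: M).
Proof.
pose n := (\max_(i < 3) \max_(j < 3) `|ord (M i j)|)%N; exists n => i j.
rewrite mxE; have [->|Mij] := eqVneq (M i j) 0; first by rewrite mulr0 vge0.
have u0 := unif_neq0 F.
rewrite vgeE ?mulf_neq0 ?expf_neq0// ordM ?expf_neq0// ordX// ord_unif.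
have : (`|ord (M i j)| <= n)%N.
  by apply: leq_trans (leq_bigmax i); apply: leq_bigmax.
rewrite -mulr_natr mul1r natz; move: (ord _) => k; clearbody n; lia.
Qed.

End IntegralMatrix.

Ltac ord_lia := repeat (let k := fresh "k" in move: (ord _) => k); clear; lia.

Section Vertices.
Variable F : localField.
Implicit Types (g h : 'M[F]_3) (v w : vertex F).
Local Notation std := (std_lattice F).

Lemma std_intmx (x : 'cV[F]_3) : std x <-> intmx x.
Proof.
split=> H i; last by apply/frac_idealE; exact: H.
by move=> j; rewrite (ord1 j); apply/frac_idealE; exact: H.
Qed.

Lemma lat_actM g h (L : set 'cV[F]_3) : lat_act g (lat_act h L) = lat_act (g *m h) L.
Proof.
apply/seteqP; split=> [_ [_ [x Lx <-] <-]|_ [x Lx <-]].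
  by exists x; rewrite ?mulmxA.
by exists (h *m x); [exists x|rewrite mulmxA].
Qed.

Lemma lat_subP g h : g \in unitmx ->
  lat_act h std `<=` lat_act g std <-> intmx (invmx g *m h).
Proof.
move=> gu; split=> [H i j|H _ [x /std_intmx xO <-]].
  have [x /std_intmx xO xE] : lat_act g std (h *m delta_mx j 0).
    apply: H; exists (delta_mx j 0) => //; apply/std_intmx => a b.
    by rewrite mxE; case: (_ && _); [exact: vge1|exact: vge0].
  have -> : (invmx g *m h) i j = x i 0; last exact: xO.
  have -> : x = invmx g *m (h *m delta_mx j 0) by rewrite -xE mulKmx.
  by rewrite mulmxA -colE !mxE.
exists (invmx g *m (h *m x)); last by rewrite mulKVmx.
by apply/std_intmx; rewrite mulmxA; apply: intmxM.
Qed.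

Lemma lat_eqP g h : g \in unitmx -> h \in unitmx ->
  lat_act g std = lat_act h std <->
  intmx (invmx g *m h) /\ ord (\det (invmx g *m h)) = 0.
Proof.
move=> gu hu; have Mu : invmx g *m h \in unitmx by rewrite unitmx_mul unitmx_inv gu.
have Nu : invmx h *m g \in unitmx by rewrite unitmx_mul unitmx_inv hu.
have MN : (invmx g *m h) *m (invmx h *m g) = 1%:M.
  by rewrite -mulmxA mulKVmx// mulVmx.
split=> [gh|[MO M0]].
  have MO : intmx (invmx g *m h) by apply/(lat_subP _ gu); rewrite gh.
  have NO : intmx (invmx h *m g) by apply/(lat_subP _ hu); rewrite gh.
  split=> //; move: (intmx_det MO) (intmx_det NO).
  move: Mu Nu; rewrite !unitmxE !unitfE => Mu Nu.
  rewrite !vgeE//; have := congr1 (fun X => ord (\det X)) MN.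
  by rewrite det_mulmx det1 ord_one ordM//; ord_lia.
apply/seteqP; split; apply/lat_subP => //.
rewrite (_ : _ *m _ = 1 *: invmx (invmx g *m h)); last first.
  by rewrite scale1r -[RHS]mulmx1 -MN mulKmx.
apply: intmx_inv => //; move: Mu; rewrite unitmxE unitfE => Mu.
by rewrite div1r vgeE ?invr_eq0// ordV// M0 oppr0.
Qed.

Lemma homothety_scale c (L : set 'cV[F]_3) : c != 0 ->
  homothety_class (lat_act c%:M L) = homothety_class L.
Proof.
move=> c0; apply/seteqP; split=> _ [a /= a0 <-].
  by exists (a * c); rewrite /= ?mulf_neq0// lat_actM scalar_mxM.
exists (a / c); rewrite /= ?mulf_neq0 ?invr_eq0// lat_actM -scalar_mxM.
by rewrite divfK.
Qed.

Lemma vx_subproof g :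
  [set homothety_class (lat_act g std) | g in [set g : 'M[F]_3 | g \in unitmx]]
  (homothety_class (lat_act (if g \in unitmx then g else 1%:M) std)).
Proof. by eexists; last reflexivity; rewrite /=; case: ifP => //; rewrite unitmx1. Qed.

(* The vertex [gK]; the identity replaces [g] if it is not invertible. *)
Definition vx g : vertex F := SigSub (mem_set (vx_subproof g)).

Lemma val_vx g : g \in unitmx -> val (vx g) = homothety_class (lat_act g std).
Proof. by move=> gu; rewrite /= gu. Qed.

Lemma homothety_refl (L : set 'cV[F]_3) : homothety_class L L.
Proof.
exists 1; rewrite /= ?oner_eq0//; apply/seteqP; split=> [_ [x Lx <-]|x Lx].
  by rewrite mul1mx.
by exists x => //; rewrite mul1mx.
Qed.

Lemma vx_surj v : exists2 g, g \in unitmx & v = vx g.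
Proof.
have [g gu gv] := set_mem (valP v); exists g => //.
by apply: val_inj; rewrite val_vx.
Qed.

(* [hrel k g h]: up to a scalar, [h = g m] with [m] integral of determinant of
   order [k]. *)
Definition hrel (k : int) g h : Prop := exists2 c : F, c != 0 &
  intmx (c *: (invmx g *m h)) /\ ord (\det (c *: (invmx g *m h))) = k.

Lemma det_scale3 c g : \det (c *: g) = c ^+ 3 * \det g.
Proof. by rewrite detZ. Qed.

Lemma det_unit g : g \in unitmx -> \det g != 0.
Proof. by rewrite unitmxE unitfE. Qed.

Lemma ord_det_hrel c g h : c != 0 -> g \in unitmx -> h \in unitmx ->
  ord (\det (c *: (invmx g *m h))) = 3%:Z * ord c + (ord (\det h) - ord (\det g)).
Proof.
move=> c0 gu hu; have g0 := det_unit gu; have h0 := det_unit hu.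
have gh0 : (\det g)^-1 * \det h != 0 by rewrite mulf_neq0// invr_eq0.
rewrite det_scale3 det_mulmx det_inv ordM ?expf_neq0// ordX// ordM ?invr_eq0//.
by rewrite ordV// !mulrS mulr0n; ord_lia.
Qed.

Lemma scale_unitmx c g : c != 0 -> g \in unitmx -> c *: g \in unitmx.
Proof. by move=> c0 gu; rewrite unitmxZ// unitfE. Qed.

Lemma vx_eqP g h : g \in unitmx -> h \in unitmx -> vx g = vx h <-> hrel 0 g h.
Proof.
move=> gu hu; split=> [gh|[c c0 [cO c1]]].
  have : val (vx g) (lat_act h std).
    by rewrite gh val_vx//; apply: homothety_refl.
  rewrite val_vx// => -[c /= c0]; rewrite lat_actM mul_scalar_mx => /lat_eqP H.
  have [|//|] := H; first exact: scale_unitmx.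
  rewrite invmxZ ?scale_unitmx// -scalemxAl => cO c1.
  by exists c^-1; rewrite ?invr_eq0.
apply: val_inj; rewrite !val_vx// -(homothety_scale _ (_ : c^-1 != 0)) ?invr_eq0//.
rewrite lat_actM mul_scalar_mx; congr homothety_class; apply/lat_eqP => //.
  by apply: scale_unitmx => //; rewrite invr_eq0.
by rewrite invmxZ ?scale_unitmx ?invr_eq0// invrK -scalemxAl.
Qed.

(** The two inclusions are the two integrality conditions and confine the order of the determinant
    to 0, ..., 3; strictness excludes 0 and 3. *)
Lemma adjP g h : g \in unitmx -> h \in unitmx ->
  adj (vx g) (vx h) <-> exists2 c : F, c != 0 &
    [/\ intmx (c *: (invmx g *m h)), intmx ((unif F / c) *: (invmx h *m g)) &
        ord (\det (c *: (invmx g *m h))) = 1 \/ ord (\det (c *: (invmx g *m h))) = 2].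
Proof.
move=> gu hu; have u0 := unif_neq0 F.
split=> [[_ [L [L' []]]]|[c c0 [cO ucO c12]]].
  rewrite !val_vx// => -[a /= a0 <-] [b /= b0 <-]; rewrite !lat_actM -?mulmxA !mul_scalar_mx.
  have agu := scale_unitmx a0 gu; have bhu := scale_unitmx b0 hu.
  rewrite !scalerA => -[s1 n1] [s2 n2].
  have uagu : (unif F * a) *: g \in unitmx by apply: scale_unitmx; rewrite ?mulf_neq0.
  have E x y g' h' : x != 0 -> g' \in unitmx ->
      invmx (x *: g') *m (y *: h') = (y / x) *: (invmx g' *m h').
    move=> x0 gu'; rewrite invmxZ ?scale_unitmx// -scalemxAl -scalemxAr scalerA.
    by rewrite mulrC.
  have ba0 : b / a != 0 by rewrite mulf_neq0 ?invr_eq0.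
  move/(lat_subP _ bhu): s1; rewrite E// => s1.
  move/(lat_subP _ agu): s2; rewrite E// => s2.
  have s3 : ~ (ord (\det ((b / a) *: (invmx g *m h))) = 0).
    move=> H; apply: n2; rewrite (_ : lat_act (b *: h) std = lat_act (a *: g) std)//.
    by apply/esym/lat_eqP => //; rewrite E.
  have s4 : ~ (ord (\det ((b / a) *: (invmx g *m h))) = 3).
    move=> H; apply: n1.
    rewrite (_ : lat_act (b *: h) std = lat_act ((unif F * a) *: g) std)//.
    apply/lat_eqP => //; rewrite E//; split=> //.
    rewrite ord_det_hrel ?mulf_neq0 ?invr_eq0// !ordM ?mulf_neq0 ?invr_eq0//.
    rewrite ordV// ord_unif.
    by move: H; rewrite ord_det_hrel// ordM ?invr_eq0// ordV//; ord_lia.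
  exists (b / a) => //; split=> //.
    by rewrite (_ : unif F / (b / a) = unif F * a / b)//; field; rewrite a0 b0.
  have := intmx_det s1; have := intmx_det s2.
  rewrite !vgeE; first last.
  - by apply/det_unit/scale_unitmx; rewrite ?mulf_neq0 ?invr_eq0// unitmx_mul unitmx_inv gu.
  - by apply/det_unit/scale_unitmx; rewrite ?mulf_neq0 ?invr_eq0// unitmx_mul unitmx_inv hu.
  move: s3 s4; rewrite !ord_det_hrel ?mulf_neq0 ?invr_eq0// !ordM ?mulf_neq0 ?invr_eq0//.
  rewrite !ordV// ord_unif; ord_lia.
split.
  move=> /vx_eqP H; have [//|//|d d0 [_]] := H; move: c12.
  by rewrite !ord_det_hrel// => -[]; ord_lia.
exists (lat_act g std), (lat_act (c *: h) std); rewrite !val_vx//.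
have chu := scale_unitmx c0 hu; have ugu := scale_unitmx u0 gu.
split.
- exact: homothety_refl.
- by exists c => //; rewrite lat_actM mul_scalar_mx.
- rewrite lat_actM mul_scalar_mx; split.
    apply/(lat_subP _ chu); rewrite invmxZ ?scale_unitmx// -scalemxAl -scalemxAr scalerA.
    by rewrite mulrC.
  move=> /(lat_subP _ ugu); rewrite invmxZ ?scale_unitmx// -scalemxAl -scalemxAr scalerA.
  move/intmx_det; rewrite vgeE; last first.
    by apply/det_unit/scale_unitmx; rewrite ?mulf_neq0 ?invr_eq0// unitmx_mul unitmx_inv gu.
  move: c12; rewrite !ord_det_hrel ?mulf_neq0 ?invr_eq0// !ordM ?invr_eq0// ordV// ord_unif.
  by move=> -[]; ord_lia.
split.
  by apply/(lat_subP _ gu); rewrite -scalemxAr.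
move=> /(lat_subP _ chu); rewrite invmxZ ?scale_unitmx// -scalemxAl.
move/intmx_det; rewrite vgeE; last first.
  by apply/det_unit/scale_unitmx; rewrite ?invr_eq0// unitmx_mul unitmx_inv hu.
move: c12; rewrite !ord_det_hrel ?invr_eq0// ordV//.
by move=> -[]; ord_lia.
Qed.

End Vertices.

(** * Colors and color-one edges *)

Section Edges.
Variable F : localField.
Implicit Types (g h : 'M[F]_3) (u v w : vertex F).

Lemma frameP v : frame v \in unitmx /\
  val v = homothety_class (lat_act (frame v) (std_lattice F)).
Proof.
have [g gu gv] := vx_surj v.
apply: (xgetPex 1%:M (P := [set g : 'M[F]_3 | g \in unitmx /\
  val v = homothety_class (lat_act g (std_lattice F))])).
by exists g; split; rewrite // gv val_vx.
Qed.

Lemma frame_unit v : frame v \in unitmx.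
Proof. by case: (frameP v). Qed.

Lemma vx_frame v : vx (frame v) = v.
Proof. by apply: val_inj; have [fu ->] := frameP v; rewrite val_vx. Qed.

Lemma Z3_mul3 (k : int) : ((3%:Z * k)%:~R : 'Z_3) = 0.
Proof. by rewrite intrM (_ : (3%:Z%:~R : 'Z_3) = 0) ?mul0r//; apply: val_inj. Qed.

(** Two frames of a vertex differ by GL_3(O) and a scalar c, which changes the order of the
    determinant by 3 ord c. *)
Lemma color_vx g : g \in unitmx -> color (vx g) = (ord (\det g))%:~R.
Proof.
move=> gu; rewrite /color; have fu := frame_unit (vx g).
have /vx_eqP [//|//|c c0 [_]] := vx_frame (vx g).
rewrite ord_det_hrel// => /eqP H.
have -> : ord (\det g) = ord (\det (frame (vx g))) + 3%:Z * - ord c.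
  by move/eqP: H; ord_lia.
by rewrite intrD Z3_mul3 addr0.
Qed.

Definition edge1 v w : Prop := adj v w /\ edge_color v w = 1.

Lemma adjC v w : adj v w -> adj w v.
Proof.
have [g gu ->] := vx_surj v; have [h hu ->] := vx_surj w.
move=> /adjP [//|//|c c0 [cO ucO c12]]; apply/adjP => //.
have u0 := unif_neq0 F.
exists (unif F / c); rewrite ?mulf_neq0 ?invr_eq0//; split=> //.
  by rewrite (_ : unif F / (unif F / c) = c)//; field; rewrite c0 u0.
move: c12; rewrite !ord_det_hrel ?mulf_neq0 ?invr_eq0//.
rewrite ordM ?invr_eq0// ordV// ord_unif.
by case=> H; [right|left]; move: H; ord_lia.
Qed.

Lemma edge_color_vx c g h : c != 0 -> g \in unitmx -> h \in unitmx ->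
  edge_color (vx g) (vx h) = (ord (\det (c *: (invmx g *m h))))%:~R.
Proof.
move=> c0 gu hu; rewrite /edge_color !color_vx// ord_det_hrel//.
by rewrite intrD Z3_mul3 add0r intrB.
Qed.

(** For determinant of order 1 the second integrality condition of [adjP] is automatic: pi M^-1 is
    the unit pi / det M times the adjugate. *)
Lemma edge1P g h : g \in unitmx -> h \in unitmx ->
  edge1 (vx g) (vx h) <-> hrel 1 g h.
Proof.
move=> gu hu; have u0 := unif_neq0 F; split=> [[/adjP H]|[c c0 [cO c1]]].
  have [//|//|c c0 [cO ucO [c1|c2]]] := H; first by exists c.
  by rewrite (edge_color_vx c0)// c2 => /eqP.
split; last by rewrite (edge_color_vx c0)// c1.
apply/adjP => //; exists c => //; split=> //; last by left.
have Mu : c *: (invmx g *m h) \in unitmx.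
  by rewrite scale_unitmx// unitmx_mul unitmx_inv gu.
have -> : (unif F / c) *: (invmx h *m g) = unif F *: invmx (c *: (invmx g *m h)).
  rewrite invmxZ// scalerA; congr (_ *: _).
  have Nu : invmx g *m h \in unitmx by rewrite unitmx_mul unitmx_inv gu.
  by rewrite -[LHS]mulmx1 -(mulmxV Nu) !mulmxA mulmxK// mulVmx// mul1mx.
apply: intmx_inv => //; have d0 := det_unit Mu.
by rewrite vgeE ?mulf_neq0 ?invr_eq0// ordM ?invr_eq0// ordV// ord_unif c1.
Qed.

Lemma edge2P v w : adj v w /\ edge_color v w = 2%:R <-> edge1 w v.
Proof.
have cN : edge_color w v = - edge_color v w by rewrite /edge_color opprB.
split=> [[vw e2]|[wv e1]].
  by split; [exact: adjC|rewrite cN e2; apply: val_inj].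
split; first exact: adjC.
by rewrite -[LHS]opprK -cN e1; apply: val_inj.
Qed.

(** The colors add up to 2 from u to w, so w <> u, and adjacency of u and w can only be a color-one
    edge from w to u. *)
Lemma edge1_triangle u v w : edge1 u v -> edge1 v w ->
  (w <> u /\ ~ triangle u v w) <-> ~ edge1 w u.
Proof.
move=> [uv cuv] [vw cvw]; have cuw : edge_color u w = 2%:R.
  by rewrite /edge_color -(subrKA (color v)) [X in X + _]cvw [X in _ + X]cuv.
split=> [[_ tri] [wu _]|H]; first by apply: tri; split=> //; exact: adjC.
split=> [wu|[_ _ uw]]; last by apply: H; apply/edge2P.
by move/eqP: cuw; rewrite wu /edge_color subrr.
Qed.

End Edges.

(** * Links of the building *)

Section Neighbours.
Variables (F : localField) (q : nat) (r : 'I_q -> F).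
Hypothesis r_int : forall i, vge 0 (r i).
Hypothesis r_surj : forall x, vge 0 x -> exists i, vge 1 (x - r i).
Hypothesis r_inj : forall i j, vge 1 (r i - r j) -> i = j.
Implicit Types (g h : 'M[F]_3) (u v w : vertex F).
Local Notation pi := (unif F).
Let pi0 : pi != 0 := unif_neq0 F.

(** The cells of sizes q^2, q and 1 of the projective plane over the residue field. *)
Definition nbr_index : finType := (('I_q * 'I_q + 'I_q) + unit)%type.

(* Representatives of the index-[q] sublattices of [O^3], in Hermite normal form. *)
Definition nbr_mx (s : nbr_index) : 'M[F]_3 := match s with
  | inl (inl (i, j)) => mx3 pi (r i) (r j) 0 1 0 0 0 1
  | inl (inr i) => mx3 1 0 0 0 pi (r i) 0 0 1
  | inr _ => mx3 1 0 0 0 1 0 0 0 pi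
  end.

Definition nbr_inv (s : nbr_index) : 'M[F]_3 := match s with
  | inl (inl (i, j)) => mx3 pi^-1 (- r i / pi) (- r j / pi) 0 1 0 0 0 1
  | inl (inr i) => mx3 1 0 0 0 pi^-1 (- r i / pi) 0 0 1
  | inr _ => mx3 1 0 0 0 1 0 0 0 pi^-1
  end.


Lemma nbr_mxV s : nbr_mx s *m nbr_inv s = 1%:M.
Proof. by case: s => [[[i j]|i]|[]]; rewrite /nbr_mx /nbr_inv; mx3_eq. Qed.

Lemma nbr_mx_unit s : nbr_mx s \in unitmx.
Proof. by case/mulmx1_unit: (nbr_mxV s). Qed.

Lemma invmx_nbr s : invmx (nbr_mx s) = nbr_inv s.
Proof. by rewrite -[RHS](mulKmx (nbr_mx_unit s)) nbr_mxV mulmx1. Qed.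

Lemma det_nbr s : \det (nbr_mx s) = pi.
Proof. by case: s => [[[i j]|i]|[]]; rewrite det_mx3; ring. Qed.

Lemma nbr_int s : intmx (nbr_mx s).
Proof.
have h0 := vge0 F 0; have h1 := vge1 F; have hp := vge_unif F.
by case: s => [[[i j]|i]|[]]; apply/intmx3P.
Qed.

Lemma vge_unitV (x : F) : vge 0 x -> ~~ vge 1 x -> x != 0 /\ vge 0 x^-1.
Proof.
move=> x0 x1; have xn : x != 0 by apply: contraNneq x1 => ->; apply: vge0.
split=> //; move: x0 x1; rewrite !vgeE ?invr_eq0// ordV//; ord_lia.
Qed.

(** The rows x, y, z are dependent modulo pi; the cases look for the lowest row that is a
    combination of the rows below it, and its coefficients give the digits of the normal form. *)
Lemma nbr_reduce g : intmx g -> vge 1 (\det g) ->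
  exists s, intmx (nbr_inv s *m g).
Proof.
move=> gO dg.
pose x := g o0; pose y := g o1; pose z := g o2.
have xO k : vge 0 (x k) by apply: gO.
have yO k : vge 0 (y k) by apply: gO.
have zO k : vge 0 (z k) by apply: gO.
have gE : g = mx3 (x o0) (x o1) (x o2) (y o0) (y o1) (y o2) (z o0) (z o1) (z o2).
  exact: mx3_eta.
have h0 := vge0 F 0; have h1 := vge1 F.
(* The determinant of three columns of g, repetitions allowed, is 0 or det g up to sign. *)
have minors (j l k : 'I_3) : let D := x k * (y l * z j - y j * z l)
    - x l * (y k * z j - y j * z k) + x j * (y k * z l - y l * z k) in
    D = 0 \/ D = \det g \/ D = - \det g.
  rewrite gE det_mx3; move: j l k; do 3![apply: forall_ord3] => D; rewrite /D;
    by [left; ring | right; left; ring | right; right; ring].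
have div1 a : vge 1 a -> vge 0 (a / pi) by rewrite -vge_div_unif add0r.
have [z1|] := boolP [forall k, vge 1 (z k)].
  exists (inr tt); rewrite gE mx3M; apply/intmx3P.
  by rewrite !mul0r !mul1r !addr0 !add0r ![pi^-1 * _]mulrC; do !split => //;
    apply: div1; apply: (forallP z1).
rewrite negb_forall => /existsP[j /(vge_unitV (zO j)) [zj0 zjV]].
pose a := y j / z j; have aO : vge 0 a by apply: vge0M.
have [y1|] := boolP [forall k, vge 1 (y k - a * z k)].
  have [i ai] := r_surj aO; exists (inl (inr i)); rewrite gE mx3M; apply/intmx3P.
  have yk k : vge 0 ((y k - r i * z k) / pi).
    apply: div1; rewrite (_ : _ - _ = (y k - a * z k) + (a - r i) * z k); last by ring.
    by apply: vgeD; [exact: (forallP y1)|rewrite -[1]addr0; apply: vgeM].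
  have E k : 0 * x k + pi^-1 * y k + - r i / pi * z k = (y k - r i * z k) / pi by ring.
  by rewrite !E !mul0r !mul1r !addr0 !add0r; do !split.
rewrite negb_forall => /existsP[l]; set yl := y l - _ => yl1.
have ylO : vge 0 yl by apply: vgeB; [exact: yO|apply: vge0M; [exact: aO|exact: zO]].
have [yl0 ylV] := vge_unitV ylO yl1.
(* By Cramer's rule x = al y + be z holds exactly in the columns j and l. The error in column k is a
   determinant from [minors] over the units yl and z j. *)
pose al := (x l - x j / z j * z l) / yl.
pose be := x j / z j - al * a.
have alO : vge 0 al by apply: vge0M => //; apply: vgeB => //; do 2?[apply: vge0M => //].
have beO : vge 0 be by apply: vgeB; apply: vge0M.
have xk k : vge 1 (x k - al * y k - be * z k).
  pose D := x k * (y l * z j - y j * z l) - x l * (y k * z j - y j * z k)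
    + x j * (y k * z l - y l * z k).
  have -> : x k - al * y k - be * z k = D * (yl^-1 * (z j)^-1).
    have yl0' : y l * z j - y j * z l != 0.
      apply: contra_neq yl0 => E; rewrite /yl /a.
      rewrite (_ : y l - _ = (y l * z j - y j * z l) / z j); last by field.
      by rewrite E mul0r.
    by rewrite /D /be /al /yl /a; field; rewrite zj0 yl0'.
  rewrite -[1]addr0; apply: vgeM; last exact: vge0M.
  have := minors j l k; rewrite -/D.
  by case=> [->|[->|->]]; rewrite ?vge0 ?vgeN.
have [i ai] := r_surj alO; have [i' bi'] := r_surj beO.
exists (inl (inl (i, i'))); rewrite gE mx3M; apply/intmx3P.
have E k : vge 0 (pi^-1 * x k + - r i / pi * y k + - r i' / pi * z k).
  rewrite (_ : _ + _ + _ = ((x k - al * y k - be * z k) + (al - r i) * y k + (be - r i') * z k) / pi); last by ring.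
  apply: div1; do 2?[apply: vgeD]; rewrite ?xk//; by rewrite -[1]addr0; apply: vgeM.
by rewrite !mul0r !mul1r !addr0 !add0r; do !split.
Qed.

End Neighbours.

Lemma invmx_mul (K : comUnitRingType) n (A B : 'M[K]_n) : A \in unitmx -> B \in unitmx ->
  invmx (A *m B) = invmx B *m invmx A.
Proof.
move=> Au Bu; have ABu : A *m B \in unitmx by rewrite unitmx_mul Au.
by rewrite -[RHS]mulmx1 -(mulmxV ABu) !mulmxA mulmxKV// mulVmx// mul1mx.
Qed.

Section Links.
Variables (F : localField) (q : nat) (r : 'I_q -> F).
Hypothesis r_int : forall i, vge 0 (r i).
Hypothesis r_surj : forall x, vge 0 x -> exists i, vge 1 (x - r i).
Hypothesis r_inj : forall i j, vge 1 (r i - r j) -> i = j.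
Implicit Types (g h : 'M[F]_3) (u v w : vertex F).
Local Notation pi := (unif F).
Let pi0 : pi != 0 := unif_neq0 F.
Local Notation I := (nbr_index q).
Implicit Types s : I.

Lemma nbr_mul_unit g s : g \in unitmx -> g *m nbr_mx r s \in unitmx.
Proof. by move=> gu; rewrite unitmx_mul gu nbr_mx_unit. Qed.

Lemma edge1_nbrP g w : g \in unitmx ->
  edge1 (vx g) w <-> exists s, w = vx (g *m nbr_mx r s).
Proof.
move=> gu; split=> [|[s ->]]; last first.
  apply/edge1P; rewrite ?nbr_mul_unit//; exists 1; rewrite ?oner_eq0//.
  by rewrite scale1r mulKmx// det_nbr ord_unif; split=> //; apply: nbr_int r_int s.
have [h hu ->] := vx_surj w => /edge1P[//|//|c c0 [cO c1]].
set M := c *: _ in cO c1.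
have Mu : M \in unitmx by rewrite scale_unitmx// unitmx_mul unitmx_inv gu.
have [|s sO] := nbr_reduce r_surj cO.
  by rewrite vgeE ?c1// det_unit.
exists s; apply/esym/vx_eqP; rewrite ?nbr_mul_unit//.
exists c => //; split.
  by rewrite invmx_mul ?nbr_mx_unit// invmx_nbr -mulmxA scalemxAr.
move: c1; rewrite /M !ord_det_hrel ?nbr_mul_unit//.
rewrite det_mulmx det_nbr ordM ?det_unit// ord_unif; ord_lia.
Qed.

Lemma nbr_mx_inj g s s' : g \in unitmx ->
  vx (g *m nbr_mx r s) = vx (g *m nbr_mx r s') -> s = s'.
Proof.
move=> gu /vx_eqP; rewrite !nbr_mul_unit// => /(_ isT isT)[c c0 [cO c1]].
have oc : ord c = 0.
  move: c1; rewrite ord_det_hrel ?nbr_mul_unit// !det_mulmx !det_nbr; ord_lia.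
have {cO} : intmx (nbr_inv r s *m nbr_mx r s').
  have -> : nbr_inv r s *m nbr_mx r s' = c^-1 *: (c *: (invmx (g *m nbr_mx r s) *m (g *m nbr_mx r s'))).
    rewrite scalerA mulVf// scale1r invmx_mul ?nbr_mx_unit// -mulmxA mulKmx//.
    by rewrite invmx_nbr.
  by apply: intmxZ cO; rewrite vgeE ?invr_eq0// ordV// oc.
have np : vge 0 pi^-1 = false.
  by rewrite vgeE ?invr_eq0// ordV// ord_unif.
have div1 x : vge 0 (x / pi) -> vge 1 x by rewrite -vge_div_unif add0r.
case: s s' {c1} => [[[i j]|i]|[]] [[[i' j']|i']|[]]; rewrite /nbr_inv /nbr_mx mx3M => /intmx3P;
  rewrite ?mulr0 ?mul0r ?mulr1 ?mul1r ?add0r ?addr0 ?np; try by move=> [[? ? ?] [[? ? ?] [? ? ?]]].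
- move=> [[_ H1 H2] _]; congr (inl (inl (_, _))); apply/esym/r_inj/div1.
    by move: H1; congr vge; ring.
  by move: H2; congr vge; ring.
- move=> [_ [[_ _ H] _]]; congr (inl (inr _)); apply/esym/r_inj/div1.
  by move: H; congr vge; ring.
Qed.

Definition out_nbrs v : seq (vertex F) :=
  [seq vx (frame v *m nbr_mx r s) | s <- enum I].

Lemma mem_out_nbrs v w : w \in out_nbrs v <-> edge1 v w.
Proof.
rewrite -{2}(vx_frame v); split=> [/mapP[s _ ->]|/edge1_nbrP].
  by apply/edge1_nbrP; [exact: frame_unit|exists s].
move=> /(_ (frame_unit v))[s ->]; apply/mapP; exists s => //.
by rewrite mem_enum.
Qed.

Lemma out_nbrs_uniq v : uniq (out_nbrs v).
Proof.
rewrite map_inj_uniq ?enum_uniq// => s s'; apply: nbr_mx_inj; exact: frame_unit.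
Qed.

Lemma size_out_nbrs v : size (out_nbrs v) = (q ^ 2 + q + 1)%N.
Proof.
rewrite size_map -cardE /nbr_index !card_sum card_prod !card_ord card_unit; lia.
Qed.

Lemma perm_out_nbrs g : g \in unitmx ->
  perm_eq (out_nbrs (vx g)) [seq vx (g *m nbr_mx r s) | s <- enum I].
Proof.
move=> gu; apply: uniq_perm; first exact: out_nbrs_uniq.
  by rewrite map_inj_uniq ?enum_uniq// => s s'; apply: nbr_mx_inj.
move=> w; apply/idP/mapP => [/mem_out_nbrs/edge1_nbrP|[s _ ->]].
  by move=> /(_ gu)[s ->]; exists s; rewrite ?mem_enum.
by apply/mem_out_nbrs/edge1_nbrP => //; exists s.
Qed.

(* [rev3 (g^-1)^T] represents the dual lattice, with its coordinates reversed so that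
   upper triangular matrices are preserved up to the stabilizer of [O^3]. *)
Definition rev3 : 'M[F]_3 := mx3 0 0 1 0 1 0 1 0 0.

Definition dual_mx g : 'M[F]_3 := rev3 *m (invmx g)^T.

Definition dual v : vertex F := vx (dual_mx (frame v)).

Lemma rev3K : rev3 *m rev3 = 1%:M.
Proof. by rewrite mx3M mx3_scalar; congr mx3; ring. Qed.

Lemma rev3_unit : rev3 \in unitmx. Proof. by case/mulmx1_unit: rev3K. Qed.

Lemma invmx_rev3 : invmx rev3 = rev3.
Proof. by rewrite -[RHS](mulKmx rev3_unit) rev3K mulmx1. Qed.

Lemma dual_mx_unit g : g \in unitmx -> dual_mx g \in unitmx.
Proof. by move=> gu; rewrite unitmx_mul rev3_unit unitmx_tr unitmx_inv. Qed.

Lemma dual_mxK g : g \in unitmx -> dual_mx (dual_mx g) = g.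
Proof.
move=> gu; rewrite /dual_mx invmx_mul ?rev3_unit ?unitmx_tr ?unitmx_inv//.
rewrite invmx_rev3 trmx_mul -trmx_inv trmxK invmxK mulmxA.
have -> : rev3^T = rev3 by rewrite /rev3 mx3_tr.
by rewrite rev3K mul1mx.
Qed.

Lemma hrel_dual k g h : g \in unitmx -> h \in unitmx ->
  hrel k g h -> hrel k (dual_mx h) (dual_mx g).
Proof.
move=> gu hu [c c0 [cO ck]]; exists c => //.
have -> : c *: (invmx (dual_mx h) *m dual_mx g) = (c *: (invmx g *m h))^T.
  rewrite /dual_mx invmx_mul ?rev3_unit ?unitmx_tr ?unitmx_inv// invmx_rev3.
  rewrite -mulmxA (mulmxA rev3) rev3K mul1mx -trmx_inv invmxK.
  by rewrite -trmx_mul linearZ.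
by rewrite det_tr; split=> //; apply: intmx_tr.
Qed.

Lemma dual_vx g : g \in unitmx -> dual (vx g) = vx (dual_mx g).
Proof.
move=> gu; have fu := frame_unit (vx g).
apply/vx_eqP; rewrite ?dual_mx_unit//; apply: hrel_dual => //.
by apply/vx_eqP => //; rewrite vx_frame.
Qed.

Lemma dualK : involutive dual.
Proof.
move=> v; have [g gu ->] := vx_surj v.
by rewrite !dual_vx ?dual_mx_unit// dual_mxK.
Qed.

Lemma edge1_dual v w : edge1 (dual w) (dual v) <-> edge1 v w.
Proof.
have impl v' w' : edge1 v' w' -> edge1 (dual w') (dual v').
  have [g gu ->] := vx_surj v'; have [h hu ->] := vx_surj w' => /edge1P H.
  rewrite !dual_vx//; apply/edge1P; rewrite ?dual_mx_unit//.
  by apply: hrel_dual => //; apply: H.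
by split=> [/impl|]; rewrite ?dualK//; apply: impl.
Qed.

(** Duality reverses color-one edges, so incoming neighbours need no normal form of their own. *)
Definition in_nbrs v : seq (vertex F) := map dual (out_nbrs (dual v)).

Lemma mem_in_nbrs v w : w \in in_nbrs v <-> edge1 w v.
Proof.
by rewrite -edge1_dual -mem_out_nbrs -{1}(dualK w) (mem_map (inv_inj dualK)).
Qed.

Lemma in_nbrs_uniq v : uniq (in_nbrs v).
Proof. by rewrite map_inj_uniq ?out_nbrs_uniq//; apply: inv_inj dualK. Qed.

Lemma size_in_nbrs v : size (in_nbrs v) = (q ^ 2 + q + 1)%N.
Proof. by rewrite size_map size_out_nbrs. Qed.

Lemma in_out_nbrs v w : (v \in in_nbrs w) = (w \in out_nbrs v).
Proof. by apply/idP/idP => [/mem_in_nbrs/mem_out_nbrs|/mem_out_nbrs/mem_in_nbrs]. Qed.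

End Links.

Lemma count_unique (T : eqType) (s : seq T) (P : pred T) x : uniq s -> x \in s -> P x ->
  (forall y, y \in s -> P y -> y = x) -> count P s = 1%N.
Proof.
move=> us xs Px uP; rewrite -size_filter -[1%N]/(size [:: x]).
apply/perm_size/uniq_perm; rewrite ?filter_uniq// => y; rewrite mem_filter inE.
by apply/andP/eqP => [[Py ys]|->]; [exact: uP|].
Qed.

Section PlaneLinksBuilding.
Variables (F : localField) (q : nat) (r : 'I_q -> F).
Hypothesis r_int : forall i, vge 0 (r i).
Hypothesis r_surj : forall x, vge 0 x -> exists i, vge 1 (x - r i).
Hypothesis r_inj : forall i j, vge 1 (r i - r j) -> i = j.
Implicit Types (g h : 'M[F]_3) (u v w : vertex F).
Local Notation pi := (unif F).
Let pi0 : pi != 0 := unif_neq0 F.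
Local Notation I := (nbr_index q).
Implicit Types s : I.

(** The group GL_3(O). *)
Definition inK (k : 'M[F]_3) := [/\ k \in unitmx, intmx k & ord (\det k) = 0].

Lemma vx_mulK g k : g \in unitmx -> inK k -> vx (g *m k) = vx g.
Proof.
move=> gu [ku kO k0]; apply/esym/vx_eqP; rewrite ?unitmx_mul ?gu//.
by exists 1; rewrite ?oner_eq0// scale1r mulKmx.
Qed.

Lemma inK_mx3 (a b c d e f g h i : F) :
  [/\ vge 0 a, vge 0 b & vge 0 c] -> [/\ vge 0 d, vge 0 e & vge 0 f] ->
  [/\ vge 0 g, vge 0 h & vge 0 i] ->
  a * (e * i - f * h) - b * (d * i - f * g) + c * (d * h - e * g) = 1 \/
  a * (e * i - f * h) - b * (d * i - f * g) + c * (d * h - e * g) = -1 ->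
  inK (mx3 a b c d e f g h i).
Proof.
move=> ? ? ? dE; split; [|exact/intmx3P|]; rewrite ?unitmxE det_mx3.
  by case: dE => ->; rewrite ?unitrN unitr1.
by case: dE => ->; rewrite ?ordN ord_one.
Qed.

Let diag a b c : 'M[F]_3 := mx3 a 0 0 0 b 0 0 0 c.

Lemma diag_unit a b c : a != 0 -> b != 0 -> c != 0 -> diag a b c \in unitmx.
Proof.
move=> a0 b0 c0; rewrite unitmxE unitfE det_mx3.
by rewrite (_ : _ + _ = a * b * c); [rewrite !mulf_neq0|ring].
Qed.

Let c0 := vge0 F 0.
Let c1 := vge1 F.
Let cp := vge_unif F.

Ltac in_K := apply: inK_mx3; rewrite ?vge0M//; by [left; ring | right; ring].

(** A Smith normal form: in a suitable frame every color-one edge is the standard one. *)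
Lemma nbr_flag s : exists k k', [/\ inK k, inK k' & nbr_mx r s *m k' = k *m diag 1 1 pi].
Proof.
case: s => [[[i j]|i]|[]] /=.
- exists (mx3 (r j) (r i) 1 0 1 0 1 0 0), (rev3 F); split; rewrite /rev3; [in_K|in_K|mx3_eq].
- exists (mx3 1 0 0 0 (r i) 1 0 1 0), (mx3 1 0 0 0 0 1 0 1 0); split; [in_K|in_K|mx3_eq].
- exists (mx3 1 0 0 0 1 0 0 0 1), (mx3 1 0 0 0 1 0 0 0 1); split; [in_K|in_K|mx3_eq].
Qed.

(** The index [inr tt] is the standard neighbour itself. For any other, k moves diag(1, pi, 1) to it
    while fixing the standard neighbour, which is the last equation. *)
Lemma nbr_flag2 s : s <> inr tt -> exists k k1 k2,
  [/\ inK k, inK k1, inK k2, nbr_mx r s *m k2 = k *m diag 1 pi 1 &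
      k *m diag 1 1 pi = diag 1 1 pi *m k1].
Proof.
case: s => [[[i j]|i]|[]] // _ /=.
- exists (mx3 (r i) 1 (r j) 1 0 0 0 0 1), (mx3 (r i) 1 (pi * r j) 1 0 0 0 0 1),
    (mx3 0 1 0 1 0 0 0 0 1).
  split; [in_K|in_K|in_K|mx3_eq|mx3_eq].
- exists (mx3 1 0 0 0 1 (r i) 0 0 1), (mx3 1 0 0 0 1 (pi * r i) 0 0 1),
    (mx3 1 0 0 0 1 0 0 0 1).
  split; [in_K|in_K|in_K|mx3_eq|mx3_eq].
Qed.

Lemma edge1_flag v w : edge1 v w ->
  exists2 g, g \in unitmx & v = vx g /\ w = vx (g *m diag 1 1 pi).
Proof.
have [g gu ->] := vx_surj v => /(edge1_nbrP r_int r_surj _ gu)[s ->].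
have [k [k' [kK k'K E]]] := nbr_flag s; have [ku _ _] := kK.
exists (g *m k); rewrite ?unitmx_mul ?gu//; split; first by rewrite vx_mulK.
by rewrite -mulmxA -E mulmxA (vx_mulK _ k'K) ?nbr_mul_unit.
Qed.

Lemma edge1_flag2 v w w' : edge1 v w -> edge1 v w' -> w <> w' ->
  exists2 g, g \in unitmx &
    [/\ v = vx g, w = vx (g *m diag 1 1 pi) & w' = vx (g *m diag 1 pi 1)].
Proof.
move=> /edge1_flag[g gu [-> ->]] /(edge1_nbrP r_int r_surj _ gu)[s ->] ww'.
have [|k [k1 [k2 [kK k1K k2K E1 E2]]]] := @nbr_flag2 s.
  by move=> sE; apply: ww'; rewrite sE.
have [ku _ _] := kK.
have du : diag 1 1 pi \in unitmx by rewrite diag_unit// oner_eq0.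
exists (g *m k); rewrite ?unitmx_mul ?gu//; split; first by rewrite vx_mulK.
  by rewrite -mulmxA E2 mulmxA (vx_mulK _ k1K) ?unitmx_mul ?gu.
by rewrite -mulmxA -E1 mulmxA (vx_mulK _ k2K) ?nbr_mul_unit.
Qed.

Lemma edge1_mul g m : g \in unitmx -> intmx m -> ord (\det m) = 1 -> m \in unitmx ->
  edge1 (vx g) (vx (g *m m)).
Proof.
move=> gu mO m1 mu; apply/edge1P; rewrite ?unitmx_mul ?gu//.
by exists 1; rewrite ?oner_eq0// scale1r mulKmx.
Qed.

Lemma vxZ c g : c != 0 -> g \in unitmx -> vx (c *: g) = vx g.
Proof.
move=> c0' gu; apply/esym/vx_eqP => //; first exact: scale_unitmx.
exists c^-1; rewrite ?invr_eq0// -scalemxAr scalerA !mulVf// scale1r mulVmx//.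
rewrite det1 ord_one; split=> // i j; rewrite mxE.
by case: (i == j); [exact: vge1|exact: vge0].
Qed.

(* Two hyperplanes of the residue space meet in exactly one line. *)
Lemma meet_unique g u : g \in unitmx -> edge1 (vx (g *m diag 1 1 pi)) u ->
  edge1 (vx (g *m diag 1 pi 1)) u -> u = vx (g *m diag 1 pi pi).
Proof.
move=> gu; have [h hu ->] := vx_surj u.
have o10 := oner_neq0 F.
have du := diag_unit o10 o10 pi0; have d'u := diag_unit o10 pi0 o10.
have eu := diag_unit o10 pi0 pi0.
have dI : invmx (diag 1 1 pi) = diag 1 1 pi^-1.
  by rewrite -[RHS](mulKmx du) (_ : _ *m diag 1 1 pi^-1 = 1%:M) ?mulmx1//; mx3_eq.
have d'I : invmx (diag 1 pi 1) = diag 1 pi^-1 1.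
  by rewrite -[RHS](mulKmx d'u) (_ : _ *m diag 1 pi^-1 1 = 1%:M) ?mulmx1//; mx3_eq.
have eI : invmx (diag 1 pi pi) = diag 1 pi^-1 pi^-1.
  by rewrite -[RHS](mulKmx eu) (_ : _ *m diag 1 pi^-1 pi^-1 = 1%:M) ?mulmx1//; mx3_eq.
have detd : \det (diag 1 1 pi) = pi by rewrite det_mx3; ring.
have detd' : \det (diag 1 pi 1) = pi by rewrite det_mx3; ring.
have dete : \det (diag 1 pi pi) = pi * pi by rewrite det_mx3; ring.
move=> /edge1P H /edge1P H'.
have [||c cn [cO ck]] := H => //; first by rewrite unitmx_mul gu.
have [||c' cn' [cO' ck']] := H' => //; first by rewrite unitmx_mul gu.
apply/esym/vx_eqP; rewrite ?unitmx_mul ?gu//.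
have ock : ord c = ord c'.
  have e1 : ord (\det (g *m diag 1 1 pi)) = ord (\det g) + 1.
    by rewrite det_mulmx detd ordM ?det_unit// ord_unif.
  have e2 : ord (\det (g *m diag 1 pi 1)) = ord (\det g) + 1.
    by rewrite det_mulmx detd' ordM ?det_unit// ord_unif.
  move: ck' ck; rewrite !ord_det_hrel ?unitmx_mul ?gu// e1 e2; ord_lia.
exists c => //; split; last first.
  move: ck; rewrite !ord_det_hrel ?unitmx_mul ?gu// !det_mulmx detd dete.
  by rewrite !ordM ?mulf_neq0 ?det_unit// ord_unif; ord_lia.
have {cO'} cO' : intmx (c *: (invmx (g *m diag 1 pi 1) *m h)).
  rewrite (_ : c = c / c' * c'); last by rewrite divfK.
  rewrite -scalerA; apply: intmxZ => //.
  by rewrite vgeE ?mulf_neq0 ?invr_eq0// ordM ?invr_eq0// ordV// ock subrr.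
move: cO cO'; rewrite !invmx_mul// dI d'I eI -!mulmxA !scalemxAr.
set M := invmx g *m _; rewrite (mx3_eta M) !mx3M => /intmx3P H1 /intmx3P H2.
apply/intmx3P; move: H1 H2; rewrite !mul0r !mul1r !addr0 !add0r.
by move=> [[? ? ?] [[? ? ?] [? ? ?]]] [[? ? ?] [[? ? ?] [? ? ?]]]; split; [|split].
Qed.

Local Notation outs := (out_nbrs r).
Local Notation ins := (in_nbrs r).

Let mem_outs v w : w \in outs v <-> edge1 v w := mem_out_nbrs r_int r_surj v w.
Let mem_ins' v w : w \in ins v <-> edge1 w v := mem_in_nbrs r_int r_surj v w.

(** By [edge1_flag2] it suffices to treat the standard pair. Its common out-neighbour is diag(1, pi,
    pi), and diag(pi, 1, 1) leads from there back to v, up to the scalar pi. *)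
Lemma out_nbrs_meet v w w' : w != w' -> w \in outs v -> w' \in outs v ->
  count (fun u => (u \in outs w) && (u \in outs w')) (ins v) = 1%N.
Proof.
move=> /eqP ww' /mem_outs vw /mem_outs vw'.
have [g gu [-> -> ->]] := edge1_flag2 vw vw' ww'.
have o10 := oner_neq0 F.
have du := diag_unit o10 o10 pi0; have d'u := diag_unit o10 pi0 o10.
have eu := diag_unit o10 pi0 pi0; have fu := diag_unit pi0 o10 o10.
have diagO a b c : vge 0 a -> vge 0 b -> vge 0 c -> intmx (diag a b c).
  by move=> ? ? ?; apply/intmx3P.
have gdu := unitmx_mul g (diag 1 1 pi).
apply: (@count_unique _ _ _ (vx (g *m diag 1 pi pi))).
- exact: in_nbrs_uniq.
- apply/mem_ins'; have -> : vx g = vx (g *m diag 1 pi pi *m diag pi 1 1).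
    rewrite -mulmxA (_ : diag 1 pi pi *m _ = pi%:M); last by mx3_eq.
    by rewrite mul_mx_scalar vxZ.
  apply: edge1_mul => //; rewrite ?unitmx_mul ?gu//; first exact: diagO.
  by rewrite det_mx3 -[RHS](ord_unif F); congr ord; ring.
- apply/andP; split; apply/mem_outs.
    have -> : vx (g *m diag 1 pi pi) = vx (g *m diag 1 1 pi *m diag 1 pi 1).
      by rewrite -mulmxA; congr (vx (_ *m _)); mx3_eq.
    apply: edge1_mul => //; rewrite ?unitmx_mul ?gu//; first exact: diagO.
    by rewrite det_mx3 -[RHS](ord_unif F); congr ord; ring.
  have -> : vx (g *m diag 1 pi pi) = vx (g *m diag 1 pi 1 *m diag 1 1 pi).
    by rewrite -mulmxA; congr (vx (_ *m _)); mx3_eq.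
  apply: edge1_mul => //; rewrite ?unitmx_mul ?gu//; first exact: diagO.
  by rewrite det_mx3 -[RHS](ord_unif F); congr ord; ring.
move=> u _ /andP[/mem_outs H1 /mem_outs H2]; exact: meet_unique.
Qed.

Lemma in_nbrs_join v w w' : w != w' -> w \in ins v -> w' \in ins v ->
  count (fun u => (w \in outs u) && (w' \in outs u)) (outs v) = 1%N.
Proof.
move=> ww' /mem_ins' vw /mem_ins' vw'.
rewrite -(@out_nbrs_meet (dual v) (dual w) (dual w')).
- rewrite [RHS]count_map.
  have -> : outs (dual (dual v)) = outs v by rewrite dualK.
  apply: eq_count => u /=.
  by congr (_ && _); apply/idP/idP => /mem_outs H; apply/mem_outs; move: H; rewrite edge1_dual.
- by rewrite (inj_eq (inv_inj (@dualK F))).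
- by apply/mem_outs; rewrite edge1_dual.
- by apply/mem_outs; rewrite edge1_dual.
Qed.

(** In the standard frame of the edge, closing the triangle means that the digit in the last column
    of the normal form is 0 modulo pi. This leaves q indices of the first cell and one of the
    second. *)
Lemma out_nbrs_triangle v w : w \in outs v ->
  count (fun u => v \in outs u) (outs w) = q.+1.
Proof.
move=> /mem_outs/edge1_flag[g gu [-> ->]].
have o10 := oner_neq0 F; have du := diag_unit o10 o10 pi0.
have gdu : g *m diag 1 1 pi \in unitmx by rewrite unitmx_mul gu.
rewrite (permP (perm_out_nbrs r_int r_surj r_inj gdu)) count_map.
have [i0 i0P] := r_surj c0; rewrite sub0r vgeN in i0P.
have i0_uniq i : vge 1 (r i) -> i = i0.
  by move=> ri; apply: r_inj; apply: vgeB.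
rewrite -size_filter.
rewrite (perm_size (_ : perm_eq _ ([seq inl (inl (i, i0)) | i <- enum 'I_q] ++ [:: inl (inr i0)]))).
  by rewrite size_cat size_map size_enum_ord addn1.
apply: uniq_perm; first by rewrite filter_uniq//; exact: enum_uniq.
  rewrite cat_uniq map_inj_uniq ?enum_uniq /=; last by move=> i j [].
  by rewrite orbF andbT; apply/mapP => -[].
move=> s; rewrite mem_filter mem_enum andbT mem_cat mem_seq1.
have dI : invmx (diag 1 1 pi) = diag 1 1 pi^-1.
  by rewrite -[RHS](mulKmx du) (_ : _ *m diag 1 1 pi^-1 = 1%:M) ?mulmx1//; mx3_eq.
have sE : (vx g \in outs (vx (g *m diag 1 1 pi *m nbr_mx r s))) <->
    intmx (pi *: (nbr_inv r s *m diag 1 1 pi^-1)).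
  rewrite mem_outs; have gdsu := nbr_mul_unit r s gdu.
  have iE c : c *: (invmx (g *m diag 1 1 pi *m nbr_mx r s) *m g) =
      c *: (nbr_inv r s *m diag 1 1 pi^-1).
    by rewrite invmx_mul ?nbr_mx_unit// invmx_nbr invmx_mul// dI -!mulmxA mulVmx// mulmx1.
  have oE c : c != 0 -> ord (\det (c *: (invmx (g *m diag 1 1 pi *m nbr_mx r s) *m g))) =
      3%:Z * ord c - 2.
    move=> cn; rewrite ord_det_hrel// !det_mulmx det_nbr.
    have -> : \det (diag 1 1 pi) = pi by rewrite det_mx3; ring.
    by rewrite !ordM ?mulf_neq0 ?det_unit// ord_unif; ord_lia.
  rewrite edge1P//; split=> [[c cn []]|piO].
    rewrite oE// => + oc; have {oc} oc : ord c = 1 by move: oc; ord_lia.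
    rewrite iE => cO.
    have pcO : vge 0 (pi / c).
      by rewrite vgeE ?mulf_neq0 ?invr_eq0// ordM ?invr_eq0// ordV// oc ord_unif.
    by have := intmxZ pcO cO; rewrite scalerA divfK.
  by exists pi => //; rewrite oE// ord_unif iE.
have piV : vge 0 pi^-1 = false by rewrite vgeE ?invr_eq0// ordV// ord_unif.
have div1 (x : F) : vge 0 (- x / pi) = vge 1 x.
  by rewrite -vge_div_unif add0r vgeN.
have {}sE : (vx g \in outs (vx (g *m diag 1 1 pi *m nbr_mx r s))) <->
    match s with inl (inl (i, j)) => vge 1 (r j) | inl (inr i) => vge 1 (r i)
    | inr _ => false end.
  rewrite sE; case: s {sE} => [[[i j]|i]|[]] /=.
  - have -> : pi *: (mx3 pi^-1 (- r i / pi) (- r j / pi) 0 1 0 0 0 1 *m diag 1 1 pi^-1)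
      = mx3 1 (- r i) (- r j / pi) 0 pi 0 0 0 1 by mx3_eq.
    by rewrite intmx3P div1 vgeN; split=> [[[]]//|H]; do !split.
  - have -> : pi *: (mx3 1 0 0 0 pi^-1 (- r i / pi) 0 0 1 *m diag 1 1 pi^-1)
      = mx3 pi 0 0 0 1 (- r i / pi) 0 0 1 by mx3_eq.
    by rewrite intmx3P div1; split=> [[_ [[]]]//|H]; do !split.
  - have -> : pi *: (mx3 1 0 0 0 1 0 0 0 pi^-1 *m diag 1 1 pi^-1)
      = mx3 pi 0 0 0 pi 0 0 0 pi^-1 by mx3_eq.
    by rewrite intmx3P piV; split=> // -[_ [_ []]].
apply/idP/idP => [/sE|H]; last apply/sE.
  case: s {sE} => [[[i j]|i]|[]] // /i0_uniq ->; last by rewrite eqxx orbT.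
  by rewrite map_f ?mem_enum.
case/orP: H => [/mapP[i _ ->]|/eqP ->]; exact: i0P.
Qed.

Lemma plane_links_building : plane_links outs ins q.
Proof.
split.
- by move=> v; apply: out_nbrs_uniq.
- by move=> v; apply: in_nbrs_uniq.
- by move=> v w; apply: in_out_nbrs.
- by move=> v; apply: size_out_nbrs.
- by move=> v; apply: size_in_nbrs.
- exact: out_nbrs_triangle.
- exact: out_nbrs_meet.
- exact: in_nbrs_join.
Qed.

End PlaneLinksBuilding.

(** * The horospherical function *)

Section Horospherical.
Variables (F : localField) (q : nat) (r : 'I_q -> F).
Hypothesis r_int : forall i, vge 0 (r i).
Hypothesis r_surj : forall x, vge 0 x -> exists i, vge 1 (x - r i).
Hypothesis r_inj : forall i j, vge 1 (r i - r j) -> i = j.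
Implicit Types (g h : 'M[F]_3) (u v w : vertex F).
Local Notation pi := (unif F).
Let pi0 : pi != 0 := unif_neq0 F.

(** Connectedness along directed edges: scaling makes the transition matrix integral, and each
    neighbour matrix split off by [nbr_reduce] lowers the order of its determinant by 1. *)
Lemma edge1_reach (P : vertex F -> Prop) v :
  P v -> (forall u w, edge1 u w -> P u -> P w) -> forall w, P w.
Proof.
have [a au ->] := vx_surj v => Pv Pedge w; have [h hu ->] := vx_surj w.
have step (n : nat) g : g \in unitmx -> intmx g -> ord (\det g) = n ->
    forall a, a \in unitmx -> P (vx a) -> P (vx (a *m g)).
  elim: n g => [|n IHn] g gu gO gn {au Pv}a au Pa; first by rewrite vx_mulK.
  have [|s sO] := nbr_reduce r_surj gO; first by rewrite vgeE ?det_unit// gn.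
  have gE : g = nbr_mx r s *m (nbr_inv r s *m g) by rewrite mulmxA nbr_mxV mul1mx.
  have g'u : nbr_inv r s *m g \in unitmx.
    by rewrite -invmx_nbr unitmx_mul unitmx_inv nbr_mx_unit.
  have gn' : ord (\det (nbr_inv r s *m g)) = n.
    move: gn; rewrite {1}gE det_mulmx det_nbr ordM ?det_unit// ord_unif intS.
    exact: addrI.
  rewrite gE (mulmxA a); apply: IHn => //; first exact: nbr_mul_unit.
  by apply: Pedge Pa; apply/(edge1_nbrP r_int r_surj) => //; exists s.
have [n nO] := scale_intmx (invmx a *m h).
have pn0 : pi ^+ n != 0 by rewrite expf_neq0.
have -> : vx h = vx (a *m (pi ^+ n *: (invmx a *m h))).
  by rewrite -scalemxAr mulKVmx// vxZ.
have gu : pi ^+ n *: (invmx a *m h) \in unitmx.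
  by rewrite scale_unitmx// unitmx_mul unitmx_inv au.
have := intmx_det nO; rewrite vgeE ?det_unit// => d0.
by apply: (step `|ord (\det (pi ^+ n *: (invmx a *m h)))|%N) => //; rewrite gez0_abs.
Qed.

Definition upper_tri (b : 'M[F]_3) : Prop := [/\ b \in unitmx, b o1 o0 = 0, b o2 o0 = 0 & b o2 o1 = 0].

Lemma upper_triE b : upper_tri b ->
  b = mx3 (b o0 o0) (b o0 o1) (b o0 o2) 0 (b o1 o1) (b o1 o2) 0 0 (b o2 o2).
Proof. by case=> _ b10 b20 b21; rewrite {1}(mx3_eta b) b10 b20 b21. Qed.

Lemma upper_tri_diag b : upper_tri b ->
  [/\ b o0 o0 != 0, b o1 o1 != 0 & b o2 o2 != 0].
Proof.
move=> bU; have [/det_unit + _ _ _] := bU; rewrite {1}(upper_triE bU) det_mx3.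
rewrite (_ : _ + _ = b o0 o0 * b o1 o1 * b o2 o2); last by ring.
by rewrite !mulf_eq0 !negb_or => /andP[/andP[]].
Qed.

Lemma upper_tri_mx3 (a b c d e f : F) : a != 0 -> d != 0 -> f != 0 ->
  upper_tri (mx3 a b c 0 d e 0 0 f).
Proof.
move=> a0 d0 f0; split; rewrite ?mxE// unitmxE unitfE det_mx3.
by rewrite (_ : _ + _ = a * d * f); [rewrite !mulf_neq0|ring].
Qed.

Lemma upper_tri_nbr b s : upper_tri b -> upper_tri (b *m nbr_mx r s).
Proof.
move=> bU; have [a0 d0 f0] := upper_tri_diag bU.
rewrite (upper_triE bU); case: s => [[[i j]|i]|[]]; rewrite /nbr_mx mx3M;
  rewrite ?mulr0 ?mul0r ?addr0 ?add0r ?mulr1; apply: upper_tri_mx3; rewrite ?mulf_neq0//.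
Qed.

(** The Iwasawa decomposition, from connectedness and the upper triangular shape of the neighbour
    matrices. *)
Lemma vx_upper v : exists2 b, upper_tri b & v = vx b.
Proof.
apply: (@edge1_reach (fun v => exists2 b, upper_tri b & v = vx b) (vx 1%:M)).
  by exists 1%:M => //; rewrite mx3_scalar; apply: upper_tri_mx3; rewrite oner_eq0.
move=> u w uw [b bU ub]; rewrite {}ub in uw; have [bu _ _ _] := bU.
have [s ->] := (edge1_nbrP r_int r_surj w bu).1 uw.
by exists (b *m nbr_mx r s) => //; apply: upper_tri_nbr.
Qed.

Definition height (b : 'M[F]_3) : int := ord (b o2 o2) - ord (b o0 o0).

(** The transition matrix is triangular and integral with unit determinant, so its diagonal entries
    are units; the scalar c cancels in the difference of orders. *)
Lemma height_vx b b' : upper_tri b -> upper_tri b' -> vx b = vx b' ->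
  height b = height b'.
Proof.
move=> bU bU'; have [bu _ _ _] := bU; have [bu' _ _ _] := bU'.
move=> /vx_eqP[]// c c0 []; set M := c *: _ => MO M1.
have Mu : M \in unitmx by rewrite scale_unitmx// unitmx_mul unitmx_inv bu.
have bM : b *m M = c *: b' by rewrite /M -scalemxAr mulKVmx.
clearbody M.
have [a0 d0 f0] := upper_tri_diag bU; have [a0' d0' f0'] := upper_tri_diag bU'.
move: bM; rewrite {1}(upper_triE bU) {1}(upper_triE bU') {1}(mx3_eta M) mx3M mx3Z.
move=> /matrixP E.
have := E o2 o0; rewrite !mxE /= !mul0r mulr0 !add0r => /eqP.
rewrite mulf_eq0 (negbTE f0) => /eqP M20.
have := E o2 o1; rewrite !mxE /= !mul0r mulr0 !add0r => /eqP.
rewrite mulf_eq0 (negbTE f0) => /eqP M21.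
have := E o1 o0; rewrite !mxE /= M20 !mul0r !mulr0 !add0r addr0 => /eqP.
rewrite mulf_eq0 (negbTE d0) => /eqP M10.
have := E o0 o0; rewrite !mxE /= M20 M10 !mulr0 !addr0 => E00.
have := E o2 o2; rewrite !mxE /= !mul0r !add0r => E22.
have MU : upper_tri M by split.
have [m0 m1 m2] := upper_tri_diag MU.
have detM : \det M = M o0 o0 * (M o1 o1 * M o2 o2).
  by rewrite {1}(upper_triE MU) det_mx3; ring.
move: (MO o0 o0) (MO o1 o1) (MO o2 o2) M1.
rewrite detM !vgeE// !ordM ?mulf_neq0//.
have := congr1 (@ord F) E00; have := congr1 (@ord F) E22.
by rewrite !ordM// /height; ord_lia.
Qed.

Section Psi.
Variable R : realType.

(* The horospherical function [q^(a3 - a1)] at the lattice with Iwasawa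
   exponents [a1, a2, a3]: the eigenfunction with Satake parameters [1, 1, 1]. *)
Definition psi v : R :=
  q%:R ^ height (xget 1%:M [set b | upper_tri b /\ v = vx b]).

Lemma psi_vx b : upper_tri b -> psi (vx b) = q%:R ^ height b.
Proof.
move=> bU; rewrite /psi; congr (_ ^ _).
have [b'U bb'] := xgetPex 1%:M (P := [set b' | upper_tri b' /\ vx b = vx b'])
  (ex_intro _ b (conj bU erefl)).
exact/esym/height_vx.
Qed.

Hypothesis q_gt0 : (0 < q)%N.

Lemma psi_gt0 v : 0 < psi v.
Proof. by rewrite /psi exprz_gt0// ltr0n. Qed.

Lemma psi_nbr b s : upper_tri b -> psi (vx (b *m nbr_mx r s)) = psi (vx b) *
  match s with inl (inl _) => q%:R^-1 | inl (inr _) => 1 | inr _ => q%:R end.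
Proof.
move=> bU; have [a0 d0 f0] := upper_tri_diag bU.
have q0 : q%:R != 0 :> R by rewrite pnatr_eq0 -lt0n.
rewrite !psi_vx//; last exact: upper_tri_nbr.
have [e00 e22] : (b *m nbr_mx r s) o0 o0 = b o0 o0 * (nbr_mx r s) o0 o0 /\
    (b *m nbr_mx r s) o2 o2 = b o2 o2 * (nbr_mx r s) o2 o2.
  rewrite {1 3}(upper_triE bU) (mx3_eta (nbr_mx r s)) mx3M !mxE /= !mul0r !add0r.
  split=> //; case: s => [[[i j]|i]|[]]; rewrite !mxE /=; ring.
rewrite /height {}e00 {}e22; case: s => [[[i j]|i]|[]]; rewrite !mxE /= ?mulr1 ?ordM// ?ord_unif.
- by rewrite opprD addrA expfzDr// exprN1.
- by rewrite addrAC expfzDr.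
Qed.

(** The cells of q^2, q and 1 neighbours carry the factors 1/q, 1 and q, so each contributes q. *)
Lemma psi_outs v : nsum (out_nbrs r) psi v = 3 * q%:R * psi v.
Proof.
have q0 : q%:R != 0 :> R by rewrite pnatr_eq0 -lt0n.
have [b bU ->] := vx_upper v; have [bu _ _ _] := bU.
rewrite /nsum (perm_big _ (perm_out_nbrs r_int r_surj r_inj bu)) big_map big_enum /=.
under eq_bigr do rewrite psi_nbr//.
rewrite -mulr_sumr big_sumType big_sumType /= !sumr_const !card_prod !card_ord.
rewrite card_unit mulr1n -[q%:R^-1 *+ _]mulr_natr natrM; field.
by rewrite q0.
Qed.

(** Duality turns the Iwasawa exponents (a1, a2, a3) into (-a3, -a2, -a1), which preserves a3 - a1.
    The right factor [rev3] restores the triangular shape. *)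
Lemma psi_dual v : psi (dual v) = psi v.
Proof.
have [b bU ->] := vx_upper v; have [bu _ _ _] := bU.
have [a0 d0 f0] := upper_tri_diag bU.
rewrite dual_vx// -(vx_mulK (k := rev3 F)) ?dual_mx_unit//; last first.
  rewrite /rev3; apply: inK_mx3; rewrite ?vge0 ?vge1//; right; ring.
have bE := upper_triE bU.
pose bi := mx3 (b o0 o0)^-1 (- b o0 o1 / (b o0 o0 * b o1 o1))
  ((b o0 o1 * b o1 o2 - b o0 o2 * b o1 o1) / (b o0 o0 * b o1 o1 * b o2 o2))
  0 (b o1 o1)^-1 (- b o1 o2 / (b o1 o1 * b o2 o2)) 0 0 (b o2 o2)^-1.
have biE : invmx b = bi.
  rewrite -[RHS](mulKmx bu) [X in _ *m X](_ : _ = 1%:M) ?mulmx1//.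
  rewrite {1}bE /bi mx3M mx3_scalar; congr mx3; field; rewrite ?a0 ?d0 ?f0//.
have -> : dual_mx b *m rev3 F = mx3 (b o2 o2)^-1 (- b o1 o2 / (b o1 o1 * b o2 o2))
    ((b o0 o1 * b o1 o2 - b o0 o2 * b o1 o1) / (b o0 o0 * b o1 o1 * b o2 o2))
    0 (b o1 o1)^-1 (- b o0 o1 / (b o0 o0 * b o1 o1)) 0 0 (b o0 o0)^-1.
  by rewrite /dual_mx biE /bi mx3_tr !mx3M; congr mx3; ring.
rewrite !psi_vx//; last by apply: upper_tri_mx3; rewrite invr_eq0.
congr (_ ^ _); rewrite /height !mxE /= !ordV//; ord_lia.
Qed.

Lemma psi_ins v : nsum (in_nbrs r) psi v = 3 * q%:R * psi v.
Proof.
rewrite -[in RHS]psi_dual -psi_outs /nsum big_map.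
by apply: eq_bigr => w _; rewrite psi_dual.
Qed.

End Psi.
End Horospherical.

(** * Operators on the quotient *)

Section Action.
Variable F : localField.
Implicit Types (g h : 'M[F]_3) (u v w : vertex F).

Definition act g v : vertex F := vx (g *m frame v).

Lemma hrel_mull k a g h : a \in unitmx -> g \in unitmx ->
  hrel k (a *m g) (a *m h) <-> hrel k g h.
Proof.
move=> au gu; rewrite /hrel invmx_mul//.
have -> : invmx g *m invmx a *m (a *m h) = invmx g *m h.
  by rewrite mulmxA mulmxKV.
by [].
Qed.

Lemma act_vx g h : g \in unitmx -> h \in unitmx -> act g (vx h) = vx (g *m h).
Proof.
move=> gu hu; have fu := frame_unit (vx h).
apply/vx_eqP; rewrite ?unitmx_mul ?gu//; apply/hrel_mull => //.
by apply/vx_eqP => //; rewrite vx_frame.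
Qed.

Lemma actM g h v : g \in unitmx -> h \in unitmx -> act g (act h v) = act (g *m h) v.
Proof.
move=> gu hu; have [k ku ->] := vx_surj v.
by rewrite !act_vx ?unitmx_mul ?hu ?gu// mulmxA.
Qed.

Lemma scalar_unitmx (c : F) : c != 0 -> (c%:M : 'M[F]_3) \in unitmx.
Proof. by move=> c0; rewrite -[_%:M]mulmx1 mul_scalar_mx scale_unitmx// unitmx1. Qed.

Lemma act_scalar (c : F) v : c != 0 -> act c%:M v = v.
Proof.
move=> c0; have [k ku ->] := vx_surj v.
by rewrite act_vx ?scalar_unitmx// mul_scalar_mx vxZ.
Qed.

Lemma act1 v : act 1%:M v = v.
Proof. by rewrite act_scalar// oner_eq0. Qed.

Lemma actK g v : g \in unitmx -> act (invmx g) (act g v) = v.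
Proof. by move=> gu; rewrite actM ?unitmx_inv// mulVmx// act1. Qed.

Lemma actVK g v : g \in unitmx -> act g (act (invmx g) v) = v.
Proof. by move=> gu; rewrite actM ?unitmx_inv// mulmxV// act1. Qed.

Lemma edge1_act g v w : g \in unitmx -> edge1 (act g v) (act g w) <-> edge1 v w.
Proof.
move=> gu; have [h hu ->] := vx_surj v; have [k ku ->] := vx_surj w.
rewrite !act_vx// !edge1P ?unitmx_mul ?gu//; exact: hrel_mull.
Qed.

Lemma moves_act g v w : g \in unitmx -> moves g v w <-> w = act g v.
Proof.
move=> gu; have [h hu ->] := vx_surj v; rewrite act_vx//.
have ghu : g *m h \in unitmx by rewrite unitmx_mul gu.
have E : [set lat_act g L | L in val (vx h)] = val (vx (g *m h)).
  rewrite !val_vx//; apply/seteqP; split=> [_ [_ [c c0 <-] <-]|_ [c c0 <-]].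
    exists c => //; rewrite !lat_actM; congr (lat_act _ _).
    by rewrite !mulmxA scalar_mxC.
  exists (lat_act c%:M (lat_act h (std_lattice F))); first by exists c.
  rewrite !lat_actM; congr (lat_act _ _).
  by rewrite !mulmxA scalar_mxC.
by rewrite /moves E; split=> [/val_inj|->].
Qed.

End Action.

Section Quotient.
Variables (R : realType) (F : localField) (Gamma : set 'M[F]_3).
Hypothesis Gamma_group : pgl_subgroup Gamma.
Hypothesis Gamma_free : acts_freely R Gamma.
Implicit Types (g h : 'M[F]_3) (u v w : vertex F) (x y : qvertex Gamma).

Local Notation pr := (@vproj F Gamma).

Lemma Gunit g : Gamma g -> g \in unitmx.
Proof. by case: Gamma_group => + _ _ _; apply. Qed.

Lemma Gmul g h : Gamma g -> Gamma h -> Gamma (g *m h).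
Proof. by case: Gamma_group => _ _ + _; apply. Qed.

Lemma Ginv g : Gamma g -> Gamma (invmx g).
Proof. by case: Gamma_group => _ _ _; apply. Qed.

Lemma Gone : Gamma 1%:M.
Proof. by case: Gamma_group => _ + _ _; apply; rewrite oner_eq0. Qed.

Lemma vorbitP v w : vorbit Gamma v w <-> exists2 g, Gamma g & w = act g v.
Proof.
by split=> -[g gG] /moves_act H; exists g => //; apply: H; apply: Gunit.
Qed.

Lemma vproj_eqP v w : pr v = pr w <-> exists2 g, Gamma g & w = act g v.
Proof.
split=> [/(congr1 val)/= vw|[g gG ->]].
  apply/vorbitP; rewrite vw; apply/vorbitP; exists 1%:M; first exact: Gone.
  by rewrite act1.
apply: val_inj; apply/seteqP; split=> u /vorbitP[h hG ->]; apply/vorbitP.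
  exists (h *m invmx g); first exact/Gmul/Ginv.
  have gu := Gunit gG; have hu := Gunit hG.
  by rewrite actM ?unitmx_mul ?hu ?unitmx_inv// mulmxKV.
by exists (h *m g); [exact: Gmul|rewrite actM// Gunit].
Qed.

Lemma vproj_act g v : Gamma g -> pr (act g v) = pr v.
Proof. by move=> gG; apply/esym/vproj_eqP; exists g. Qed.

Lemma vliftK x : pr (vlift x) = x.
Proof.
by apply: val_inj => /=; rewrite /vlift; case: (cid2 _).
Qed.

Lemma vlift_act v : exists2 g, Gamma g & v = act g (vlift (pr v)).
Proof. by apply/vproj_eqP; rewrite vliftK. Qed.

(** The vertex v is the point of the realization given by its indicator function, which g would
    fix. *)
Lemma act_fixed g v : Gamma g -> act g v = v -> is_scalar_mx g.
Proof.
move=> gG gv; apply/negPn/negP => gs.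
pose x w : R := if w == v then 1 else 0.
apply: (Gamma_free gG gs (x := x)).
  exists [set v]; split.
  - by split; [exact: finite_set1|exists v|move=> ? ? -> ->].
  - by move=> w; rewrite /x; case: ifP.
  - by move=> w; rewrite /x; case: eqP => //= -> _.
  - by rewrite fsbig_set1 /x eqxx.
move=> u w /(moves_act _ _ (Gunit gG)) ->; rewrite /x.
congr (if _ then _ else _); apply/eqP/eqP => [H|->//].
by rewrite -[u](actK _ (Gunit gG)) H -{1}gv actK// Gunit.
Qed.

Section Symmetric.
Variables (nbr rnbr : vertex F -> seq (vertex F)).
Hypothesis nbr_uniq : forall v, uniq (nbr v).
Hypothesis rnbrP : forall v w, (v \in rnbr w) = (w \in nbr v).
Hypothesis nbr_act : forall g v w, Gamma g -> (act g w \in nbr (act g v)) = (w \in nbr v).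

(** An edge from a to g b goes to the edge from g^-1 a to b. This is injective because vertex
    stabilizers are scalar, and it makes A_1 and A_2 adjoint on the quotient, multiplicities
    included. *)
Lemma count_fiber_le a b :
  (count (fun w => pr w == pr b) (nbr a) <= count (fun u => pr u == pr a) (rnbr b))%N.
Proof.
have gP w : exists g, pr w == pr b -> Gamma g /\ w = act g b.
  have [e|ne] := eqVneq (pr w) (pr b); last by exists 1%:M.
  by have [g gG ->] := (vproj_eqP b w).1 (esym e); exists g.
pose gw w := projT1 (cid (gP w)).
have gwP w : pr w == pr b -> Gamma (gw w) /\ w = act (gw w) b.
  by rewrite /gw; case: (cid _).
rewrite -!size_filter -(size_map (fun w => act (invmx (gw w)) a)); apply: uniq_leq_size.
  rewrite map_inj_in_uniq ?filter_uniq// => w w'; rewrite !mem_filter.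
  move=> /andP[/gwP[gG wE] _] /andP[/gwP[gG' wE'] _] H.
  have gu := Gunit gG; have gu' := Gunit gG'.
  have : act (gw w' *m invmx (gw w)) a = a.
    by rewrite -actM ?unitmx_inv// H actVK.
  move/(act_fixed (Gmul gG' (Ginv gG)))/is_scalar_mxP => [c cE].
  have gE : gw w' = c *: gw w by rewrite -(mulmxKV gu (gw w')) cE mul_scalar_mx.
  have c0 : c != 0.
    apply: contraTneq gu' => c0; rewrite gE c0 scale0r unitmxE unitfE.
    by rewrite det0 eqxx.
  by rewrite wE wE' gE -mul_scalar_mx -actM ?scalar_unitmx// act_scalar.
move=> u /mapP[w]; rewrite !mem_filter => /andP[/gwP[gG wE] wa] ->.
rewrite vproj_act ?eqxx /=; last exact: Ginv.
by rewrite rnbrP -(nbr_act _ _ gG) actVK ?Gunit// -wE.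
Qed.

End Symmetric.

Section Operators.
Variables (q : nat) (r : 'I_q -> F).
Hypothesis r_int : forall i, vge 0 (r i).
Hypothesis r_surj : forall z, vge 0 z -> exists i, vge 1 (z - r i).
Hypothesis r_inj : forall i j, vge 1 (r i - r j) -> i = j.

Local Notation outs := (out_nbrs r).
Local Notation ins := (in_nbrs r).
Let mem_outs v w : w \in outs v <-> edge1 v w := mem_out_nbrs r_int r_surj v w.
Let mem_insE v w : w \in ins v <-> edge1 w v := mem_in_nbrs r_int r_surj v w.
Let Hpl : plane_links outs ins q := plane_links_building r_int r_surj r_inj.

Lemma outs_act g v w : Gamma g -> (act g w \in outs (act g v)) = (w \in outs v).
Proof.
move=> gG; have gu := Gunit gG.
by apply/idP/idP => /mem_outs H; apply/mem_outs; move: H; rewrite edge1_act.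
Qed.

Lemma ins_act g v w : Gamma g -> (act g w \in ins (act g v)) = (w \in ins v).
Proof. by move=> gG; rewrite !(mem_ins Hpl) outs_act. Qed.

Lemma count_fiber a b :
  count (fun w => pr w == pr b) (outs a) = count (fun u => pr u == pr a) (ins b).
Proof.
apply/eqP; rewrite eqn_leq; apply/andP; split.
  apply: count_fiber_le; [exact: (outs_uniq Hpl)|exact: (mem_ins Hpl)|].
  by move=> g v w; apply: outs_act.
apply: count_fiber_le; [exact: (ins_uniq Hpl)| |].
  by move=> v w; rewrite (mem_ins Hpl).
by move=> g v w; apply: ins_act.
Qed.

Lemma nsum_outs_act (Z : nmodType) (f : qvertex Gamma -> Z) g v : Gamma g ->
  nsum outs (f \o pr) (act g v) = nsum outs (f \o pr) v.
Proof.
move=> gG; have gu := Gunit gG; rewrite /nsum.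
rewrite (perm_big [seq act g w | w <- outs v]) /=; last first.
  apply: uniq_perm; first exact: (outs_uniq Hpl).
    by rewrite map_inj_uniq ?(outs_uniq Hpl)//; apply: can_inj (fun w => actK w gu).
  move=> w; rewrite -{1}(actVK w gu) outs_act// -{2}(actVK w gu).
  by rewrite mem_map//; apply: can_inj (fun w => actK w gu).
by rewrite big_map; apply: eq_bigr => w _ /=; rewrite vproj_act.
Qed.

Lemma nsum_ins_act (Z : nmodType) (f : qvertex Gamma -> Z) g v : Gamma g ->
  nsum ins (f \o pr) (act g v) = nsum ins (f \o pr) v.
Proof.
move=> gG; have gu := Gunit gG; rewrite /nsum.
rewrite (perm_big [seq act g w | w <- ins v]) /=; last first.
  apply: uniq_perm; first exact: (ins_uniq Hpl).
    by rewrite map_inj_uniq ?(ins_uniq Hpl)//; apply: can_inj (fun w => actK w gu).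
  move=> w; rewrite -{1}(actVK w gu) ins_act// -{2}(actVK w gu).
  by rewrite mem_map//; apply: can_inj (fun w => actK w gu).
by rewrite big_map; apply: eq_bigr => w _ /=; rewrite vproj_act.
Qed.

Lemma Aop1E (Z : nmodType) (f : vertex F -> Z) : Aop 1 f = nsum outs f.
Proof.
apply/funext => v; rewrite /Aop /nsum.
have -> : [set w | adj v w /\ edge_color v w = 1] = [set` outs v].
  by apply/seteqP; split=> w /mem_outs.
by rewrite -fsbig_seq// (outs_uniq Hpl).
Qed.

Lemma Aop2E (Z : nmodType) (f : vertex F -> Z) : Aop 2%:R f = nsum ins f.
Proof.
apply/funext => v; rewrite /Aop /nsum.
have -> : [set w | adj v w /\ edge_color v w = 2%:R] = [set` ins v].
  by apply/seteqP; split=> w; [move/edge2P/mem_insE|move/mem_insE/edge2P].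
by rewrite -fsbig_seq// (ins_uniq Hpl).
Qed.

End Operators.
End Quotient.

Lemma card_seq_eq (T : choiceType) (s : seq T) : uniq s ->
  ([set` s] #= `I_(size s))%card.
Proof.
move=> us; apply/card_set_bijP; exists (index^~ s); split.
- by move=> x /= xs; rewrite index_mem.
- move=> x y; rewrite !inE /= => xs ys xy.
  by rewrite -(nth_index x xs) xy nth_index.
- move=> i /= is_; have x0 : T by case: (s) is_ => [|x l] //.
  by exists (nth x0 s i); rewrite /= ?mem_nth// index_uniq.
Qed.

(** * Enumeration of the terms of the geodesic operator *)

Section GeodesicTerms.
Variables (F : localField) (q : nat) (r : 'I_q -> F).
Hypothesis r_int : forall i, vge 0 (r i).
Hypothesis r_surj : forall z, vge 0 z -> exists i, vge 1 (z - r i).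
Hypothesis r_inj : forall i j, vge 1 (r i - r j) -> i = j.
Implicit Types (u v w : vertex F).

Local Notation outs := (out_nbrs r).
Local Notation ins := (in_nbrs r).
Let mem_outs v w : w \in outs v <-> edge1 v w := mem_out_nbrs r_int r_surj v w.
Let Hpl : plane_links outs ins q := plane_links_building r_int r_surj r_inj.

Lemma geodesicE m (p : m.+1.-tuple (vertex F)) : geodesic p <-> geo_seq outs p.
Proof.
rewrite (geo_seqP outs (pstart p) p) size_tuple /geodesic.
split=> [[H1 H2]|[H1 H2]].
  have E i : (i < m)%N -> edge1 (nth (pstart p) p i) (nth (pstart p) p i.+1) by move/H1.
  split=> i im; first by apply/mem_outs/E.
  apply/negP => /mem_outs; apply/edge1_triangle; last exact: H2.
    by apply: E; apply: ltnW.
  exact: E.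
have E i : (i < m)%N -> edge1 (nth (pstart p) p i) (nth (pstart p) p i.+1).
  by move=> im; apply/mem_outs/H1.
split=> i im; first exact: E.
apply/edge1_triangle; [by apply: E; apply: ltnW|exact: E|].
by move/mem_outs; apply/negP/H2.
Qed.

Variables (m : nat) (v : vertex F).

Let tup (s : seq (vertex F)) : m.+1.-tuple (vertex F) := insubd (nseq_tuple m.+1 v) s.

(** Geodesics ending at v are found by walking backwards along [ins] and reversing the sequence. *)
Definition geo_term_seq : seq (m.+1.-tuple (vertex F) * bool) :=
  [seq (tup (v :: p), true) | p <- geo_from outs m v] ++
  [seq (tup (rev (v :: p)), false) | p <- geo_from ins m v].

Let tupK s : size s = m.+1 -> tup s = s :> seq _.
Proof. by move=> sm; apply: insubdK; apply/eqP. Qed.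

Let pstartE (p : m.+1.-tuple (vertex F)) : pstart p = head v p.
Proof. by rewrite /pstart (tnth_nth v) nth0. Qed.

Let pendE (p : m.+1.-tuple (vertex F)) : pend p = last v p.
Proof. by rewrite /pend (tnth_nth v) (last_nth v) size_tuple; case: (val p). Qed.

Lemma mem_geo_terms : geodesic_terms m v = [set` geo_term_seq].
Proof.
apply/seteqP; split=> [[p b]|t].
  rewrite /geodesic_terms /= mem_cat => -[/geodesicE gp].
  have sp : size p = m.+1 by rewrite size_tuple.
  case: b => [|] E; apply/orP; [left|right]; apply/mapP.
    exists (behead p).
      rewrite mem_geo_from size_behead sp eqxx /=.
      by move: gp E; rewrite pstartE; case: (val p) sp => // a l _ + /= <-.
    congr (_, _); apply: val_inj => /=; rewrite tupK; last first.
      by rewrite /= size_behead sp.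
    by move: E; rewrite pstartE; case: (val p) sp => // a l _ /= ->.
  have [l lE] : exists l, rev p = v :: l.
    exists (behead (rev p)); move: E; rewrite pendE.
    case/lastP: (val p) sp => // l a _; rewrite last_rcons rev_rcons => ->//.
  exists l.
    rewrite mem_geo_from -eqSS -[(size l).+1]/(size (v :: l)) -lE size_rev sp eqxx /=.
    by rewrite (geo_seq_rev p (fun a b => mem_ins Hpl a b)).
  have sl : size (rev (v :: l)) = m.+1 by rewrite size_rev -lE size_rev.
  by congr (_, _); apply: val_inj => /=; rewrite tupK// -lE revK.
rewrite /= mem_cat => /orP[] /mapP[p]; rewrite mem_geo_from => /andP[/eqP sp gp] -> /=.
  have E := tupK (_ : size (v :: p) = m.+1).
  rewrite /geodesic_terms /= geodesicE pstartE E ?gp//=; by rewrite sp.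
have E : tup (rev (v :: p)) = rev (v :: p) :> seq _ by rewrite tupK// size_rev /= sp.
rewrite /geodesic_terms /= geodesicE pendE E.
rewrite (geo_seq_rev (outs := ins)) ?gp => [|a b]; last by rewrite (mem_ins Hpl).
by rewrite rev_cons last_rcons.
Qed.

Lemma geo_term_seq_uniq : uniq geo_term_seq.
Proof.
rewrite cat_uniq; apply/and3P; split.
- rewrite map_inj_in_uniq; first by apply: uniq_geo_from; exact: (outs_uniq Hpl).
  move=> p p'; rewrite !mem_geo_from => /andP[/eqP sp _] /andP[/eqP sp' _] [].
  by move/(congr1 val); rewrite /= !tupK /= ?sp ?sp'// => -[].
- by apply/hasPn => t /mapP[p _ ->]; apply/mapP => -[].
- rewrite map_inj_in_uniq; first by apply: uniq_geo_from; exact: (ins_uniq Hpl).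
  move=> p p'; rewrite !mem_geo_from => /andP[/eqP sp _] /andP[/eqP sp' _] [].
  move/(congr1 val); rewrite /= !tupK ?size_rev /= ?sp ?sp'//.
  by move/(can_inj revK) => -[].
Qed.

Lemma geodesic_opE (Z : nmodType) (f : vertex F -> Z) :
  geodesic_op m f v = gsum outs m f v + gsum ins m f v.
Proof.
rewrite /geodesic_op mem_geo_terms -fsbig_seq ?geo_term_seq_uniq//.
rewrite big_cat !big_map /= /gsum; congr (_ + _); apply: eq_big_seq => p.
  rewrite mem_geo_from => /andP[/eqP sp _]; congr f.
  by rewrite pendE tupK //= sp.
rewrite mem_geo_from => /andP[/eqP sp _]; congr f.
rewrite pstartE tupK ?size_rev /= ?sp//.
by case/lastP: p {sp} => [|p a]; rewrite // -rcons_cons rev_rcons last_rcons.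
Qed.

Lemma card_geodesic_terms : (0 < m)%N ->
  (geodesic_terms m v #= `I_(2 * (q ^ 2 + q + 1) * q ^ (2 * (m - 1))))%card.
Proof.
move=> m0; rewrite mem_geo_terms.
have := card_seq_eq geo_term_seq_uniq; congr (_ #= `I_ _)%card.
rewrite size_cat !size_map; case: m m0 => // m' _.
by rewrite (size_geo_from Hpl) (size_geo_from (plane_links_rev Hpl)) subn1 addnn -mul2n mulnA.
Qed.

End GeodesicTerms.

(** * Joint eigenfunctions on the quotient *)

Section FiniteQuotient.
Variables (F : localField) (Gamma : set 'M[F]_3).
Hypothesis Gamma_group : pgl_subgroup Gamma.
Hypothesis Gamma_cocompact : cocompact Gamma.
Implicit Types (g h : 'M[F]_3).
Local Notation pr := (@vproj F Gamma).

Lemma det_near_one (M : 'M[F]_3) : (forall i j, vge 1 (M i j)) ->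
  vge 1 (\det (1%:M + M) - 1).
Proof.
move=> M1; rewrite (_ : 1%:M + M = mx3 (1 + M o0 o0) (M o0 o1) (M o0 o2)
    (M o1 o0) (1 + M o1 o1) (M o1 o2) (M o2 o0) (M o2 o1) (1 + M o2 o2)); last first.
  by apply/matrixP; do 2![apply: forall_ord3]; rewrite !mxE /= ?add0r.
rewrite det_mx3.
move: (M1 o0 o0) (M1 o0 o1) (M1 o0 o2) (M1 o1 o0) (M1 o1 o1) (M1 o1 o2)
  (M1 o2 o0) (M1 o2 o1) (M1 o2 o2).
move: (M o0 o0) (M o0 o1) (M o0 o2) (M o1 o0) (M o1 o1) (M o1 o2) (M o2 o0) (M o2 o1) (M o2 o2).
move=> a b c d e f g h i a1 b1 c1 d1 e1 f1 g1 h1 i1.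
have w (x : F) : vge 1 x -> vge 0 x by apply: vge_le.
have p (x y : F) : vge 1 x -> vge 0 y -> vge 1 (x * y).
  by move=> x1 y0; rewrite -[1]addr0; apply: vgeM.
have s (x : F) : vge 1 x -> vge 0 (1 + x) by move=> x1; apply: vgeD; [exact: vge1|exact: w].
rewrite (_ : _ - 1 = a * ((1 + e) * (1 + i) - f * h) + (e * (1 + i) + i - f * h)
  - b * (d * (1 + i) - f * g) + c * (d * h - (1 + e) * g)); last by ring.
have t1 := p _ _ a1 (vgeB (vge0M (s _ e1) (s _ i1)) (vge0M (w _ f1) (w _ h1))).
have t2 := vgeB (vgeD (p _ _ e1 (s _ i1)) i1) (p _ _ f1 (w _ h1)).
have t3 := p _ _ b1 (vgeB (vge0M (w _ d1) (s _ i1)) (vge0M (w _ f1) (w _ g1))).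
have t4 := p _ _ c1 (vgeB (vge0M (w _ d1) (w _ h1)) (vge0M (s _ e1) (w _ g1))).
exact: vgeD (vgeB (vgeD t1 t2) t3) t4.
Qed.

Lemma open_vertex_class (P : vertex F -> Prop) :
  open_GL [set h : 'M[F]_3 | h \in unitmx /\ P (vx h)].
Proof.
split=> [h []//|h [hu Ph]]; have [n nO] := scale_intmx (invmx h).
have u0 := unif_neq0 F; have un0 : unif F ^+ n != 0 by rewrite expf_neq0.
(* As pi^n h^-1 is integral, this radius makes h^-1 (h' - h) divisible by pi, so h^-1 h' lies in
   GL_3(O) and h' represents the same vertex. *)
exists (n%:Z + 1) => h' [hb h'u]; split=> //.
suff <- : vx h = vx h' by [].
pose N := invmx h *m (h' - h).
have N1 i j : vge 1 (N i j).
  have -> : N i j = ((unif F ^+ n *: invmx h) *m ((unif F ^+ n)^-1 *: (h' - h))) i j.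
    by rewrite -scalemxAl -scalemxAr scalerA mulfV// scale1r.
  rewrite mxE; apply: vge_sum => k _; rewrite -[1]add0r; apply: vgeM; first exact: nO.
  rewrite mxE; have /frac_idealE := hb k j; rewrite !mxE.
  have [->|d0] := eqVneq (h' k j - h k j) 0; first by rewrite mulr0 !vge0.
  rewrite !vgeE ?mulf_neq0 ?invr_eq0// ordM ?invr_eq0// ordV// ordX// ord_unif.
  by rewrite -mulr_natr mul1r natz; ord_lia.
have E : invmx h *m h' = 1%:M + N by rewrite /N mulmxBr mulVmx// addrC subrK.
have d1 := det_near_one N1.
apply/vx_eqP => //; exists 1; rewrite ?oner_eq0// scale1r; split.
  move=> i j; rewrite E mxE; apply: vgeD; last by apply: vge_le (N1 i j).
  by rewrite mxE; case: (i == j); [exact: vge1|exact: vge0].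
rewrite E; set D := \det _ in d1 *.
have DE : D = 1 + (D - 1) by rewrite addrC subrK.
have D0 : vge 0 D by rewrite DE; apply: vgeD; [exact: vge1|apply: vge_le d1].
have D1 : ~~ vge 1 D.
  apply/negP => D1; have := vgeB D1 d1.
  by rewrite opprB addrC subrK vgeE ?oner_neq0// ord_one.
have [Dn DV] := vge_unitV D0 D1.
by move: D0 DV; rewrite !vgeE ?invr_eq0// ordV//; ord_lia.
Qed.

(** The matrices over a given quotient vertex form an open invariant set. These sets are nonempty
    and disjoint, so a finite subcover contains them all. *)
Lemma qvertex_finite : exists xs : seq (qvertex Gamma), uniq xs /\ forall x, x \in xs.
Proof.
pose U (x : qvertex Gamma) := [set h : 'M[F]_3 | h \in unitmx /\ pr (vx h) = x].
have [||D' [finD' D'D D'cov]] := Gamma_cocompact (D := range U).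
- move=> _ [x _ <-]; split; first exact: open_vertex_class (fun v => pr v = x).
  move=> g h gG [hu hx]; have gu := Gunit Gamma_group gG.
  split; first by rewrite unitmx_mul gu.
  by rewrite -hx -act_vx// vproj_act.
- by move=> h hu; exists (U (pr (vx h))) => //; exists (pr (vx h)).
have xU x : U x (frame (vlift x)).
  by split; [exact: frame_unit|rewrite vx_frame (vliftK)].
have Uinj x y : U x = U y -> x = y.
  by move=> xy; have [_ e1] := xU x; have := xU x; rewrite xy => -[_ /(etrans (esym e1))].
have UD' x : D' (U x).
  have [V VD' Vx] := D'cov _ (frame_unit (vlift x)).
  have [y _ yV] := D'D _ VD'; suff -> : x = y by rewrite yV.
  by have [_ e1] := xU x; rewrite -yV in Vx; case: Vx => _ /(etrans (esym e1)).
have : finite_set [set: qvertex Gamma].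
  have -> : [set: qvertex Gamma] = U @^-1` D' by apply/seteqP; split=> x _ //=; exact: UD'.
  by apply: finite_preimage => // x y _ _; apply: Uinj.
move=> /finite_seqP[s sE]; exists (undup s); split; first exact: undup_uniq.
by move=> x; rewrite mem_undup; have : [set: qvertex Gamma] x by []; rewrite sE.
Qed.

End FiniteQuotient.

(** * Cube roots of unity *)

Lemma cube_root_powers (K : idomainType) (w : K) : w ^+ 2 + w + 1 = 0 ->
  w ^+ 3 = 1 /\ forall z, z ^+ 3 = 1 -> exists i : 'I_3, z = w ^+ i.
Proof.
move=> w0; have w3 : w ^+ 3 = 1.
  have E : w ^+ 3 - 1 = (w - 1) * (w ^+ 2 + w + 1) by ring.
  by apply/eqP; rewrite -subr_eq0 E w0 mulr0.
split=> // z z3.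
have : (z - 1) * (z - w) * (z - w ^+ 2) = 0.
  have -> : (z - 1) * (z - w) * (z - w ^+ 2) =
    z ^+ 3 - w ^+ 3 + (w ^+ 2 + w + 1) * (z * w - z ^+ 2) by ring.
  by rewrite z3 w3 w0 subrr mul0r addr0.
move/eqP; rewrite !mulf_eq0 !subr_eq0 -orbA => /or3P[]/eqP ->.
- by exists ord0; rewrite expr0.
- by exists (Ordinal (isT : 1 < 3)%N); rewrite expr1.
- by exists (Ordinal (isT : 2 < 3)%N).
Qed.

Lemma cube_root_power_sum (K : idomainType) (z : K) m : z ^+ 2 + z + 1 = 0 ->
  z ^+ m + z ^+ (2 * m) = if (3 %| m)%N then 2 else -1.
Proof.
move=> z0; have [z3 _] := cube_root_powers z0.
have z1 n : z ^+ n = z ^+ (n %% 3) by rewrite expr_mod.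
rewrite z1 (z1 (2 * m)%N) -modnMmr /dvdn.
have zz : z + z ^+ 2 = -1 by apply/eqP; rewrite -subr_eq0 opprK -z0; apply/eqP; ring.
have := ltn_pmod m (isT : 0 < 3)%N; case: (m %% 3)%N => [|[|[|//]]] _ /=.
- by rewrite expr0.
- by rewrite expr1.
- by rewrite addrC.
Qed.

(** Injectivity of the Fourier transform on Z/3: the inverse transform recovers three times each
    coordinate, up to a multiple of w^2 + w + 1. *)
Lemma cube_root_transform_inj (K : numDomainType) (w x y z : K) :
  w ^+ 2 + w + 1 = 0 -> x + y + z = 0 -> x + w * y + w ^+ 2 * z = 0 ->
  x + w ^+ 2 * y + w ^+ 4 * z = 0 -> [/\ x = 0, y = 0 & z = 0].
Proof.
move=> w0 S0 S1 S2; have three0 (t : K) : 3 * t = 0 -> t = 0.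
  by move/eqP; rewrite mulf_eq0 pnatr_eq0 /= => /eqP.
split; apply: three0.
- transitivity ((x + y + z) + (x + w * y + w ^+ 2 * z) + (x + w ^+ 2 * y + w ^+ 4 * z)
    - (w ^+ 2 + w + 1) * (y + (w ^+ 2 - w + 1) * z)); first by ring.
  by rewrite S0 S1 S2 w0; ring.
- transitivity ((x + y + z) + w ^+ 2 * (x + w * y + w ^+ 2 * z)
    + w * (x + w ^+ 2 * y + w ^+ 4 * z)
    - (w ^+ 2 + w + 1) * (x + 2 * (w - 1) * y + (1 + (w - 1) * (w + w ^+ 2)) * z)); first by ring.
  by rewrite S0 S1 S2 w0; ring.
- transitivity ((x + y + z) + w * (x + w * y + w ^+ 2 * z)
    + w ^+ 2 * (x + w ^+ 2 * y + w ^+ 4 * z)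
    - (w ^+ 2 + w + 1) * (x + (w ^+ 2 - w + 1) * y + (w - 1) * (w ^+ 3 + 2) * z)); first by ring.
  by rewrite S0 S1 S2 w0; ring.
Qed.

Lemma cube_root_inj (K : idomainType) (z : K) (a b : 'Z_3) :
  z ^+ 3 = 1 -> z ^+ a = z ^+ b -> a != b -> z = 1.
Proof.
move=> z3; wlog ab : a b / (a < b)%N => [H|].
  case: (ltngtP a b) => [ab|ba|/val_inj ->]; first exact: H.
    by rewrite eq_sym => E; apply: H; rewrite // E.
  by rewrite eqxx.
move=> E _; move: (nat_of_ord a) (nat_of_ord b) (ltn_ord b) ab E => {b}{}a b.
case: a b => [|[|a]] [|[|[|b]]]// _ _; rewrite ?expr0 ?expr1 // => E.
- by rewrite -z3 exprS -E mulr1.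
- by rewrite -z3 [z ^+ 3]exprS -E.
Qed.

Section QuotientSpectrum.
Variables (R : realType) (F : localField) (Gamma : set 'M[F]_3).
Hypothesis Gamma_group : pgl_subgroup Gamma.
Hypothesis Gamma_free : acts_freely R Gamma.
Hypothesis Gamma_cocompact : cocompact Gamma.
Local Notation pr := (@vproj F Gamma).
Local Notation C := R[i].
Variables (q : nat) (r : 'I_q -> F).
Hypothesis q_gt1 : (1 < q)%N.
Hypothesis r_int : forall i, vge 0 (r i).
Hypothesis r_surj : forall z, vge 0 z -> exists i, vge 1 (z - r i).
Hypothesis r_inj : forall i j, vge 1 (r i - r j) -> i = j.
Local Notation outs := (out_nbrs r).
Local Notation ins := (in_nbrs r).
Let Hpl : plane_links outs ins q := plane_links_building r_int r_surj r_inj.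
Implicit Types (f e : qvertex Gamma -> C) (u v w : vertex F).

Lemma AX1_proj f v : AX 1 f (pr v) = nsum outs (f \o pr) v.
Proof.
rewrite /AX /quotient_op (Aop1E r_int r_surj r_inj).
have [g gG vE] := vlift_act Gamma_group v.
by rewrite [in RHS]vE (nsum_outs_act Gamma_group r_int r_surj r_inj).
Qed.

Lemma AX2_proj f v : AX 2%:R f (pr v) = nsum ins (f \o pr) v.
Proof.
rewrite /AX /quotient_op (Aop2E r_int r_surj r_inj).
have [g gG vE] := vlift_act Gamma_group v.
by rewrite [in RHS]vE (nsum_ins_act Gamma_group r_int r_surj r_inj).
Qed.

Lemma AXC f x : AX 1 (AX 2%:R f) x = AX 2%:R (AX 1 f) x.
Proof.
rewrite -(vliftK x) AX1_proj AX2_proj.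
rewrite [LHS](eq_nsum outs _ (g := nsum ins (f \o pr))) => [|v]; last exact: AX2_proj.
rewrite [RHS](eq_nsum ins _ (g := nsum outs (f \o pr))) => [|v]; last exact: AX1_proj.
exact: (nsumC Hpl (f \o pr) (vlift x)).
Qed.

Lemma sum_fibers (xs : seq (qvertex Gamma)) (s : seq (vertex F)) f :
  uniq xs -> (forall x, x \in xs) ->
  \sum_(w <- s) f (pr w) = \sum_(y <- xs) f y *+ count (fun w => pr w == y) s.
Proof.
move=> ux mx.
transitivity (\sum_(w <- s) \sum_(y <- xs | pr w == y) f y).
  apply: eq_bigr => w _; rewrite -big_filter (_ : [seq y <- xs | pr w == y] = [:: pr w]) ?big_seq1//.
  apply: perm_small_eq => //; apply: uniq_perm; rewrite ?filter_uniq// => y.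
  by rewrite mem_filter mem_seq1 mx andbT eq_sym.
rewrite (exchange_big_dep predT)//=; apply: eq_bigr => y _.
by rewrite big_const_seq iter_addr_0.
Qed.

(** By [count_fiber] the conjugate transpose of the matrix of A_1 represents A_2. The matrix is
    therefore normal, and diagonalizing it unitarily gives joint eigenvectors with conjugate
    eigenvalues. *)
Lemma joint_eigenbasis : exists (n : nat) (e : 'I_n -> qvertex Gamma -> C) (lam : 'I_n -> C),
  [/\ (forall i, [/\ eigenfunction (AX 1) (lam i) (e i) &
                 eigenfunction (AX 2%:R) (lam i)^*%C (e i)]),
   forall a, lin_comb e a = (fun=> 0) -> forall i, a i = 0 &
   forall f, exists a, f = lin_comb e a].
Proof.
have [xs [ux mx]] := qvertex_finite Gamma_group Gamma_cocompact.
set n := size xs; exists n.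
have idx_lt (x : qvertex Gamma) : (index x xs < n)%N by rewrite index_mem.
pose idx (x : qvertex Gamma) : 'I_n := Ordinal (idx_lt x).
pose X (i : 'I_n) : qvertex Gamma := tnth (in_tuple xs) i.
have XK x : X (idx x) = x by rewrite /X (tnth_nth x) nth_index.
have idxK i : idx (X i) = i.
  by apply: val_inj; rewrite /= /X (tnth_nth (X i)) index_uniq.
(* Several neighbours of one lift may lie in the same orbit, so the matrix counts multiplicities. *)
pose N (x y : qvertex Gamma) := count (fun w => pr w == y) (outs (vlift x)).
pose A : 'M[C]_n := \matrix_(i, j) (N (X j) (X i))%:R.
pose row_of f : 'rV[C]_n := \row_i f (X i).
have sumX (h : qvertex Gamma -> C) : \sum_(y <- xs) h y = \sum_i h (X i).
  by rewrite big_tnth.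
have rowA f : row_of f *m A = row_of (AX 1 f).
  apply/rowP => j; rewrite !mxE /AX /quotient_op (Aop1E r_int r_surj r_inj) /nsum /=.
  rewrite (sum_fibers _ _ ux mx) sumX; apply: eq_bigr => i _.
  by rewrite !mxE mulr_natr.
pose A' : 'M[C]_n := map_mx Num.conj A^T.
have rowA' f : row_of f *m A' = row_of (AX 2%:R f).
  apply/rowP => j; rewrite !mxE /AX /quotient_op (Aop2E r_int r_surj r_inj) /nsum /=.
  rewrite (sum_fibers _ _ ux mx) sumX; apply: eq_bigr => i _.
  rewrite !mxE conjC_nat mulr_natr; congr (_ *+ _).
  rewrite -{1}(vliftK (X j)) -{2}(vliftK (X i)).
  exact: (count_fiber Gamma_group Gamma_free r_int r_surj r_inj).
have rowK (u : 'rV[C]_n) : row_of (fun x : qvertex Gamma => u 0 (idx x)) = u.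
  by apply/rowP => i; rewrite mxE idxK.
have Anormal : A \is normalmx.
  apply/normalmxP/row_matrixP => i; rewrite -/A' !rowE !mulmxA.
  rewrite -(rowK (delta_mx 0 i)) rowA !rowA' rowA.
  by apply/rowP => j; rewrite !mxE AXC.
have /orthomx_spectralP := Anormal.
set P := spectralmx A; set d := spectral_diag A => AE.
have Pu : P \in unitmx by apply: spectral_unit.
have PA : P *m A = diag_mx d *m P by rewrite {1}AE !mulmxA mulmxV// mul1mx.
have PA' : P *m A' = diag_mx (map_mx Num.conj d) *m P.
  have PV : invmx P = map_mx Num.conj P^T by rewrite invmx_unitary// spectral_unitarymx.
  have -> : A' = invmx P *m diag_mx (map_mx Num.conj d) *m P.
    rewrite /A' {1}AE PV !trmx_mul !map_mxM tr_diag_mx map_diag_mx mulmxA.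
    congr (_ *m _ *m _); rewrite map_trmx trmxK -map_mx_comp.
    by apply/matrixP => i j; rewrite !mxE /= conjCK.
  by rewrite !mulmxA mulmxV// mul1mx.
pose e i (x : qvertex Gamma) := P i (idx x); pose lam i := d 0 i.
have row_e i : row_of (e i) = row i P by apply/rowP => j; rewrite !mxE /e idxK.
have e_neq0 i : exists x, e i x <> 0.
  apply/not_existsP => e0; have : row i P = 0.
    by apply/rowP => j; rewrite -row_e !mxE; apply/eqP/negPn/negP => /eqP; exact: e0.
  move=> Pi0; have := congr1 (row i) (mulmxV Pu); rewrite row_mul Pi0 mul0mx.
  by move=> /rowP/(_ i)/eqP; rewrite !mxE eqxx eq_sym oner_eq0.
exists e, lam; split=> [i|a a0 i|f]; last first.
- exists (fun i => (row_of f *m invmx P) 0 i); apply/funext => x; rewrite /lin_comb.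
  transitivity ((row_of f *m invmx P *m P) 0 (idx x)).
    by rewrite mulmxKV// mxE XK.
  by rewrite mxE.
- have aP : (\row_j a j) *m P = 0.
    apply/rowP => j; rewrite !mxE; have := congr1 (@^~ (X j)) a0.
    rewrite /lin_comb /= => a0j; rewrite -[RHS]a0j.
    by apply: eq_bigr => l _; rewrite /e idxK mxE.
  have := mulmxK Pu (\row_j a j); rewrite aP mul0mx => /rowP/(_ i).
  by rewrite !mxE.
  split; split=> // x.
    have := rowA (e i); rewrite row_e -row_mul PA mul_diag_mx => /rowP/(_ (idx x)).
    by rewrite !mxE XK => <-.
  have := rowA' (e i); rewrite row_e -row_mul PA' mul_diag_mx => /rowP/(_ (idx x)).
  by rewrite !mxE XK => <-.
Qed.

Lemma geodesic_opXE m f x : geodesic_opX m f x =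
  gsum outs m (f \o pr) (vlift x) + gsum ins m (f \o pr) (vlift x).
Proof. by rewrite /geodesic_opX /quotient_op (geodesic_opE r_int r_surj r_inj). Qed.

Lemma geodesic_opX_eigen m lam mu e :
  (forall x, AX 1 e x = lam * e x) -> (forall x, AX 2%:R e x = mu * e x) ->
  forall x, geodesic_opX m e x = (geo_eig q lam mu m + geo_eig q mu lam m) * e x.
Proof.
move=> e1 e2 x.
have A v : nsum outs (e \o pr) v = lam * (e \o pr) v.
  by rewrite -AX1_proj e1.
have B v : nsum ins (e \o pr) v = mu * (e \o pr) v.
  by rewrite -AX2_proj e2.
rewrite geodesic_opXE (gsum_eigen Hpl A B) (gsum_eigen (plane_links_rev Hpl) B A).
by rewrite /= vliftK mulrDl.
Qed.

Lemma geodesic_opX_comb m n (e : 'I_n -> qvertex Gamma -> C) a x :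
  geodesic_opX m (lin_comb e a) x = \sum_i a i * geodesic_opX m (e i) x.
Proof.
rewrite geodesic_opXE /gsum /= /lin_comb exchange_big /= [X in _ + X]exchange_big /=.
rewrite -big_split /=; apply: eq_bigr => i _.
by rewrite geodesic_opXE mulrDr /gsum /= !mulr_sumr.
Qed.

Lemma normc_nat k : ComplexField.Normc.normc (k%:R : C) = k%:R.
Proof.
rewrite -(rmorph_nat (real_complex R)) /= expr0n addr0 sqrtr_sqr ger0_norm//.
Qed.

Lemma normc_conj (z : C) : ComplexField.Normc.normc z^*%C = ComplexField.Normc.normc z.
Proof. by case: z => a b /=; rewrite sqrrN. Qed.

Lemma normcC (z : C) : `|z| = (ComplexField.Normc.normc z)%:C%C.
Proof. by []. Qed.

Hypothesis Hram : ramanujan R Gamma q.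

Lemma nontrivial_bound m mu : nontrivial_eigenvalue R Gamma q m mu ->
  ComplexField.Normc.normc mu <= 2 * geo_eig q (3 * q%:R) (3 * q%:R) m.
Proof.
move=> [f [[fne0 feig] fspan]].
have [n [e [lam [eP efree espan]]]] :=
  joint_eigenbasis.
have [a fE] := espan f.
pose mui i := geo_eig q (lam i) (lam i)^*%C m + geo_eig q (lam i)^*%C (lam i) m.
have eig i x : geodesic_opX m (e i) x = mui i * e i x.
  by have [[_ e1] [_ e2]] := eP i; apply: geodesic_opX_eigen.
have aE i : a i * (mui i - mu) = 0.
  apply: (efree (fun i => a i * (mui i - mu))); apply/funext => x; rewrite /lin_comb.
  have H := feig x; rewrite {1}fE geodesic_opX_comb fE /lin_comb mulr_sumr in H.
  transitivity (\sum_i a i * geodesic_opX m (e i) x - \sum_i mu * (a i * e i x)).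
    by rewrite -sumrB; apply: eq_bigr => j _; rewrite eig; ring.
  by rewrite H subrr.
have [i ai0 ntriv] : exists2 i, a i != 0 & ~ trivial_eigenfunction q (e i).
  apply/not_exists2P => H; apply: fspan.
  have trivi i : a i != 0 -> trivial_eigenfunction q (e i).
    by move=> ai; apply: contrapT => nt; have [|] := H i.
  have [i0 ai0] : exists i0, a i0 != 0.
    apply/not_existsP => a0; have [x] := fne0; rewrite fE; apply.
    rewrite /lin_comb big1// => i _.
    by have /negP/negPn/eqP -> := a0 i; rewrite mul0r.
  (* [span_of] asks every listed function to be trivial, so those with coefficient 0 are replaced by
     e i0. *)
  exists n, (fun i => if a i == 0 then e i0 else e i), a; split.
    by move=> i; case: ifPn => [_|/trivi//]; apply: trivi.
  rewrite fE; apply/funext => x; rewrite /lin_comb; apply: eq_bigr => i _.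
  by case: ifP => // /eqP ->; rewrite !mul0r.
have mE : mu = mui i.
  by have /eqP := aE i; rewrite mulf_eq0 (negbTE ai0) subr_eq0 => /eqP.
have [E1 E2] := eP i.
(* If lam i had the trivial modulus, so would its conjugate, the eigenvalue of A_2, and e i would be
   trivial. *)
have spec : l2_spectrum (@Aop C F 1) (lam i).
  have [|triv|//] := Hram (j := 1) (or_introl erefl) (lam := lam i); first by exists (e i).
  exfalso; apply: ntriv => j [->|->]; first by exists (lam i).
  by exists (lam i)^*%C => //; rewrite /Aop_trivial normc_conj.
rewrite (_ : @Aop C F 1 = nsum outs (Z := C)) in spec; last first.
  by apply/funext => h; rewrite (Aop1E r_int r_surj r_inj).
have q_gt0 : (0 < q)%N by rewrite ltnW.
have B := spectrum_geo_eig_le Hpl q_gt1 (@psi_gt0 F q R q_gt0)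
  (@psi_outs F q r r_int r_surj r_inj R q_gt0) (@psi_ins F q r r_int r_surj r_inj R q_gt0) m spec.
have B' : `|geo_eig q (lam i)^*%C (lam i) m| <= geo_eig q (3 * q%:R) (3 * q%:R) m.
  rewrite -{2}(conjcK (lam i)) -(rmorph_geo_eig (@conjc R)).
  rewrite normcC normc_conj -normcC; exact: B.
have cE : geo_eig q (3 * q%:R) (3 * q%:R) m = (geo_eig q (3 * q%:R) (3 * q%:R) m)%:C%C :> C.
  rewrite (rmorph_geo_eig (real_complex R)); congr geo_eig; by rewrite rmorphM !rmorph_nat.
rewrite -lecR -normcC mE /mui.
have -> (x : R) : (2 * x)%:C%C = x%:C%C + x%:C%C by rewrite mulr_natl mulr2n rmorphD.
rewrite -cE; exact: le_trans (ler_normD _ _) (lerD B B').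
Qed.

(** * The trivial spectrum *)

Local Notation normc := ComplexField.Normc.normc.
Let mem_outs v w : w \in outs v <-> edge1 v w := mem_out_nbrs r_int r_surj v w.
Implicit Types zeta : C.
Let d : nat := (q ^ 2 + q + 1)%N.

Lemma d_gt0 : (0 < d)%N. Proof. by rewrite /d addn1. Qed.

Definition chi zeta v : C := zeta ^+ (color v).

Lemma chi_edge zeta v w : zeta ^+ 3 = 1 -> edge1 v w -> chi zeta w = zeta * chi zeta v.
Proof.
move=> z3 [_ vw]; rewrite /chi -exprS.
have -> : color w = color v + 1 by rewrite -vw /edge_color addrC subrK.
have -> : nat_of_ord (color v + 1 : 'Z_3) = ((color v).+1 %% 3)%N.
  by rewrite /= modnDmr addn1.
by rewrite expr_mod.
Qed.

Lemma chi_outs zeta v : zeta ^+ 3 = 1 ->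
  nsum outs (chi zeta) v = d%:R * zeta * chi zeta v.
Proof.
move=> z3; rewrite /nsum (eq_big_seq (fun=> zeta * chi zeta v)) => [|w /mem_outs vw].
  by rewrite big_const_seq iter_addr_0 count_predT (size_outs Hpl) -[LHS]mulr_natl mulrA.
exact: chi_edge.
Qed.

Lemma chi_ins zeta v : zeta ^+ 3 = 1 ->
  nsum ins (chi zeta) v = d%:R * zeta ^+ 2 * chi zeta v.
Proof.
move=> z3; rewrite /nsum (eq_big_seq (fun=> zeta ^+ 2 * chi zeta v)) => [|w].
  by rewrite big_const_seq iter_addr_0 count_predT (size_ins Hpl) -[LHS]mulr_natl mulrA.
rewrite (mem_ins Hpl) => /mem_outs wv.
by rewrite (chi_edge z3 wv) mulrA -exprSr z3 mul1r.
Qed.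

(** On zeta^color each of the d q^(2m) geodesics from a vertex contributes the same factor
    zeta^(m+1); the recursion confirms this once powers of zeta^3 = 1 are inserted. *)
Lemma geo_eig_trivial zeta m : zeta ^+ 3 = 1 ->
  geo_eig q (d%:R * zeta) (d%:R * zeta ^+ 2) m.+1 =
  d%:R * q%:R ^+ (2 * m) * zeta ^+ m.+1.
Proof.
move=> z3; have dE : d%:R = q%:R ^+ 2 + q%:R + 1 :> C by rewrite /d !natrD natrX.
elim/nat_ind3: m => [|||m P0 P1 P2].
- by rewrite /= muln0; ring.
- rewrite /= dE -[q.+1%:R]natr1; ring.
- rewrite [LHS]/= natrM -/d dE -[q.+1%:R]natr1.
  have -> : (q%:R ^+ 2 + q%:R + 1) * q%:R = (q%:R ^+ 2 + q%:R + 1) * q%:R * zeta ^+ 3 :> C.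
    by rewrite z3 mulr1.
  rewrite (_ : 2 * 2 = 4)%N//; ring.
rewrite geo_eigS P0 P1 P2 natrX dE.
have -> : (2 * m.+2 = 4 + 2 * m)%N by lia.
have -> : (2 * m.+1 = 2 + 2 * m)%N by lia.
have -> : (2 * m.+3 = 6 + 2 * m)%N by lia.
have -> : zeta ^+ m.+1 = zeta ^+ 3 * zeta ^+ m.+1 by rewrite z3 mul1r.
by rewrite !(exprD _ _ (2 * m)) !exprS expr0; ring.
Qed.

Lemma normc_root zeta : zeta ^+ 3 = 1 -> normc zeta = 1.
Proof.
move=> z3; apply: (@complexI R); rewrite -normcC.
have : `|zeta| ^+ 3 = 1 by rewrite -normrX z3 normr1.
by move/eqP; rewrite pexpr_eq1// => /eqP.
Qed.

Section Character.
Variable zeta : C.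
Hypothesis zeta3 : zeta ^+ 3 = 1.
Hypothesis chi_act : forall g v, Gamma g -> chi zeta (act g v) = chi zeta v.

Definition chiX (x : qvertex Gamma) : C := chi zeta (vlift x).

Lemma chiX_proj : chiX \o pr = chi zeta.
Proof.
apply/funext => v; rewrite /chiX /=; have [g gG vE] := vlift_act Gamma_group v.
by rewrite [in RHS]vE chi_act.
Qed.

Lemma chi_neq0 v : chi zeta v != 0.
Proof.
rewrite expf_neq0//; apply: contra_eq_neq zeta3 => ->.
by rewrite expr0n eq_sym oner_eq0.
Qed.

Lemma chiX_AX1 x : AX 1 chiX x = d%:R * zeta * chiX x.
Proof.
rewrite -{1}(vliftK x) AX1_proj chiX_proj.
exact: chi_outs.
Qed.

Lemma chiX_AX2 x : AX 2%:R chiX x = d%:R * zeta ^+ 2 * chiX x.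
Proof.
rewrite -{1}(vliftK x) AX2_proj chiX_proj.
exact: chi_ins.
Qed.

Lemma chiX_nonzero : exists x, chiX x <> 0.
Proof. by exists (pr (vx 1%:M)); apply/eqP/chi_neq0. Qed.

Lemma chiX_trivial : trivial_eigenfunction q chiX.
Proof.
have nd k : (normc (d%:R * zeta ^+ k) = d%:R).
  rewrite ComplexField.Normc.normcM normc_nat normc_root ?mulr1//.
  by rewrite -exprM mulnC exprM zeta3 expr1n.
move=> j [->|->].
  exists (d%:R * zeta); last by have := nd 1%N; rewrite expr1.
  by split; [exact: chiX_nonzero|exact: chiX_AX1].
exists (d%:R * zeta ^+ 2); last exact: nd.
by split; [exact: chiX_nonzero|exact: chiX_AX2].
Qed.

Lemma chiX_geodesic m : (0 < m)%N -> eigenfunction (geodesic_opX m)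
  ((d * q ^ (2 * (m - 1)))%:R * (zeta ^+ m + zeta ^+ (2 * m))) chiX.
Proof.
case: m => // m _; split; first exact: chiX_nonzero.
move=> x; rewrite (geodesic_opX_eigen m.+1 chiX_AX1 chiX_AX2).
congr (_ * _); rewrite geo_eig_trivial//.
(* In the reverse direction zeta^2 takes the place of zeta, with (zeta^2)^2 = zeta. *)
have z23 : (zeta ^+ 2) ^+ 3 = 1 by rewrite exprAC zeta3 expr1n.
have z4 : zeta = (zeta ^+ 2) ^+ 2 by rewrite -exprM -[in LHS](mulr1 zeta) -zeta3 -exprS.
rewrite [X in geo_eig q _ (_ * X)]z4 geo_eig_trivial// subn1 /= natrM natrX.
by rewrite -!exprM; ring.
Qed.

End Character.

(** Maximum principle: equality in the triangle inequality at a vertex of maximal modulus passes to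
    its out-neighbours and, by [edge1_reach], to all vertices. *)
Lemma trivial_is_chi f : trivial_eigenfunction q f ->
  exists zeta c, [/\ zeta ^+ 3 = 1, c != 0 & forall v, f (pr v) = c * chi zeta v].
Proof.
move=> /(_ 1 (or_introl erefl)) [lam [[y0 fy0] feig] lamd].
have [xs [ux mx]] := qvertex_finite Gamma_group Gamma_cocompact.
have A v : nsum outs (f \o pr) v = lam * f (pr v).
  by rewrite -AX1_proj feig.
have d0 : d%:R != 0 :> C by rewrite pnatr_eq0 -lt0n d_gt0.
have dR0 : 0 < d%:R :> R by rewrite ltr0n d_gt0.
have [zeta lamE] : exists zeta, lam = d%:R * zeta.
  by exists (lam / d%:R); rewrite mulrC divfK.
have nzeta : normsq zeta = 1.
  have : normsq lam = d%:R ^+ 2 by rewrite -normc_sqr lamd.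
  rewrite lamE normsqM -normc_sqr normc_nat -[RHS]mulr1 => /mulfI; apply.
  by rewrite expf_neq0// gt_eqF.
have [x0 x0max] : exists x0, forall x, normsq (f x) <= normsq (f x0).
  have ix : (index y0 xs < size xs)%N by rewrite index_mem.
  pose i0 := [arg max_(i > Ordinal ix) normsq (f (tnth (in_tuple xs) i))]%O.
  exists (tnth (in_tuple xs) i0) => x.
  have jx : (index x xs < size xs)%N by rewrite index_mem.
  have -> : x = tnth (in_tuple xs) (Ordinal jx) by rewrite (tnth_nth x) nth_index.
  by rewrite /i0; case: arg_maxP => // i _; apply.
pose M := normsq (f x0).
have M_gt0 : 0 < M.
  rewrite lt_neqAle eq_sym normsq_ge0 andbT; apply/eqP => M0.
  apply: fy0; have := x0max y0; rewrite -/M M0 => le0.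
  have : normsq (f y0) = 0 by apply/eqP; rewrite eq_le le0 normsq_ge0.
  move/eqP; rewrite paddr_eq0 ?sqr_ge0// !sqrf_eq0 => E.
  by apply/eqP; rewrite eq_complex.
(* Expanding the sum of |f(u) - zeta f(v)|^2 over the out-neighbours u of v gives at most d M + d M
   - 2 d M = 0. *)
have equal v w : normsq (f (pr v)) = M -> w \in outs v -> f (pr w) = zeta * f (pr v).
  move=> vM wv; apply/eqP; rewrite -subr_eq0.
  suff : \sum_(u <- outs v) normsq (f (pr u) - zeta * f (pr v)) <= 0.
    rewrite (bigD1_seq w) ?(outs_uniq Hpl)//= => le0.
    have : normsq (f (pr w) - zeta * f (pr v)) <= 0.
      apply: le_trans le0; rewrite lerDl; apply: sumr_ge0 => u _; exact: normsq_ge0.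
    rewrite le_eqVlt ltNge normsq_ge0 orbF paddr_eq0 ?sqr_ge0// !sqrf_eq0 => E.
    by rewrite eq_complex; exact: E.
  set b := zeta * f (pr v).
  have nb : normsq b = M by rewrite normsqM nzeta mul1r.
  have sumE : \sum_(u <- outs v) f (pr u) = d%:R * b by rewrite -/(nsum _ _ _) A lamE /b mulrA.
  have -> : \sum_(u <- outs v) normsq (f (pr u) - b) = \sum_(u <- outs v) normsq (f (pr u))
     + d%:R * M - 2 * (Re (\sum_(u <- outs v) f (pr u)) * Re b + Im (\sum_(u <- outs v) f (pr u)) * Im b).
    have -> : d%:R * M = \sum_(u <- outs v) normsq b.
      by rewrite big_const_seq iter_addr_0 count_predT (size_outs Hpl) nb mulr_natl.
    rewrite Re_sum Im_sum !mulr_suml -!big_split /= mulr_sumr -sumrB.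
    by apply: eq_bigr => u _; rewrite /normsq ReD ImD ReN ImN; ring.
  have dE (z : C) : Re (d%:R * z) = d%:R * Re z /\ Im (d%:R * z) = d%:R * Im z.
    by rewrite ReM ImM -(rmorph_nat (real_complex R)) /= !mul0r subr0 addr0.
  rewrite sumE; have [-> ->] := dE b.
  have : \sum_(u <- outs v) normsq (f (pr u)) <= d%:R * M.
    apply: (@le_trans _ _ (\sum_(u <- outs v) M)); first exact: ler_sum.
    by rewrite big_const_seq iter_addr_0 count_predT (size_outs Hpl) mulr_natl.
  by rewrite -nb /normsq; lra.
have allM v : normsq (f (pr v)) = M.
  apply: (@edge1_reach _ _ _ r_int r_surj (fun v => normsq (f (pr v)) = M) (vlift x0)).
    by rewrite vliftK.
  move=> u w /mem_outs uw uM; rewrite (equal u w)// normsqM nzeta mul1r//.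
(* Going once around a triangle multiplies the nonzero value of f by zeta^3. *)
have zeta3 : zeta ^+ 3 = 1.
  pose v := vx (1%:M : 'M[F]_3).
  have [w wv] : exists w, w \in outs v.
    have : (0 < size (outs v))%N by rewrite (size_outs Hpl) d_gt0.
    by case: (outs v) => // w l _; exists w; rewrite mem_head.
  have [u uw vu] : exists2 u, u \in outs w & v \in outs u.
    by apply/hasP; rewrite has_count (triangle_count Hpl wv).
  have fv0 : f (pr v) != 0.
    by apply: contraTneq M_gt0 => fv; rewrite -(allM v) fv normsq0 ltxx.
  have := equal u v (allM u) vu; rewrite (equal w u (allM w) uw) (equal v w (allM v) wv).
  rewrite !mulrA -{1}[f (pr v)]mul1r => /(mulIf fv0) ->.
  by rewrite !exprS expr0 mulr1 mulrA.
pose v0 := vlift x0; pose c := f x0 / chi zeta v0.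
have chi0 v : chi zeta v != 0 by apply: chi_neq0.
exists zeta, c; split=> //.
  rewrite mulf_neq0 ?invr_eq0//; apply: contraTneq M_gt0 => fx.
  by rewrite /M fx normsq0 ltxx.
apply: (@edge1_reach _ _ _ r_int r_surj (fun v => f (pr v) = c * chi zeta v) v0).
  by rewrite /v0 vliftK /c divfK.
move=> u w uw fu; rewrite (equal u w (allM u)) ?fu; last exact/mem_outs.
by rewrite (chi_edge zeta3 uw) mulrCA.
Qed.

Variable m : nat.
Hypothesis m_gt0 : (0 < m)%N.
Local Notation k := (2 * (q ^ 2 + q + 1) * q ^ (2 * (m - 1)))%N.
Let kE : (k%:R : C) = 2 * ((q ^ 2 + q + 1) * q ^ (2 * (m - 1)))%:R.
Proof. by rewrite -mulnA natrM. Qed.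

Lemma trivial_spectrum_nontripartite : ~ tripartite Gamma ->
  trivial_spectrum Gamma q m [:: k%:R : C].
Proof.
move=> ntri; have [g [gG [v [w [gvw cvw]]]]] : exists g, Gamma g /\
    exists v w, moves g v w /\ color w != color v.
  apply: contrapT => H; apply: ntri => g gG v w gvw; apply/eqP; apply: contrapT => /negP E.
  by apply: H; exists g; split=> //; exists v, w.
have one3 : (1 : C) ^+ 3 = 1 by rewrite expr1n.
have act1 g' v' : Gamma g' -> chi (1 : C) (act g' v') = chi 1 v'.
  by rewrite /chi !expr1n.
exists (fun=> chiX 1); split.
- move=> i; split; first exact: (chiX_trivial one3 act1).
  have := chiX_geodesic one3 act1 m_gt0.
  by rewrite ord1 /= kE !expr1n mulrC.
- move=> a /(congr1 (fun h => h (pr v))); rewrite /lin_comb /= big_ord_recl big_ord0 addr0.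
  rewrite /chiX /chi expr1n mulr1 => a0 i; rewrite -[RHS]a0; congr a.
  by apply: val_inj; case: i => [[]].
move=> f /trivial_is_chi.
move=> [zeta [c [z3 c0 fE]]].
(* The values of f at v and g v agree although the colors differ. *)
have z1 : zeta = 1.
  apply: (cube_root_inj z3 _ cvw); apply: (mulfI c0); rewrite -/(chi zeta w) -/(chi zeta v) -!fE.
  congr f; symmetry; apply/(vproj_eqP Gamma_group); exists g => //.
  by apply/moves_act => //; apply: (Gunit Gamma_group).
exists (fun=> c); apply/funext => x; rewrite /lin_comb /= big_ord_recl big_ord0 addr0.
by rewrite -[in LHS](vliftK x) fE z1.
Qed.

Lemma trivial_spectrum_tripartite : tripartite Gamma ->
  let mu : C := if (3 %| m)%N then k%:R else - (k%:R / 2) in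
  trivial_spectrum Gamma q m [:: k%:R; mu; mu].
Proof.
move=> tri mu; have [w w0] : exists w : C, w ^+ 2 + w + 1 = 0.
  exists ((-1 + sqrtC (-3)) / 2).
  have -> (s : C) : ((-1 + s) / 2) ^+ 2 + (-1 + s) / 2 + 1 = (s ^+ 2 + 3) / 4 by field.
  by rewrite sqrtCK addNr mul0r.
have [w3 wP] := cube_root_powers w0.
have wi3 i : (w ^+ i) ^+ 3 = 1 by rewrite exprAC w3 expr1n.
have chi_act zeta g v : Gamma g -> chi (zeta : C) (act g v) = chi zeta v.
  move=> gG; rewrite /chi (tri g gG v)//.
  by apply/moves_act => //; apply: (Gunit Gamma_group).
have w20 : (w ^+ 2) ^+ 2 + w ^+ 2 + 1 = 0.
  by rewrite -[RHS](mul0r (w ^+ 2 - w + 1)) -w0; ring.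
exists (fun i => chiX (w ^+ i)); split.
- move=> i; split.
    exact: (chiX_trivial (wi3 i) (chi_act _)).
  have := chiX_geodesic (wi3 i) (chi_act _) m_gt0.
  suff -> : ((q ^ 2 + q + 1) * q ^ (2 * (m - 1)))%:R * ((w ^+ i) ^+ m + (w ^+ i) ^+ (2 * m)) =
    [:: k%:R; mu; mu]`_i :> C by [].
  have muE z : z ^+ 2 + z + 1 = 0 ->
      ((q ^ 2 + q + 1) * q ^ (2 * (m - 1)))%:R * (z ^+ m + z ^+ (2 * m)) = mu.
    move=> z0; rewrite (cube_root_power_sum m z0) /mu kE.
    by case: ifP => _; [rewrite mulrC|field].
  case: i => [[|[|[|//]]] /= _].
  + by rewrite expr0 !expr1n kE mulrC.
  + by rewrite muE ?expr1.
  + by rewrite muE.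
- move=> a a0 i.
  have sum0 v : \sum_(j < size [:: k%:R; mu; mu]) a j * chi (w ^+ j) v = 0.
    have := congr1 (fun h => h (pr v)) a0; rewrite /lin_comb => H; rewrite -[RHS]H.
    apply: eq_bigr => j _; congr (_ * _).
    by have := congr1 (fun h => h v) (chiX_proj (chi_act (w ^+ j))).
  have succ v : exists v', edge1 v v'.
    have : (0 < size (outs v))%N by rewrite (size_outs Hpl) addn1.
    by case E : (outs v) => [//|v' l] _; exists v'; apply/mem_outs; rewrite E mem_head.
  (* Along v0 -> v1 -> v2 the character of w^j is multiplied by w^j at each edge, so the relation at
     these vertices is the Fourier system of Z/3. *)
  pose v0 := vx (1%:M : 'M[F]_3).
  have [v1 e1] := succ v0; have [v2 e2] := succ v1.
  have b0 (j : 'I_3) : a j * chi (w ^+ j) v0 = 0.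
    have := sum0 v2; have := sum0 v1; have := sum0 v0.
    rewrite /= !big_ord_recl !big_ord0 !addr0.
    rewrite !(chi_edge (wi3 _) e2) !(chi_edge (wi3 _) e1) /= expr1.
    rewrite expr0 !mul1r => S0 S1 S2.
    have [|||B0 B1 B2] := cube_root_transform_inj (x := a ord0 * chi 1 v0)
      (y := a (lift ord0 ord0) * chi w v0)
      (z := a (lift ord0 (lift ord0 ord0)) * chi (w ^+ 2) v0) w0.
    - by rewrite -addrA.
    - by rewrite -[RHS]S1; ring.
    - by rewrite -[RHS]S2; ring.
    case: j => [[|[|[|//]]] jlt].
    - by rewrite (_ : Ordinal jlt = ord0) ?expr0//; apply: val_inj.
    - by rewrite (_ : Ordinal jlt = lift ord0 ord0) ?expr1//; apply: val_inj.
    - by rewrite (_ : Ordinal jlt = lift ord0 (lift ord0 ord0))//; apply: val_inj.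
  by have /eqP := b0 i; rewrite mulf_eq0 (negbTE (chi_neq0 (wi3 i) v0)) orbF => /eqP.
move=> f /trivial_is_chi.
move=> [zeta [c [z3 c0 fE]]]; have [i0 zE] := wP zeta z3.
exists (fun i => if i == i0 then c else 0); apply/funext => x; rewrite /lin_comb.
rewrite (bigD1 i0)//= eqxx big1 ?addr0 => [|i /negbTE ->]; last by rewrite mul0r.
by rewrite -[in LHS](vliftK x) fE zE.
Qed.

End QuotientSpectrum.

(** Integer powers accommodate m = 1, where the exponent m - 2 is negative and its coefficient
    vanishes. *)
Lemma geo_eig_max_expz (K : numFieldType) q m : (0 < q)%N -> (0 < m)%N ->
  2 * geo_eig q (3 * q%:R) (3 * q%:R) m =
  (m%:R ^+ 2 + 3 * m%:R + 2) * q%:R ^ m%:Z - 2 * (m%:R ^+ 2 - 1) * q%:R ^ (m%:Z - 1)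
  + (m%:R ^+ 2 - 3 * m%:R + 2) * q%:R ^ (m%:Z - 2) :> K.
Proof.
case: m => // m q0 _; have qn0 : q%:R != 0 :> K by rewrite pnatr_eq0 -lt0n.
apply: (mulfI (expf_neq0 2 qn0)).
rewrite mulrA (mulrC (q%:R ^+ 2)) geo_eig_max.
have -> : q%:R ^ (m.+1%:Z - 1) = q%:R ^+ m.+1 / q%:R :> K.
  by rewrite expfzDr// exprN1.
have -> : q%:R ^ (m.+1%:Z - 2) = q%:R ^+ m.+1 / q%:R ^+ 2 :> K.
  by rewrite expfzDr.
rewrite -exprnP -natr1; move: (q%:R ^+ m.+1) => Q; field.
exact: qn0.
Qed.

Lemma geo_eig_max_ratio (K : realFieldType) q m : (1 < q)%N -> (0 < m)%N ->
  2 * geo_eig q (3 * q%:R) (3 * q%:R) m / (2 * (q ^ 2 + q + 1) * q ^ (2 * (m - 1)))%:R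
  <= (m%:R ^+ 2 + 3 * m%:R + 2) / q%:R ^+ m :> K.
Proof.
case: m => // m q1 _; rewrite subn1 -[_.-1]/m; have q0 : (0 < q)%N by rewrite ltnW.
move: (geo_eig q _ _ _) (geo_eig_max K q m) => g G.
have qR0 : 0 < q%:R :> K by rewrite ltr0n.
have qR1 : 1 <= q%:R :> K by rewrite ler1n.
have m0 : 0 <= m%:R :> K by [].
have Q0 : 0 < q%:R ^+ m.+1 :> K by rewrite exprn_gt0.
rewrite ler_pdivrMr; last by rewrite ltr0n !muln_gt0 /= addn1 expn_gt0 q0.
rewrite [leRHS]mulrAC ler_pdivlMr// !natrM !natrD natrX natrX mulnC exprM.
rewrite -(ler_pM2l (exprn_gt0 2 qR0)).
have -> : q%:R ^+ 2 * (2 * g * q%:R ^+ m.+1) = 2 * q%:R ^+ 2 * g * q%:R ^+ m.+1 by ring.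
rewrite G.
have QE : q%:R ^+ m.+1 = q%:R * q%:R ^+ m :> K by rewrite exprS.
rewrite -[m.+1%:R]natr1; have P0 : 0 < q%:R ^+ m :> K by rewrite exprn_gt0.
rewrite QE; move: (m%:R : K) m0 (q%:R ^+ m) P0 => y y0 P P0.
move: (q%:R : K) qR0 qR1 => x x0 x1.
(* What remains of the difference after a square is split off. The only negative term y (y - 1) is
   dominated by 2 y (y + 2) x, since x >= 1. *)
set s := (X in X <= _); pose D : K := 2 * (y + 2) * (y + 3) * (x + 1) + 2 * y * (y + 2) * x - y * (y - 1)
  + (y + 2) * (y + 3) * x ^+ 2.
rewrite -subr_ge0 (_ : _ - s = P ^+ 2 * x ^+ 2 * D); last by rewrite /s /D; ring.
apply: mulr_ge0; first by rewrite mulr_ge0// exprn_ge0// ltW.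
rewrite /D; nra.
Qed.

Theorem theorem3p9 (R : realType) (F : localField) (q : nat)
    (hq : (residue_field F #= `I_q)%card)
    (Gamma : set 'M[F]_3) (hX : A2tilde_group R Gamma)
    (hRam : ramanujan R Gamma q) (m : nat) (hm : (1 <= m)%N) :
  let k := (2 * (q ^ 2 + q + 1) * q ^ (2 * (m - 1)))%N in
  let lambda := lambda_max R Gamma q m in
  [/\ (forall x : qvertex Gamma, (geodesic_terms m (vlift x) #= `I_k)%card),
      (forall mu, nontrivial_eigenvalue R Gamma q m mu ->
         ComplexField.Normc.normc mu <= lambda),
      lambda <= (m%:R ^+ 2 + 3 * m%:R + 2) * q%:R ^ m%:Z
                - 2 * (m%:R ^+ 2 - 1) * q%:R ^ (m%:Z - 1)
                + (m%:R ^+ 2 - 3 * m%:R + 2) * q%:R ^ (m%:Z - 2),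
      lambda / k%:R <= (m%:R ^+ 2 + 3 * m%:R + 2) / q%:R ^+ m &
      [/\ ~ tripartite Gamma ->
            trivial_spectrum Gamma q m [:: k%:R : R[i]],
          tripartite Gamma -> ~~ (3 %| m)%N ->
            trivial_spectrum Gamma q m
              [:: k%:R : R[i]; - (k%:R / 2); - (k%:R / 2)] &
          tripartite Gamma -> (3 %| m)%N ->
            trivial_spectrum Gamma q m [:: k%:R : R[i]; k%:R; k%:R]]].
Proof.
move=> k lambda; have [Gamma_group _ Gamma_cocompact Gamma_free] := hX.
have q_gt1 := residue_gt1 hq.
have [r [r_int r_surj r_inj]] := residue_system hq.
set A := [set ComplexField.Normc.normc mu | mu in nontrivial_eigenvalue R Gamma q m].
have Aub : ubound A (2 * geo_eig q (3 * q%:R) (3 * q%:R) m).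
  move=> _ [mu mueig <-].
  exact: (nontrivial_bound Gamma_group Gamma_free Gamma_cocompact q_gt1 r_int r_surj r_inj).
have lambda_le : lambda <= 2 * geo_eig q (3 * q%:R) (3 * q%:R) m.
  (* Without nontrivial eigenvalues the supremum takes its default value 0. *)
  have [A0|/set0P An0] := eqVneq A set0; last exact: ge_sup.
  by rewrite /lambda /lambda_max -/A A0 sup0 mulr_ge0// geo_eig_max_ge0.
split.
- by move=> x; apply: (card_geodesic_terms r_int r_surj r_inj).
- move=> mu mueig; apply: ub_le_sup; last by exists mu.
  by exists (2 * geo_eig q (3 * q%:R) (3 * q%:R) m).
- by rewrite -geo_eig_max_expz// ltnW.
- by apply: le_trans (geo_eig_max_ratio _ q_gt1 hm); rewrite ler_wpM2r// invr_ge0.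
have tri := @trivial_spectrum_tripartite R _ _ Gamma_group Gamma_cocompact _ _ q_gt1 r_int r_surj r_inj _ hm.
split; first exact: (@trivial_spectrum_nontripartite R _ _ Gamma_group Gamma_cocompact _ _ q_gt1 r_int r_surj r_inj).
  by move=> /tri /= + /negbTE; case: ifP.
by move=> /tri /=; case: ifP.
Qed.
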